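(* Let $n$ and $d$ be integers such that $n\ge 2$ and $d\ge 3$, and let $N=\binom{n+d}{n}-1$. Let $\nu_d:\mathbb{P}^n\to \mathrm{V}_n^d\subset\mathbb{P}^N$ be the $d$-Veronese embedding. \begin{itemize} \item If $r=\left\lceil\frac{d+2}{2}\right\rceil$, then $\mathrm{Ter}_r(\mathrm{V}_n^d)=\overline{\{\nu_d(S)\mid S\in(\mathbb{P}^n)^{(r)}\text{ is contained in a line}\}}$. In particular, it is irreducible of dimension $2n+r-2$. \item $\mathrm{Ter}_4(\mathrm{V}_n^3)=\overline{\{\nu_3(S)\mid S\in(\mathbb{P}^n)^{(4)}\text{ is contained in a plane}\}}$. In particular, it is irreducible of dimension $3n+2$. \item If $d\geq 4$ and $r=\left\lceil\frac{d+2}{2}\right\rceil+1$, then \[\mathrm{Ter}_r(\mathrm{V}_n^d)=\overline{\{\nu_d(S\cup\{p\})\mid S\in(\mathbb{P}^n)^{(r-1)}\text{ is contained in a line and } p\in\mathbb{P}^n\setminus S\}}.\] In particular, it is irreducible of dimension $3n+r-3$. \end{itemize}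
   Context: The base field $\mathbb{K}$ is algebraically closed of characteristic $0$. $\mathrm{V}_n^d$ is the image of the embedding $\nu_d$ of $\mathbb{P}^n$ by the complete linear system of degree $d$ hypersurfaces. For a variety $V$, $V^{(r)}$ denotes the variety of unordered sets of $r$ distinct points of $V$. For a nondegenerate irreducible variety $X\subset\mathbb{P}^N$ with set of smooth points $X_{sm}$ and embedded tangent spaces $T_pX$, the $r$-Terracini locus is \[\mathrm{Ter}_r(X)=\overline{\{\{p_1,\ldots,p_r\}\in X_{sm}^{(r)}\mid \dim\langle T_{p_1}X,\ldots,T_{p_r}X\rangle<r(\dim X+1)-1\}},\] where $\langle\cdot\rangle$ denotes linear span and the closure is taken in $X_{sm}^{(r)}$. Closures in the claim are taken in $(\mathrm{V}_n^d)^{(r)}$ (for the relevant $d$ and $r$). *)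

(* Defs.v *)
From HB Require Import structures.
From mathcomp Require Import all_boot all_order all_algebra finmap.
From mathcomp Require Import mpoly.
From mathcomp Require Import all_classical topology.

Set Implicit Arguments.
Unset Strict Implicit.
Unset Printing Implicit Defensive.

Import GRing.Theory.

Local Open Scope classical_set_scope.
Local Open Scope ring_scope.

(* Dimension theory of a topological space T: a subset A of T always carries
   the subspace topology. *)
Section Dimension.
Context {T : topologicalType}.
Implicit Types A : set T.

Definition closed_in A (Z : set T) := exists2 C, closed C & Z = A `&` C.

Definition closure_in A (Z : set T) := A `&` closure Z.

Definition irreducible_set A := A !=set0 /\
  forall C1 C2, closed C1 -> closed C2 ->
    A `<=` C1 `|` C2 -> A `<=` C1 \/ A `<=` C2.

Definition irr_chain A (k : nat) (Z : nat -> set T) :=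
  (forall i, (i <= k)%N -> closed_in A (Z i) /\ irreducible_set (Z i)) /\
  (forall i, (i < k)%N -> Z i `<` Z i.+1).

(* Krull dimension of A. *)
Definition has_dim A (k : nat) :=
  (exists Z, irr_chain A k Z) /\ forall l Z, irr_chain A l Z -> (l <= k)%N.

End Dimension.

(* The points of P^m are the lines through the origin of K^(m+1). *)
Definition projspace (K : fieldType) (m : nat) :=
  {p : {vspace 'rV[K]_m.+1} | \dim p == 1%N}.

HB.instance Definition _ (K : fieldType) m := SubChoice.on (projspace K m).

Section Projective.
Context {K : fieldType}.
Implicit Types m r e : nat.

(* Homogeneous coordinates.  All uses below are insensitive to the choice of
   the representative. *)
Definition rep m (p : projspace K m) : 'rV[K]_m.+1 := vpick (val p).

Lemma rep_neq0 m (p : projspace K m) : rep p != 0.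
Proof. by rewrite vpick0 -dimv_eq0 (eqP (valP p)). Qed.

Definition hval m (F : {mpoly K[m.+1]}) (p : projspace K m) : K :=
  F.@[fun j => rep p 0 j].

Definition proj_basic m : set (set (projspace K m)) :=
  [set U | exists F e, F \is e.-homog /\ U = [set p | hval F p != 0]].

HB.instance Definition _ m :=
  isSubBaseTopological.Build (projspace K m) (@proj_basic m) id.

(* Multihomogeneous polynomials in r blocks of m + 1 variables, the j-th
   variable of the block i having index mxvec_index i j. *)
Definition multihomog m r (F : {mpoly K[r * m.+1]}) :=
  exists e : 'I_r -> nat, forall u, u \in msupp F ->
    forall i, (\sum_(j < m.+1) u (mxvec_index i j))%N = e i.

Definition mhval m r (F : {mpoly K[r * m.+1]})
    (t : r.-tuple (projspace K m)) : K :=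
  F.@[fun k => mxvec (\matrix_(i < r, j < m.+1) rep (tnth t i) 0 j) 0 k].

End Projective.

(* Ordered r-tuples of distinct points of P^m, with the topology induced by
   the Zariski topology of the product variety (P^m)^r. *)
Definition dtuple (K : fieldType) (m r : nat) :=
  {t : r.-tuple (projspace K m) | uniq t}.

HB.instance Definition _ (K : fieldType) m r := SubChoice.on (dtuple K m r).

Definition dtuple_basic (K : fieldType) m r : set (set (dtuple K m r)) :=
  [set U | exists F, multihomog F /\ U = [set t | mhval F (val t) != 0]].

HB.instance Definition _ (K : fieldType) m r :=
  isSubBaseTopological.Build (dtuple K m r) (@dtuple_basic K m r) id.

(* (P^m)^(r), with the quotient topology by the symmetric group. *)
Definition rsets (K : fieldType) (m r : nat) :=
  {S : {fset projspace K m} | #|` S| == r}.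

HB.instance Definition _ (K : fieldType) m r := SubChoice.on (rsets K m r).

Section Unordered.
Context {K : fieldType} {m r : nat}.

Lemma card_unord (t : dtuple K m r) :
  #|` [fset p in (val t : seq (projspace K m))]%fset| == r.
Proof. by rewrite card_fseq undup_id ?(valP t)// size_tuple. Qed.

Definition unord (t : dtuple K m r) : rsets K m r :=
  exist (fun S : {fset projspace K m} => #|` S| == r) _ (card_unord t).

Definition rsets_open (U : set (rsets K m r)) := open (unord @^-1` U).

Lemma rsets_openT : rsets_open setT.
Proof. exact: openT. Qed.

Lemma rsets_openI : setI_closed rsets_open.
Proof. by move=> U V; exact: openI. Qed.

Lemma rsets_open_bigU (I : Type) (f : I -> set (rsets K m r)) :
  (forall i, rsets_open (f i)) -> rsets_open (\bigcup_i f i).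
Proof. by move=> fo; apply: bigcup_open => i _; exact: fo. Qed.

HB.instance Definition _ := isOpenTopological.Build (rsets K m r)
  rsets_openT rsets_openI rsets_open_bigU.

End Unordered.

Definition rsubsets (K : fieldType) m (r : nat) (X : set (projspace K m)) :
  set (rsets K m r) := [set S | forall p, p \in val S -> X p].

Section Terracini.
Context {K : fieldType} {m : nat}.
Implicit Types (X : set (projspace K m)) (p : projspace K m).
Implicit Types (U : {vspace 'rV[K]_m.+1}).

(* Dimension of the projective subspace P(U), for U nonzero. *)
Definition pdim U : nat := (\dim U).-1.

Definition vanishing_ideal X : set {mpoly K[m.+1]} :=
  [set F | (exists e, F \is e.-homog) /\ forall p, X p -> hval F p = 0].

Definition tangent_vector X p : set 'rV[K]_m.+1 :=
  [set v | forall F, vanishing_ideal X F ->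
     \sum_(j < m.+1) hval F^`M(j) p * v 0 j = 0].

(* The embedded Zariski tangent space at p, as a linear subspace of K^(m+1);
   see tangentP. *)
Definition tangent X p : {vspace 'rV[K]_m.+1} :=
  xget 0%VS [set U | forall v, (v \in U) <-> tangent_vector X p v].

Lemma tangentP X p v : (v \in tangent X p) <-> tangent_vector X p v.
Proof.
suff [U UP] : exists U : {vspace 'rV[K]_m.+1},
    forall v, (v \in U) <-> tangent_vector X p v.
  by rewrite /tangent; case: xgetP => [W _ WP|/(_ U UP)]; [exact: WP|].
have tv0 : tangent_vector X p 0.
  by move=> F _; rewrite big1// => j _; rewrite mxE mulr0.
have tvD u w : tangent_vector X p u -> tangent_vector X p w ->
    tangent_vector X p (u + w).
  move=> uT wT F FX; under eq_bigr do rewrite mxE mulrDr.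
  by rewrite big_split/= uT// wT// addr0.
have tvZ a u : tangent_vector X p u -> tangent_vector X p (a *: u).
  move=> uT F FX; under eq_bigr do rewrite mxE mulrCA.
  by rewrite -mulr_sumr uT// mulr0.
pose Q k := `[< exists U, \dim U = k /\
  forall v, v \in U -> tangent_vector X p v >].
have exQ : exists k, Q k.
  exists 0%N; apply/asboolP; exists 0%VS; split; first exact: dimv0.
  by move=> w; rewrite memv0 => /eqP ->.
have ubQ k : Q k -> (k <= \dim (fullv : {vspace 'rV[K]_m.+1}))%N.
  by move=> /asboolP[U [<- _]]; exact/dimvS/subvf.
case: (ex_maxnP exQ ubQ) => k /asboolP[U [dimU UT]] kmax.
exists U => w; split; first exact: UT.
move=> wT; apply/negPn/negP => wU.
have : Q (\dim (U + <[w]>)%VS).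
  apply/asboolP; exists (U + <[w]>)%VS; split=> // z.
  move=> /memv_addP[a aU [b /vlineP[c ->] ->]].
  exact: tvD (UT _ aU) (tvZ _ _ wT).
move=> /kmax; rewrite -dimU => le_dim.
have /eqP UE : U == (U + <[w]>)%VS by rewrite eqEdim addvSl.
by case/negP: wU; rewrite UE; exact: subvP (addvSr U _) _ (memv_line w).
Qed.

Definition smooth X : set (projspace K m) :=
  [set p | X p /\ has_dim X (pdim (tangent X p))].

Definition Ter (r : nat) X : set (rsets K m r) :=
  closure_in (rsubsets (smooth X))
    [set S | rsubsets (smooth X) S /\
       exists2 k, has_dim X k &
         (pdim (\sum_(p <- val S) tangent X p)%VS < r * k.+1 - 1)%N].

(* The finite set S is contained in a k-dimensional projective subspace. *)
Definition in_linear (k : nat) (S : {fset projspace K m}) :=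
  exists L : {vspace 'rV[K]_m.+1},
    \dim L = k.+1 /\ forall p, p \in S -> (val p <= L)%VS.

End Terracini.

Arguments Ter {K m} r X.

Section Veronese.
Context {K : fieldType}.
Variables n d : nat.

Definition veroN : nat := 'C(n + d, n).-1%N.

(* Exponents of the monomials of degree d in n + 1 variables. *)
Definition expos : {set n.+1.-tuple 'I_d.+1} :=
  [set u : n.+1.-tuple 'I_d.+1 | (\sum_(i <- u) i)%N == d]%SET.

Lemma veroNE : veroN.+1 = #|expos|.
Proof. by rewrite card_ord_partitions prednK// bin_gt0 leq_addr. Qed.

Definition vero_vec (x : 'rV[K]_n.+1) : 'rV[K]_veroN.+1 :=
  \row_j \prod_(i < n.+1) x 0 i ^+ tnth (enum_val (cast_ord veroNE j)) i.

Lemma vero_vec_neq0 x : x != 0 -> vero_vec x != 0.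
Proof.
move=> /rV0Pn[i xi]; apply/rV0Pn.
pose u := [tuple if j == i then (ord_max : 'I_d.+1) else ord0 | j < n.+1].
have uE : u \in expos.
  rewrite inE big_tuple (bigD1 i)//= tnth_mktuple eqxx big1 ?addn0//.
  by move=> j /negbTE ji; rewrite tnth_mktuple ji.
exists (cast_ord (esym veroNE) (enum_rank_in uE u)).
rewrite mxE cast_ordKV enum_rankK_in// (bigD1 i)//= big1.
  by rewrite mulr1 expf_neq0.
by move=> j /negbTE ji; rewrite tnth_mktuple ji expr0.
Qed.

Lemma dim_nu (p : projspace K n) : \dim <[vero_vec (rep p)]> == 1%N.
Proof. by rewrite dim_vline vero_vec_neq0// rep_neq0. Qed.

Definition nu (p : projspace K n) : projspace K veroN :=
  exist (fun l : {vspace _} => \dim l == 1%N) _ (dim_nu p).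

End Veronese.

Arguments nu {K n} d p.

Definition veronese (K : fieldType) (n d : nat) :
    set (projspace K (veroN n d)) :=
  range (nu d).

Arguments veronese : clear implicits.

(* Main.v *)
Require Import Defs.
From HB Require Import structures.
From mathcomp Require Import all_boot all_order all_algebra finmap.
From mathcomp Require Import mpoly.
From mathcomp Require Import all_classical topology.
From mathcomp Require Import all_fingroup zify.

(* For points p_1, ..., p_r of P^n, the tangent spaces of the Veronese variety
   at the points nu_d(p_i) are linearly dependent iff the double points 2p_i
   fail to impose independent conditions on forms of degree d.  They are
   independent as soon as, for every i, some form of degree < d is singular at
   all the p_j with j <> i and does not vanish at p_i; such a form is found as a
   product of linear forms, hyperplanes through two or three points saving
   degrees.  Conversely, too many points on a line or a plane give dependent
   tangent spaces by restriction to that linear space.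

   Dimensions are computed without transcendence degrees.  A chain of l + 1
   irreducible closed sets yields at least c a^l linearly independent forms of
   degree proportional to a, whereas a set parametrized by affine k-space
   carries at most C a^k of them; so l <= k.  Norms over the symmetric group
   carry this over to unordered tuples.  Conversely, fixing more and more
   parameters of a chart with regular inverse gives a chain of length k. *)

Set Implicit Arguments.
Unset Strict Implicit.
Unset Printing Implicit Defensive.

Import GRing.Theory.

Local Open Scope classical_set_scope.

(** * Polynomial functions in one variable *)

(** A degree budget explains the values of r. Isolating a point by squared hyperplanes through each
    of the others costs degree 2(r - 1), and the form may have degree at most d - 1, so that a
    linear factor remains to detect a tangent direction. Two points sharing a squared hyperplane
    save 2, which suffices in the first statement. The third one needs two disjoint pairs; these
    require r >= 5, hence a separate triangle argument for r = d = 4. Homogeneous coordinates are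
    chosen, not given algebraically: a form pulled back along a parametrization is polynomial only
    up to a nonzero factor that need not be polynomial, and charts and pull-backs carry this factor
    along. Charts reach only general configurations. A special one is a limit: a polynomial path
    joins it to a configuration on a rational normal curve, and a form vanishing on the chart
    vanishes along the whole path. Characteristic 0 provides d nonzero in K, a faithful Euler
    relation and infinitely many parameters. *)

Section PolynomialFunctions.
Local Open Scope ring_scope.
Context {K : fieldType}.
Hypothesis charK : [pchar K] =i pred0.

Lemma natr_inj_pchar0 : injective (fun i : nat => i%:R : K).
Proof.
move=> i j; wlog ij : i j / (i <= j)%N => [H ij|/eqP].
  by case/orP: (leq_total i j) => ?; [exact: H|exact/esym/H/esym].
rewrite eq_sym -subr_eq0 -natrB// (pcharf0P K).1// subn_eq0 => ji.
by apply/eqP; rewrite eqn_leq ij ji.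
Qed.

(** In characteristic 0 the first [size p] naturals are distinct in K, and they are more than [p]
    can have roots. *)
Lemma exists_nonroot (p : {poly K}) : p != 0 -> exists s, p.[s] != 0.
Proof.
move=> p0; have [/allP rs|/allPn[s _ ps]] :=
  boolP (all (root p) [seq i%:R | i <- iota 0 (size p)]); last by exists s.
have := max_poly_roots p0 (introT allP rs).
by rewrite map_inj_uniq ?iota_uniq ?size_map ?size_iota ?ltnn;
  [move/(_ isT)|exact: natr_inj_pchar0].
Qed.

Definition polyfun (f : K -> K) := exists p : {poly K}, forall s, f s = p.[s].

Lemma polyfun_cst a : polyfun (fun=> a).
Proof. by exists a%:P => s; rewrite hornerC. Qed.

Lemma polyfun_id : polyfun id.
Proof. by exists 'X => s; rewrite hornerX. Qed.

Lemma polyfunD f g : polyfun f -> polyfun g -> polyfun (fun s => f s + g s).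
Proof. by move=> [p fp] [q gq]; exists (p + q) => s; rewrite hornerD fp gq. Qed.

Lemma polyfunM f g : polyfun f -> polyfun g -> polyfun (fun s => f s * g s).
Proof. by move=> [p fp] [q gq]; exists (p * q) => s; rewrite hornerM fp gq. Qed.

Lemma polyfun_sum (I : Type) (r : seq I) (P : pred I) (f : I -> K -> K) :
  (forall i, polyfun (f i)) -> polyfun (fun s => \sum_(i <- r | P i) f i s).
Proof.
move=> fp; elim: r => [|i r IH].
  by under eq_fun do rewrite big_nil; exact: polyfun_cst.
under eq_fun do rewrite big_cons.
by case: (P i) => //; exact: polyfunD.
Qed.

Lemma polyfun_prod (I : Type) (r : seq I) (P : pred I) (f : I -> K -> K) :
  (forall i, polyfun (f i)) -> polyfun (fun s => \prod_(i <- r | P i) f i s).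
Proof.
move=> fp; elim: r => [|i r IH].
  by under eq_fun do rewrite big_nil; exact: polyfun_cst.
under eq_fun do rewrite big_cons.
by case: (P i) => //; exact: polyfunM.
Qed.

Lemma polyfunX f k : polyfun f -> polyfun (fun s => f s ^+ k).
Proof. by move=> [p fp]; exists (p ^+ k) => s; rewrite horner_exp fp. Qed.

Lemma polyfun_mul_neq0 f g s t : polyfun f -> polyfun g ->
  f s != 0 -> g t != 0 -> exists u, f u * g u != 0.
Proof.
move=> [p fp] [q gq]; rewrite fp gq => ps qt.
have pn0 : p != 0 by apply: contraNneq ps => ->; rewrite horner0.
have qn0 : q != 0 by apply: contraNneq qt => ->; rewrite horner0.
have [|u] := @exists_nonroot (p * q); first by rewrite mulf_neq0.
by rewrite hornerM -fp -gq; exists u.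
Qed.

(** Identity principle: it extends equations across the parameters where a construction
    degenerates. *)
Lemma polyfun_eq0_dense f q t : polyfun f -> polyfun q -> q t != 0 ->
  (forall s, q s != 0 -> f s = 0) -> forall s, f s = 0.
Proof.
move=> fp qp qt fq s; apply/eqP/negPn/negP => fs.
have [u] := polyfun_mul_neq0 fp qp fs qt.
have [->|/fq->] := eqVneq (q u) 0; first by rewrite mulr0 eqxx.
by rewrite mul0r eqxx.
Qed.

(* The combination is taken along a moment curve (1, s, s^2, ...). *)
Lemma exists_comb_neq0 (I : finType) (v : I -> I -> K) :
  (forall b, v b b != 0) ->
  exists c : I -> K, forall b, \sum_a c a * v a b != 0.
Proof.
move=> v0; pose p b := \poly_(k < #|I|) oapp (fun a => v a b) 0
  (omap (@enum_val I predT) (insub k)).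
have pE b s : (p b).[s] = \sum_a s ^+ enum_rank a * v a b.
  rewrite horner_poly (reindex enum_rank) /=; last first.
    by exists enum_val => a _; rewrite ?enum_valK ?enum_rankK.
  by apply: eq_bigr => a _; rewrite mulrC valK /= enum_rankK.
have pn0 b : p b != 0.
  apply/eqP => /(congr1 (fun q : {poly K} => q`_(enum_rank b))).
  rewrite coef_poly ltn_ord valK/= enum_rankK coef0.
  by move/eqP: (v0 b).
have [|s] := @exists_nonroot (\prod_b p b).
  by rewrite prodf_seq_neq0; apply/allP => b _; rewrite pn0 implybT.
rewrite horner_prod prodf_seq_neq0 => /allP ps.
exists (fun a => s ^+ enum_rank a) => b.
by rewrite -pE; have := ps b; rewrite mem_index_enum; exact.
Qed.

End PolynomialFunctions.

(** * Irreducible sets and closures *)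

Section Topology.
Context {T : topologicalType}.
Implicit Types A B C Z : set T.

Lemma closure_subset_closed B C : closed C -> B `<=` C -> closure B `<=` C.
Proof. by move=> cC BC x /(closureS BC); rewrite -(closure_id C).1. Qed.

Lemma irreducible_between B Z : irreducible_set B -> B `<=` Z ->
  Z `<=` closure B -> irreducible_set Z.
Proof.
move=> [[x Bx] irrB] BZ Zcl; split; first by exists x; exact: BZ.
move=> C1 C2 c1 c2 Z12.
by have [|B1|B2] := irrB C1 C2 c1 c2; [exact: subset_trans Z12|left|right];
  apply: (subset_trans Zcl); exact: closure_subset_closed.
Qed.

Lemma irreducible_finite (I : finType) B (C : I -> set T) :
  irreducible_set B -> (forall i, closed (C i)) ->
  (forall x, B x -> exists i, C i x) -> exists i, B `<=` C i.
Proof.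
move=> [[x0 Bx0] irrB] cC BC; suff: forall s : seq I,
    (forall x, B x -> exists2 i, i \in s & C i x) -> exists i, B `<=` C i.
  by move/(_ (enum I)); apply => x /BC[i Ci]; exists i; rewrite ?mem_enum.
elim=> [|i s IH] Bs; first by have [] := Bs _ Bx0.
have [||||BU] := irrB (C i) (\bigcup_(j in [set j | j \in s]) C j).
- exact: cC.
- by apply: closed_bigcup => //; rewrite -/(finite_set _); exact: finite_seq.
- move=> x /Bs[j]; rewrite inE => /orP[/eqP->|js] Cj; first by left.
  by right; exists j.
- by exists i.
- by apply: IH => x /BU[j js Cj]; exists j.
Qed.

Lemma has_dim_inj A k l : has_dim A k -> has_dim A l -> k = l.
Proof.
move=> [[Z Zk] ubk] [[Z' Zl] ubl].
by apply/eqP; rewrite eqn_leq (ubl _ _ Zk) (ubk _ _ Zl).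
Qed.

End Topology.

Lemma irreducible_image (T U : topologicalType) (f : T -> U) B :
  (forall C, closed C -> closed (f @^-1` C)) ->
  irreducible_set B -> irreducible_set (f @` B).
Proof.
move=> fcl [[x Bx] irrB]; split; first by exists (f x), x.
move=> C1 C2 /fcl c1 /fcl c2 B12.
have [|B1|B2] := irrB _ _ c1 c2; first by move=> y By; apply: B12; exists y.
- by left => _ [y By <-]; exact: B1.
- by right => _ [y By <-]; exact: B2.
Qed.

(** * Chains of irreducible closed sets *)

Section Graded.
Local Open Scope ring_scope.
Context {K : fieldType}.

(** [V e] plays the part of the forms of degree e, evaluated on chosen representatives. Separation
    asks for a positive degree so that several separating forms can be raised to powers of one
    common degree. *)
Record graded (D : topologicalType) (V : nat -> set (D -> K)) : Prop := Graded {
  graded0 : forall e, V e (fun=> 0);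
  graded1 : V 0%N (fun=> 1);
  graded_lin : forall e a f g, V e f -> V e g -> V e (fun x => a * f x + g x);
  gradedM : forall e e' f g, V e f -> V e' g ->
    V (e + e')%N (fun x => f x * g x);
  graded_closed : forall e f, V e f -> closed [set x | f x = 0];
  graded_sep : forall C x, closed C -> ~ C x ->
    exists e f, [/\ (0 < e)%N, V e f, forall y, C y -> f y = 0 & f x != 0] }.

Definition indep_on (D : Type) (Z : set D) (J : finType) (g : J -> D -> K) :=
  forall c : J -> K, (forall x, Z x -> \sum_j c j * g j x = 0) ->
    forall j, c j = 0.

(** An upper bound of order e^k for the Hilbert function of [B]; (c e + 1)^k counts the monomials in
    k variables with exponents at most c e. *)
Definition growth_le (D : Type) (V : nat -> set (D -> K)) (B : set D) k :=
  exists c, forall e (J : finType) (g : J -> D -> K),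
    (forall j, V e (g j)) -> ((c * e).+1 ^ k < #|J|)%N -> ~ indep_on B g.

Context {D : topologicalType} {V : nat -> set (D -> K)} (gV : graded V).
Implicit Types (A B C Z : set D) (f g : D -> K) (e : nat).

Lemma graded_sum e (J : finType) (c : J -> K) (g : J -> D -> K) :
  (forall j, V e (g j)) -> V e (fun x => \sum_j c j * g j x).
Proof.
move=> Vg; elim: (index_enum J) => [|j s IH].
  by under eq_fun do rewrite big_nil; exact: graded0.
by under eq_fun do rewrite big_cons; exact: graded_lin.
Qed.

Lemma gradedX e f i : V e f -> V (i * e)%N (fun x => f x ^+ i).
Proof.
move=> Vf; elim: i => [|i IH].
  by under eq_fun do rewrite expr0; exact: graded1.
by under eq_fun do rewrite exprS; rewrite mulSn; exact: gradedM.
Qed.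

Lemma graded_prod (J : finType) (d : J -> nat) (g : J -> D -> K) :
  (forall j, V (d j) (g j)) -> V (\sum_j d j)%N (fun x => \prod_j g j x).
Proof.
move=> Vg; elim: (index_enum J) => [|j s IH].
  by rewrite big_nil; under [X in V _ X]eq_fun do rewrite big_nil; exact: graded1.
by rewrite big_cons; under [X in V _ X]eq_fun do rewrite big_cons; exact: gradedM.
Qed.

Lemma eq0_on_closure e f B : V e f ->
  (forall x, B x -> f x = 0) -> forall x, closure B x -> f x = 0.
Proof.
move=> Vf Bf x; apply: (@closure_subset_closed _ B [set x | f x = 0]) => //.
exact: graded_closed Vf.
Qed.

Lemma irreducible_mul0 e e' f g Z : irreducible_set Z -> V e f -> V e' g ->
  (forall x, Z x -> f x * g x = 0) ->
  (forall x, Z x -> f x = 0) \/ (forall x, Z x -> g x = 0).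
Proof.
move=> [_ irrZ] Vf Vg fg; apply: irrZ (graded_closed gV Vf) (graded_closed gV Vg) _.
by move=> x /fg/eqP; rewrite mulf_eq0 => /orP[] /eqP; [left|right].
Qed.

Lemma exp_neq0_on Z f i : (exists2 x, Z x & f x != 0) ->
  exists2 x, Z x & f x ^+ i != 0.
Proof. by move=> [x Zx fx]; exists x => //; exact: expf_neq0. Qed.

Lemma graded_sep_common (I : finType) (C : I -> set D) (x : I -> D) :
  (forall i, closed (C i)) -> (forall i, ~ C i (x i)) ->
  exists E (f : I -> D -> K), (0 < E)%N /\ forall i,
    [/\ V E (f i), forall y, C i y -> f i y = 0 & f i (x i) != 0].
Proof.
move=> cC Cx.
have /choice[p pP] i : exists p : nat * (D -> K), [/\ (0 < p.1)%N, V p.1 p.2,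
    forall y, C i y -> p.2 y = 0 & p.2 (x i) != 0].
  by have [e [f fP]] := graded_sep gV (cC i) (Cx i); exists (e, f).
(* A common multiple of the degrees; the exponents [E %/ (p i).1] are positive, so zeros are
   preserved. *)
pose E := (\prod_i (p i).1)%N.
have E0 : (0 < E)%N by rewrite prodn_gt0// => i; have [] := pP i.
exists E, (fun i y => (p i).2 y ^+ (E %/ (p i).1)); split=> // i.
have [ei0 Vi Ci xi] := pP i.
have dvdE : ((p i).1 %| E)%N by rewrite /E (bigD1 i)//= dvdn_mulr.
have Ei0 : (0 < E %/ (p i).1)%N by rewrite divn_gt0// dvdn_leq.
split; last exact: expf_neq0.
- by rewrite -{1}(divnK dvdE); exact: gradedX.
- by move=> y /Ci->; rewrite expr0n gtn_eqF.
Qed.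

(* The g_j are independent on Z', where F vanishes; multiplication by powers of
   F, homogenized by F0, makes them independent on Z with one more degree of
   freedom. *)
Lemma indep_on_step Z Z' (F F0 : D -> K) (f e a : nat) (J : finType) (g : J -> D -> K) :
  irreducible_set Z -> irreducible_set Z' -> Z' `<=` Z -> V f F -> V f F0 ->
  (forall x, Z' x -> F x = 0) -> (exists2 x, Z x & F x != 0) ->
  (exists2 x, Z' x & F0 x != 0) -> (forall j, V e (g j)) -> indep_on Z' g ->
  indep_on Z (fun (p : 'I_a.+1 * J) x =>
    F x ^+ p.1 * F0 x ^+ (a - p.1) * g p.2 x).
Proof.
move=> irrZ irrZ' sZ VF VF0 FZ' FZ F0Z' Vg indg c c0.
pose h i x := F0 x ^+ (a - i) * \sum_j c (inord i, j) * g j x.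
(* The relation without its first i0 rows, divided by F^i0. Restricting [S i0] to Z' kills row i0;
   on Z what remains is F times [S i0.+1], and F can be cancelled by irreducibility. *)
pose S i0 x := \sum_(i0 <= i < a.+1) F x ^+ (i - i0) * h i x.
have Vh i : V ((a - i) * f + e)%N (h i).
  by apply: (gradedM gV); [exact: gradedX|exact: graded_sum].
have VS i0 : (i0 <= a)%N -> V ((a - i0) * f + e)%N (S i0).
  move=> i0a; rewrite /S /index_iota.
  have : all (fun i => i0 <= i <= a)%N (iota i0 (a.+1 - i0)).
    by apply/allP => i; rewrite mem_iota subnKC ?ltnS// ltnW// ltnS.
  elim: (iota _ _) => [_|i s IH /=/andP[/andP[i0i ia] /IH Vs]].
    by under eq_fun do rewrite big_nil; exact: graded0.
  under eq_fun do rewrite big_cons -[X in X + _]mul1r.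
  apply: (graded_lin gV) => //.
  have -> : ((a - i0) * f + e = (i - i0) * f + ((a - i) * f + e))%N.
    by rewrite addnA -mulnDl; congr (_ * _ + _)%N; lia.
  by apply: (gradedM gV); [exact: gradedX|].
have S0 x : Z x -> S 0%N x = 0.
  move=> Zx; rewrite -[RHS](c0 x Zx) /S big_mkord.
  transitivity (\sum_(i < a.+1) \sum_j
      c (i, j) * (F x ^+ i * F0 x ^+ (a - i) * g j x)); last first.
    by rewrite pair_bigA; apply: eq_bigr => -[].
  apply: eq_bigr => i _; rewrite subn0 /h mulrA mulr_sumr.
  by apply: eq_bigr => j _; rewrite inord_val mulrCA.
have row0 i0 : (i0 <= a)%N -> (forall x, Z x -> S i0 x = 0) ->
    forall j, c (inord i0, j) = 0.
  move=> i0a Si0; apply: indg => x Z'x.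
  have h0 y : Z' y -> F0 y ^+ (a - i0) * \sum_j c (inord i0, j) * g j y = 0.
    move=> Z'y; rewrite -[RHS](Si0 y (sZ _ Z'y)) /S big_ltn// subnn mul1r.
    rewrite big_nat [X in _ = _ + X]big1 ?addr0// => i /andP[i0i _].
    by rewrite FZ'// expr0n subn_eq0 leqNgt i0i mul0r.
  have [H|->//] := irreducible_mul0 irrZ' (gradedX (a - i0) VF0)
    (graded_sum (fun j => c (inord i0, j)) Vg) h0.
  by have [y /H->] := exp_neq0_on (a - i0) F0Z'; rewrite eqxx.
have Sall i0 : (i0 <= a)%N -> forall x, Z x -> S i0 x = 0.
  elim: i0 => [//|i0 IH] lti0 x Zx; have i0a := ltnW lti0.
  have [|H|->//] := irreducible_mul0 irrZ VF (VS _ lti0).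
    move=> y Zy; rewrite -[RHS](IH i0a y Zy) /S [RHS]big_ltn ?ltnS//.
    have -> : h i0 y = 0.
      rewrite /h big1 ?mulr0// => j _.
      by rewrite (row0 i0)// ?mul0r//; exact: IH.
    rewrite mulr0 add0r mulr_sumr !big_nat; apply: eq_bigr => i /andP[ii0 _].
    by rewrite mulrA -exprS -subSn// subSS.
  by have [y /H->] := FZ; rewrite eqxx.
move=> [i j]; rewrite -[i]inord_val row0//; first by rewrite -ltnS.
by apply: Sall; rewrite -ltnS.
Qed.

Lemma chain_functions A l (Z : nat -> set D) : irr_chain A l Z ->
  exists (f : nat) (F : nat -> D -> K), forall i, (i <= l)%N ->
    [/\ V f (F i), exists2 x, Z i x & F i x != 0 &
        (0 < i)%N -> forall x, Z i.-1 x -> F i x = 0].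
Proof.
move=> [Zirr Zlt].
have /choice[p pP] (i : 'I_l.+1) : exists p : set D * D,
    [/\ closed p.1, ~ p.1 p.2, Z i p.2 & (0 < i)%N -> Z i.-1 `<=` p.1].
  have il : (i <= l)%N by rewrite -ltnS.
  (* For i = 0 the closed set is empty: [F 0] need only be nonzero somewhere on [Z 0], and it serves
     to homogenize the other [F i]. *)
  case: i il => -[|i] ilt /= il.
    by have [_ [[x Zx] _]] := Zirr 0%N isT; exists (set0, x); split=> //; exact: closed0.
  have [sZ nsZ] := Zlt i il.
  have [x Zx Zix] : exists2 x, Z i.+1 x & ~ Z i x.
    apply: contrapT => H; apply: nsZ => x Zx; apply: contrapT => Zix.
    by apply: H; exists x.
  have [[C cC ZE] _] := Zirr i (ltnW il).
  have [[C' _ ZE'] _] := Zirr i.+1 il.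
  exists (C, x); split=> //=.
  - by move=> Cx; apply: Zix; rewrite ZE; split=> //; move: Zx; rewrite ZE' => -[].
  - by move=> _; rewrite ZE => y [].
have [i|i|E [f [_ fP]]] :=
  @graded_sep_common _ (fun i => (p i).1) (fun i => (p i).2).
- by have [] := pP i.
- by have [] := pP i.
exists E, (fun i => f (inord i)) => i il.
have [Vf f0 fx] := fP (inord i); have := pP (inord i).
rewrite inordK ?ltnS// => -[_ _ Zp Zi]; split=> //; first by exists (p (inord i)).2.
by move=> i0 x /(Zi i0); exact: f0.
Qed.

(** The forms are the products over the levels j = 1, ..., l of F_j^(i_j) F_0^(a - i_j) with 0 <=
    i_j <= a: one more free exponent for each step of the chain. *)
Lemma chain_indep A l (Z : nat -> set D) : irr_chain A l Z ->
  exists f : nat, forall a, exists (J : finType) (g : J -> D -> K),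
    [/\ #|J| = (a.+1 ^ l)%N, forall j, V (l * (a * f))%N (g j) & indep_on (Z l) g].
Proof.
move=> chZ; have [f [F FP]] := chain_functions chZ; have [Zirr Zlt] := chZ.
exists f => a.
have Z0 l' : (l' <= l)%N -> Z 0%N `<=` Z l'.
  elim: l' => [|l' IH] ll' x // /(IH (ltnW ll')).
  by have [sZ _] := Zlt _ ll'; exact: sZ.
suff : forall l', (l' <= l)%N -> exists (J : finType) (g : J -> D -> K),
    [/\ #|J| = (a.+1 ^ l')%N, forall j, V (l' * (a * f))%N (g j) &
        indep_on (Z l') g] by exact.
elim=> [_|l' IH ll'].
  exists unit, (fun _ _ => 1); split; first by rewrite card_unit.
    by move=> _; rewrite mul0n; exact: graded1.
  move=> c c0 [].
  have [_ [[x Zx] _]] := Zirr 0%N isT; have := c0 x Zx.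
  by rewrite (big_pred1 tt) ?mulr1//; case.
have [J [g [cJ Vg indg]]] := IH (ltnW ll').
have [VF0 [x0 Zx0 Fx0] _] := FP 0%N isT.
have [VF ? FZ] := FP _ ll'.
exists ('I_a.+1 * J)%type,
  (fun (p : 'I_a.+1 * J) x => F l'.+1 x ^+ p.1 * F 0%N x ^+ (a - p.1) * g p.2 x); split.
- by rewrite card_prod card_ord cJ expnS.
- move=> [i j] /=.
  have -> : (l'.+1 * (a * f) = i * f + (a - i) * f + l' * (a * f))%N.
    by rewrite -mulnDl subnKC ?mulSn// -ltnS.
  by apply: (gradedM gV) => //; apply: (gradedM gV); exact: gradedX.
- apply: (@indep_on_step _ (Z l') _ _ f (l' * (a * f))%N a J g) => //.
  + by have [] := Zirr _ ll'.
  + by have [] := Zirr _ (ltnW ll').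
  + by have [] := Zlt _ ll'.
  + exact: FZ.
  + by exists x0 => //; apply: Z0 => //; exact: ltnW.
Qed.

Lemma chain_bound A B k l (Z : nat -> set D) : A `<=` closure B -> growth_le V B k ->
  irr_chain A l Z -> (l <= k)%N.
Proof.
move=> AB [c cP] chZ; rewrite leqNgt; apply/negP => kl.
have [f fP] := chain_indep chZ.
(* In degree l a f the growth bound is at most ((c l f + 1)(a + 1))^k, which for this a equals a (a
   + 1)^k, less than (a + 1)^(k + 1), hence less than the (a + 1)^l independent forms. *)
pose a := ((c * (l * f)).+1 ^ k)%N.
have [J [g [cJ Vg indg]]] := fP a.
apply: (cP _ J g Vg); last first.
  move=> b b0; apply: indg => x Zx.
  apply: (eq0_on_closure (graded_sum b Vg) b0); apply: AB.
  by have [/(_ l (leqnn l))[[C _ ZE] _] _] := chZ; move: Zx; rewrite ZE => -[].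
rewrite cJ; apply: (@leq_trans (a.+1 ^ k.+1)); last by rewrite leq_pexp2l.
apply: (@leq_ltn_trans (((c * (l * f)).+1 * a.+1) ^ k)).
  case: (k) => // k'; rewrite leq_exp2r// mulSn (mulnC _ a.+1) mulnC -mulnA.
  by rewrite [(l * _)%N]mulnCA -!mulnA; lia.
by rewrite expnMn expnSr mulnC ltn_pmul2l ?expn_gt0.
Qed.

End Graded.

(** * Quotients by finite groups *)

Section Quotient.
Local Open Scope ring_scope.
Context {K : fieldType} {D T : topologicalType} {V : nat -> set (D -> K)}.
Context {gT : finGroupType} {act : gT -> D -> D} {proj : D -> T}.

Record quotient_by : Prop := QuotientBy {
  quot_act1 : forall x, act 1%g x = x;
  quot_actM : forall a b x, act (a * b)%g x = act a (act b x);
  quot_graded : forall a e f, V e f -> V e (f \o act a);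
  quot_eq : forall x y, proj x = proj y <-> exists a, y = act a x;
  quot_surj : forall t, exists x, proj x = t;
  quot_closed : forall C, closed C <-> closed (proj @^-1` C) }.

Definition quot_functions : nat -> set (T -> K) := fun e f => V e (f \o proj).

Hypothesis charK : [pchar K] =i pred0.
Hypotheses (gV : graded V) (qV : quotient_by).

Lemma quot_act a x : proj (act a x) = proj x.
Proof. by apply/esym/(quot_eq qV); exists a. Qed.

(* Separation is obtained by taking the norm over the group. *)
Lemma graded_quot : graded quot_functions.
Proof.
split.
- by move=> e; exact: (graded0 gV).
- exact: (graded1 gV).
- by move=> e a f g; exact: (graded_lin gV).
- by move=> e e' f g; exact: (gradedM gV).
- by move=> e f Vf; apply/(quot_closed qV); exact: (graded_closed gV Vf).
move=> C t /(quot_closed qV) cC; have [x <-] := quot_surj qV t => Cx.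
have [||E [G [E0 GP]]] := @graded_sep_common _ _ _ gV gT
  (fun=> proj @^-1` C) (fun a => act a x).
- by [].
- by move=> a; rewrite /preimage/= quot_act.
(* [G a] is only known to be nonzero at the point [act a x]; a single combination is made nonzero on
   the whole orbit, so that its norm does not vanish at x. *)
have [|c cP] := exists_comb_neq0 charK (v := fun a b => G a (act b x)).
  by move=> a; have [] := GP a.
pose N y := \prod_(a : gT) \sum_b c b * G b (act a y).
have Ninv a y : N (act a y) = N y.
  rewrite /N [RHS](reindex_inj (mulIg a))/=; apply: eq_bigr => b _.
  by apply: eq_bigr => d _; rewrite (quot_actM qV).
have /choice[s sP] := quot_surj qV.
have NE : (N \o s) \o proj = N.
  apply/funext => y /=; have /(quot_eq qV)[a {2}->] := sP (proj y).
  by rewrite Ninv.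
exists (\sum_(a : gT) E)%N, (N \o s); split.
- by rewrite sum_nat_const muln_gt0 E0 andbT; apply/card_gt0P; exists 1%g.
- rewrite /quot_functions NE; apply: (graded_prod gV) => a.
  apply: (graded_sum gV) => b.
  by have [VG _ _] := GP b; exact: (quot_graded qV a VG).
- move=> u Cu; have [y yu] := quot_surj qV u.
  have -> : (N \o s) u = N y by rewrite -yu -[LHS]/(((N \o s) \o proj) y) NE.
  rewrite /N (bigD1 1%g)//= big1 ?mul0r// => b _.
  have [_ G0 _] := GP b; rewrite G0 ?mulr0// /preimage/=.
  by rewrite quot_act yu.
- rewrite -[(N \o s) _]/(((N \o s) \o proj) x) NE.
  by rewrite /N prodf_seq_neq0; apply/allP => a _; rewrite cP.
Qed.

(** By separation a closed set is cut out by forms, and the group carries forms to forms. *)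
Lemma act_closed a C : closed C -> closed (act a @^-1` C).
Proof.
move=> cC.
have -> : act a @^-1` C = \bigcap_(p in [set p : nat * (D -> K) |
    V p.1 p.2 /\ forall y, C y -> p.2 y = 0]) [set x | p.2 (act a x) = 0].
  apply/seteqP; split=> [x Cx [e f] /= [_]|x fx]; first exact.
  apply: contrapT => Cx; have [e [f [_ Vf fC]]] := graded_sep gV cC Cx.
  by have /= -> := fx (e, f) (conj Vf fC); rewrite eqxx.
apply: closed_bigI => -[e f] /= [Vf _].
exact: (graded_closed gV (quot_graded qV a Vf)).
Qed.

Lemma closed_quot_image C : closed C -> closed (proj @` C).
Proof.
move=> cC; apply/(quot_closed qV).
have -> : proj @^-1` (proj @` C) = \bigcup_(a in [set: gT]) (act a @^-1` C).
  apply/seteqP; split=> x.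
    by move=> [y Cy /esym/(quot_eq qV)[a ya]]; exists a => //=; rewrite /preimage/= -ya.
  by move=> [a _ Cax]; exists (act a x) => //; rewrite quot_act.
by apply: closed_bigcup => [|a _]; [exact: finite_finset|exact: act_closed].
Qed.

End Quotient.

Arguments quotient_by {K D T} V {gT} act proj.
Arguments quot_functions {K D T} V proj.

(** * Polynomial functions with bounded exponents on affine space *)

Section BoxPolynomials.
Local Open Scope ring_scope.
Context {K : fieldType} {k : nat}.
Implicit Types (f g : ('I_k -> K) -> K) (N : nat).

(** Bounding each exponent rather than the total degree leaves (N + 1)^k monomials, a count that is
    immediate. Any finite index type is allowed, with repeated monomials, so that sums and products
    need no regrouping. *)
Definition boxpoly N f := exists (J : finType) (c : J -> K) (h : J -> 'I_k -> nat),
  (forall j i, h j i <= N)%N /\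
  forall y, f y = \sum_j c j * \prod_i y i ^+ h j i.

Lemma boxpoly_cst a : boxpoly 0 (fun=> a).
Proof.
exists unit, (fun=> a), (fun _ _ => 0%N); split=> // y.
by rewrite (big_pred1 tt) ?big1 ?mulr1//; case.
Qed.

Lemma boxpoly_coord i : boxpoly 1 (fun y => y i).
Proof.
exists unit, (fun=> 1), (fun _ j => nat_of_bool (i == j)); split=> [_ j|y].
  by case: (i == j).
rewrite (big_pred1 tt) ?mul1r; last by case.
rewrite (bigD1 i)//= eqxx expr1 big1 ?mulr1// => j.
by rewrite eq_sym => /negbTE->.
Qed.

Lemma boxpoly_leq N N' f : (N <= N')%N -> boxpoly N f -> boxpoly N' f.
Proof.
move=> NN' [J [c [h [hN fE]]]]; exists J, c, h; split=> // j i.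
exact: leq_trans NN'.
Qed.

Lemma boxpolyD N f g : boxpoly N f -> boxpoly N g ->
  boxpoly N (fun y => f y + g y).
Proof.
move=> [J [c [h [hN fE]]]] [J' [c' [h' [h'N gE]]]].
exists (J + J')%type, (fun s => match s with inl j => c j | inr j => c' j end),
  (fun s => match s with inl j => h j | inr j => h' j end).
by split=> [[j|j] i|y]; rewrite ?big_sumType/= ?fE ?gE.
Qed.

Lemma boxpolyM N N' f g : boxpoly N f -> boxpoly N' g ->
  boxpoly (N + N') (fun y => f y * g y).
Proof.
move=> [J [c [h [hN fE]]]] [J' [c' [h' [h'N gE]]]].
exists (J * J')%type, (fun p => c p.1 * c' p.2), (fun p i => h p.1 i + h' p.2 i)%N.
split=> [[j j'] i|y]; first exact: leq_add.
rewrite fE gE mulr_suml.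
under eq_bigr do rewrite mulr_sumr.
rewrite pair_bigA; apply: eq_bigr => -[j j'] _ /=.
rewrite mulrACA -big_split/=; congr (_ * _).
by apply: eq_bigr => i _; rewrite exprD.
Qed.

Lemma boxpoly_sum (I : Type) (r : seq I) N (f : I -> ('I_k -> K) -> K) :
  (forall i, boxpoly N (f i)) -> boxpoly N (fun y => \sum_(i <- r) f i y).
Proof.
move=> fN; elim: r => [|i r IH].
  under eq_fun do rewrite big_nil.
  by apply: boxpoly_leq (boxpoly_cst 0).
by under eq_fun do rewrite big_cons; exact: boxpolyD.
Qed.

Lemma boxpoly_prod (I : Type) (r : seq I) N (f : I -> ('I_k -> K) -> K) :
  (forall i, boxpoly N (f i)) ->
  boxpoly (size r * N) (fun y => \prod_(i <- r) f i y).
Proof.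
move=> fN; elim: r => [|i r IH].
  by under eq_fun do rewrite big_nil; exact: boxpoly_cst.
by under eq_fun do rewrite big_cons; rewrite mulSn; exact: boxpolyM.
Qed.

Lemma boxpolyX N i f : boxpoly N f -> boxpoly (i * N) (fun y => f y ^+ i).
Proof.
move=> fN; elim: i => [|i IH].
  by under eq_fun do rewrite expr0; exact: boxpoly_cst.
by under eq_fun do rewrite exprS; rewrite mulSn; exact: boxpolyM.
Qed.

Definition segment (y z : 'I_k -> K) s : 'I_k -> K := fun i => y i + s * (z i - y i).

Lemma segment0 y z : segment y z 0 = y.
Proof. by apply/funext => i; rewrite /segment mul0r addr0. Qed.

Lemma segment1 y z : segment y z 1 = z.
Proof. by apply/funext => i; rewrite /segment mul1r addrC subrK. Qed.

Lemma boxpoly_segment N f y z : boxpoly N f ->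
  polyfun (fun s => f (segment y z s)).
Proof.
move=> [J [c [h [_ fE]]]]; under eq_fun do rewrite fE.
apply: polyfun_sum => j; apply: polyfunM; first exact: polyfun_cst.
apply: polyfun_prod => i; apply: polyfunX.
apply: polyfunD; first exact: polyfun_cst.
by apply: polyfunM; [exact: polyfun_id|exact: polyfun_cst].
Qed.

(** Freezing the parameters of index at least j turns their powers into constants, which leaves (N +
    1)^j monomials. *)
Lemma boxpoly_prefix N f (y0 : 'I_k -> K) j (jk : (j <= k)%N) : boxpoly N f ->
  exists d : {ffun 'I_j -> 'I_N.+1} -> K, forall y,
    (forall i : 'I_k, (j <= i)%N -> y i = y0 i) ->
    f y = \sum_b d b * \prod_(i < j) y (widen_ord jk i) ^+ b i.
Proof.
move=> [J [c [h [hN fE]]]].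
pose t u : {ffun 'I_j -> 'I_N.+1} := [ffun i => inord (h u (widen_ord jk i))].
exists (fun b => \sum_(u | t u == b)
  c u * \prod_(i < k | (j <= i)%N) y0 i ^+ h u i) => y yy0.
rewrite fE (partition_big t xpredT)//=; apply: eq_bigr => b _.
rewrite mulr_suml; apply: eq_bigr => u /eqP <-.
rewrite -mulrA; congr (_ * _); rewrite (bigID (fun i : 'I_k => j <= i)%N)/=.
congr (_ * _); first by apply: eq_bigr => i /yy0->.
under eq_bigl do rewrite -ltnNge.
rewrite big_ord_narrow; apply: eq_bigr => i _; rewrite ffunE inordK//.
by rewrite ltnS.
Qed.

End BoxPolynomials.

Lemma linear_dependency (K : fieldType) (J B : finType) (d : J -> B -> K) :
  (#|B| < #|J|)%N -> exists c : J -> K, (exists j, c j != 0%R) /\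
    forall b, (\sum_j c j * d j b = 0)%R.
Proof.
move=> BJ; pose M := (\matrix_(i < #|J|, j < #|B|) d (enum_val i) (enum_val j))%R.
have : kermx M != 0%R.
  by rewrite kermx_eq0 /row_free neq_ltn (leq_ltn_trans (rank_leq_col M)).
move=> /rowV0Pn[v /sub_kermxP vM /rV0Pn[i vi]].
exists (fun j => v ord0 (enum_rank j)); split.
  by exists (enum_val i); rewrite enum_valK.
move=> b; have /matrixP/(_ ord0 (enum_rank b)) := vM.
rewrite !mxE => vM0; rewrite -[RHS]vM0 (reindex (fun i : 'I_#|J| => enum_val i))/=; last first.
  by exists enum_rank => j _; rewrite ?enum_valK ?enum_rankK.
by apply: eq_bigr => j _; rewrite mxE enum_valK !enum_rankK.
Qed.

(** * Dimension of parametrized sets *)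

Section Charts.
Local Open Scope ring_scope.
Context {K : fieldType} {D : topologicalType} {V : nat -> set (D -> K)}.
Context {k : nat}.

(* A parametrization of a locally closed subset of D by the open subset Q != 0
   of affine k-space; chart_coord asks for an inverse. *)
Record chart (phi : ('I_k -> K) -> D) (Q : ('I_k -> K) -> K) : Prop := Chart {
  chart_eval : exists c (L : ('I_k -> K) -> K),
    (forall y, Q y != 0 -> L y != 0) /\
    forall e f, V e f -> exists2 p, boxpoly (c * e) p &
      forall y, Q y != 0 -> f (phi y) = L y ^+ e * p y;
  chart_dom : exists N, boxpoly N Q;
  chart_coord : forall i, exists e G H, [/\ V e G, V e H & forall y, Q y != 0 ->
    H (phi y) != 0 /\ G (phi y) = y i * H (phi y)] }.

Hypothesis charK : [pchar K] =i pred0.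
Hypothesis gV : graded V.
Context {phi : ('I_k -> K) -> D} {Q : ('I_k -> K) -> K} {y0 : 'I_k -> K}.
Hypotheses (ch : chart phi Q) (Qy0 : Q y0 != 0).

(** With j free parameters and the others frozen at [y0], the cells grow from a point to the whole
    image of the chart. *)
Let dom j := [set y : 'I_k -> K | Q y != 0 /\ forall i : 'I_k, (j <= i)%N -> y i = y0 i].
Let cell j := phi @` dom j.

Lemma dom_y0 j : dom j y0.
Proof. by []. Qed.

Lemma dom_segment j y z s : dom j y -> dom j z -> Q (segment y z s) != 0 ->
  dom j (segment y z s).
Proof.
move=> [_ yj] [_ zj] Qs; split=> // i ji.
by rewrite /segment yj// zj// subrr mulr0 addr0.
Qed.

(** Two closed sets not containing the cell are each avoided where some polynomial is nonzero. On
    the segment joining two such parameters, both polynomials and Q are nonzero at a common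
    point. *)
Lemma cell_irreducible j : irreducible_set (cell j).
Proof.
split; first by exists (phi y0), y0 => //; exact: dom_y0.
move=> C1 C2 c1 c2 C12; apply: contrapT => /not_orP[nC1 nC2].
have sep C : closed C -> ~ (cell j `<=` C) -> exists y N p, [/\ dom j y,
    boxpoly N p, p y != 0 & forall z, Q z != 0 -> p z != 0 -> ~ C (phi z)].
  move=> cC nC; have [_ [y yj <-] nCy] : exists2 x, cell j x & ~ C x.
    apply: contrapT => H; apply: nC => x cx; apply: contrapT => Cx.
    by apply: H; exists x.
  have [e [f [_ Vf fC fy]]] := graded_sep gV cC nCy.
  have [c [L [L0 LP]]] := chart_eval ch; have [p bp pE] := LP _ _ Vf.
  exists y, (c * e)%N, p; split=> //.
    by apply: contraNneq fy => p0; rewrite pE ?p0 ?mulr0//; case: yj.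
  move=> z Qz pz Cz; move: (fC _ Cz); rewrite pE// => /eqP.
  by rewrite mulf_eq0 (negbTE pz) orbF expf_eq0 (negbTE (L0 _ Qz)) andbF.
have [y [N [p [yj bp py pC]]]] := sep _ c1 nC1.
have [z [N' [q [zj bq qz qC]]]] := sep _ c2 nC2.
have [M bQ] := chart_dom ch.
have bpq := boxpolyM bp bQ.
have [|| s] := polyfun_mul_neq0 charK (s := 0) (t := 1)
  (boxpoly_segment y z bpq) (boxpoly_segment y z bq).
- by rewrite segment0 mulf_neq0//; case: yj.
- by rewrite segment1.
rewrite !mulf_eq0 !negb_or => /andP[/andP[ps Qs] qs].
have /C12[] : cell j (phi (segment y z s)).
- by exists (segment y z s) => //; exact: dom_segment.
- exact: pC.
- exact: qC.
Qed.

(** Up to a common factor, forms of degree e pull back to combinations of (c e + 1)^j monomials; a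
    larger family therefore has a linear relation. *)
Lemma cell_growth j : (j <= k)%N -> growth_le V (cell j) j.
Proof.
move=> jk; have [c [L [L0 LP]]] := chart_eval ch.
exists c => e J g Vg cJ indg.
have /choice[d dP] t : exists d : {ffun 'I_j -> 'I_(c * e).+1} -> K, forall y,
    dom j y -> g t (phi y) =
      L y ^+ e * \sum_b d b * \prod_(i < j) y (widen_ord jk i) ^+ b i.
  have [p bp pE] := LP _ _ (Vg t).
  have [d dP] := boxpoly_prefix y0 jk bp.
  by exists d => y [Qy yj]; rewrite pE// dP.
have [|a [[t at0] aP]] := @linear_dependency K J _ d.
  by rewrite card_ffun !card_ord.
case/eqP: at0; apply: indg t => _ [y yj <-].
under eq_bigr do rewrite dP// mulrCA.
rewrite -mulr_sumr; under eq_bigr do rewrite mulr_sumr.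
rewrite exchange_big big1 ?mulr0//= => b _.
by under eq_bigr do rewrite mulrA; rewrite -mulr_suml aP mul0r.
Qed.

(** The inverse of the chart gives the form: G - y0_j H equals (y_j - y0_j) H on the image. *)
Lemma cell_function j : (j < k)%N -> exists e f,
  [/\ V e f, forall x, cell j x -> f x = 0 & exists2 x, cell j.+1 x & f x != 0].
Proof.
move=> jk; pose i := Ordinal jk.
have [e [G [H [VG VH GH]]]] := chart_coord ch i.
have fE y : Q y != 0 -> - y0 i * H (phi y) + G (phi y) = (y i - y0 i) * H (phi y).
  by move=> /GH[_ ->]; rewrite -mulrDl addrC.
exists e, (fun x => - y0 i * H x + G x); split; first exact: (graded_lin gV).
  by move=> _ [y [Qy yj] <-]; rewrite fE// yj// subrr mul0r.
have [M bQ] := chart_dom ch.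
(* A segment in the direction of parameter j: any s with s Q nonzero on it gives a point of the next
   cell with y_j different from y0_j. *)
pose z l := if l == i then y0 i + 1 else y0 l.
have [||s] := polyfun_mul_neq0 charK (s := 1) (t := 0)
  (@polyfun_id K) (boxpoly_segment y0 z bQ).
- exact: oner_neq0.
- by rewrite segment0.
rewrite mulf_eq0 negb_or => /andP[s0 Qs].
exists (phi (segment y0 z s)).
  exists (segment y0 z s) => //; split=> // l jl.
  rewrite /segment /z; case: eqP => [li|_]; last by rewrite subrr mulr0 addr0.
  by move: jl; rewrite li /= ltnn.
rewrite fE// mulf_neq0//; last by have [] := GH _ Qs.
by rewrite /segment /z eqxx addrAC subrr add0r addrAC subrr add0r mulr1.
Qed.

Context {T : topologicalType} {gT : finGroupType} {act : gT -> D -> D}.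
Context {proj : D -> T}.
Hypothesis qV : quotient_by V act proj.

Let cellT j := proj @` cell j.

Lemma cellS i j : (i <= j)%N -> cell i `<=` cell j.
Proof.
move=> ij _ [y [Qy yi] <-]; exists y => //; split=> // l jl.
by apply: yi; exact: leq_trans jl.
Qed.

(** Otherwise [cell j.+1], being irreducible, would be carried by one group element into the closure
    of [cell j]. The translates of the cells 0, ..., j + 1 would then give a chain of length j + 1
    there, against the growth bound. *)
Lemma cellT_strict j : (j < k)%N -> ~ (cellT j.+1 `<=` closure (cellT j)).
Proof.
move=> jk sub.
have [a aP] : exists a, cell j.+1 `<=` act a @^-1` closure (cell j).
  apply: irreducible_finite (cell_irreducible _) _ _ => [a|x cx].
    by apply: (act_closed gV qV); exact: closed_closure.
  have := closed_quot_image gV qV (@closed_closure _ (cell j)).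
  move=> /closure_subset_closed/(_ (image_subset _ (@subset_closure _ (cell j)))).
  move=> /(_ (proj x) (sub _ _))[]; first by exists x.
  move=> y cy /esym/(quot_eq qV)[a ya]; exists a.
  by rewrite /preimage /= -ya.
pose W m := closure (act a @` cell m).
have WC m : (m <= j.+1)%N -> W m `<=` closure (cell j).
  move=> mj; apply: closure_subset_closed; first exact: closed_closure.
  by move=> _ [x /(cellS mj)/aP cx <-].
suff : irr_chain (closure (cell j)) j.+1 W.
  move/(chain_bound gV (@subset_refl _ _) (cell_growth (ltnW jk))).
  by rewrite ltnn.
split=> [m mj|m mj]; last first.
  have mk : (m < k)%N by exact: leq_trans mj jk.
  split; first by apply: closureS; apply: image_subset; exact: cellS.
  have [e [f [Vf f0 [x cx fx]]]] := cell_function mk.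
  pose g := f \o act a^-1%g.
  have Vg : V e g by exact: (quot_graded qV).
  have ga y : g (act a y) = f y.
    by rewrite /g /= -(quot_actM qV) mulVg (quot_act1 qV).
  move=> WW; case/eqP: fx; rewrite -ga.
  apply: (eq0_on_closure gV Vg (B := act a @` cell m)).
    by move=> _ [y cy <-]; rewrite ga f0.
  by apply: WW; apply: subset_closure; exists x.
split.
  exists (W m); first exact: closed_closure.
  by apply/seteqP; split=> x; [move=> Wx; split; [exact: (WC m mj)|]|case].
apply: (@irreducible_between _ (act a @` cell m)) => //; last exact: subset_closure.
apply: irreducible_image (cell_irreducible m).
by move=> C; exact: (act_closed gV qV).
Qed.

(** Upper bound: forms on the quotient are forms upstairs, so they inherit the growth of the full
    cell. Lower bound: the closures of the images of the cells, intersected with A, form a strict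
    chain. *)
Lemma dim_chart (A : set T) :
  proj @` (phi @` [set y | Q y != 0]) `<=` A ->
  A `<=` closure (proj @` (phi @` [set y | Q y != 0])) ->
  irreducible_set A /\ has_dim A k.
Proof.
have -> : proj @` (phi @` [set y | Q y != 0]) = cellT k.
  congr (proj @` (phi @` _)); apply/seteqP; split=> [y Qy|y []//].
  by split=> // i; rewrite leqNgt ltn_ord.
move=> cA Acl.
have irrT j : irreducible_set (cellT j).
  apply: irreducible_image (cell_irreducible j).
  by move=> C /(quot_closed qV).
have cTA j : (j <= k)%N -> cellT j `<=` A.
  by move=> jk x [y /(cellS jk) cy <-]; apply: cA; exists y.
split; first exact: irreducible_between (irrT k) _ _.
split; last first.
  move=> l Z; apply: (chain_bound (graded_quot charK gV qV) Acl).
  have [c cP] := cell_growth (leqnn k).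
  exists c => e J g Vg cJ indg.
  apply: (cP e J (fun j => g j \o proj) Vg cJ) => b b0; apply: indg.
  by move=> _ [x cx <-]; exact: b0.
exists (fun j => A `&` closure (cellT j)); split=> [j jk|j jk]; last first.
  split=> [x [Ax cx]|sub].
    split=> //; apply: closureS cx => z; apply: image_subset.
    by apply: cellS; exact: leqnSn.
  apply: (cellT_strict jk) => x cx.
  have [] := sub x; last by [].
  by split; [exact: (cTA j.+1)|exact: subset_closure].
split; first by exists (closure (cellT j)) => //; exact: closed_closure.
apply: irreducible_between (irrT j) _ _ => [x cx|x []//].
by split; [exact: (cTA j)|exact: subset_closure].
Qed.

End Charts.

Arguments chart {K D} V {k} phi Q.

(** * Multihomogeneous forms *)

Section MultiForms.
Local Open Scope ring_scope.
Context {K : fieldType} {X : Type} {r m : nat} (x : 'I_r -> 'I_m -> X -> K).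
Implicit Types (e : 'I_r -> nat) (f g : X -> K).

(** Multihomogeneous polynomial functions generated from the coordinates, so that statements about
    them go by induction; [mform_mpoly] and [mpoly_mform] translate to and from polynomials. *)
Inductive mform : ('I_r -> nat) -> (X -> K) -> Prop :=
| mform0 e : mform e (fun=> 0)
| mform_cst a : mform (fun=> 0%N) (fun=> a)
| mform_coord i j : mform (fun l => nat_of_bool (l == i)) (x i j)
| mformD e f g : mform e f -> mform e g -> mform e (fun p => f p + g p)
| mformM e e' f g : mform e f -> mform e' g ->
    mform (fun i => e i + e' i)%N (fun p => f p * g p).

Lemma mformZ e a f : mform e f -> mform e (fun p => a * f p).
Proof. exact: mformM (mform_cst a). Qed.

Lemma mformX e f i : mform e f -> mform (fun l => i * e l)%N (fun p => f p ^+ i).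
Proof.
move=> ef; elim: i => [|i IH].
  by under [X in mform _ X]eq_fun do rewrite expr0; exact: mform_cst.
under [X in mform _ X]eq_fun do rewrite exprS.
by under eq_fun do rewrite mulSn; exact: mformM.
Qed.

Lemma mform_sum (I : Type) (s : seq I) (P : pred I) e (f : I -> X -> K) :
  (forall i, P i -> mform e (f i)) -> mform e (fun p => \sum_(i <- s | P i) f i p).
Proof.
move=> ef; elim: s => [|i s IH].
  by under [X in mform _ X]eq_fun do rewrite big_nil; exact: mform0.
under [X in mform _ X]eq_fun do rewrite big_cons.
have := ef i; case: (P i) => // fi.
by apply: mformD => //; exact: fi.
Qed.

Lemma mform_prod (I : Type) (s : seq I) (e : I -> 'I_r -> nat) (f : I -> X -> K) :
  (forall i, mform (e i) (f i)) ->
  mform (fun l => \sum_(i <- s) e i l)%N (fun p => \prod_(i <- s) f i p).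
Proof.
move=> ef; elim: s => [|i s IH].
  under [X in mform _ X]eq_fun do rewrite big_nil.
  by under eq_fun do rewrite big_nil; exact: mform_cst.
under [X in mform _ X]eq_fun do rewrite big_cons.
by under eq_fun do rewrite big_cons; exact: mformM.
Qed.

(** [P N] stands for polynomial functions of degree N in a loose sense, in applications [boxpoly N]
    or [polyfun]. The factors [l i] absorb the choice of representatives. *)
Lemma mform_pull (Y : Type) (S : set Y) (phi : Y -> X) (P : nat -> (Y -> K) -> Prop)
    (c : nat) (l : 'I_r -> Y -> K) (q : 'I_r -> 'I_m -> Y -> K) :
  (forall N a, P N (fun=> a)) ->
  (forall N (f g : Y -> K), P N f -> P N g -> P N (fun y => f y + g y)) ->
  (forall N N' (f g : Y -> K), P N f -> P N' g -> P (N + N')%N (fun y => f y * g y)) ->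
  (forall i j, P c (q i j)) ->
  (forall y i j, S y -> x i j (phi y) = l i y * q i j y) ->
  forall e f, mform e f -> exists2 p, P (c * \sum_i e i)%N p &
    forall y, S y -> f (phi y) = (\prod_i l i y ^+ e i) * p y.
Proof.
move=> Pc PD PM Pq xl e f; elim=> {e f}.
- by move=> e; exists (fun=> 0) => // y _; rewrite mulr0.
- move=> a; exists (fun=> a) => // y _.
  by under eq_bigr do rewrite expr0; rewrite big1 ?mul1r.
- move=> i j; exists (q i j).
    rewrite (bigD1 i)//= eqxx big1 ?addn0 ?muln1//.
    by move=> h /negbTE->.
  move=> y Sy; rewrite xl//; congr (_ * _).
  rewrite (bigD1 i)//= eqxx expr1 big1 ?mulr1//.
  by move=> h /negbTE->.
- move=> e f g _ [p Pp fp] _ [p' Pp' gp]; exists (fun y => p y + p' y); first exact: PD.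
  by move=> y Sy; rewrite fp// gp// mulrDr.
- move=> e e' f g _ [p Pp fp] _ [p' Pp' gp]; exists (fun y => p y * p' y).
    by rewrite big_split/= mulnDr; exact: PM.
  move=> y Sy; rewrite fp// gp// mulrACA -big_split/=; congr (_ * _).
  by apply: eq_bigr => i _; rewrite exprD.
Qed.

(** One degree shared by all blocks yields a grading by integers that permutations of the blocks
    preserve. *)
Definition uform : nat -> set (X -> K) := fun N f => mform (fun=> N) f.

Context {M : nat} {h : 'I_M -> 'I_r * 'I_m} {h' : 'I_r * 'I_m -> 'I_M}.
Hypotheses (hK : cancel h h') (h'K : cancel h' h).

Definition has_multidegree e (F : {mpoly K[M]}) :=
  forall u, u \in msupp F -> forall i, (\sum_j u (h' (i, j)) = e i)%N.

Definition mpoly_fun (F : {mpoly K[M]}) : X -> K :=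
  fun p => F.@[fun k => x (h k).1 (h k).2 p].

Lemma mform_mpoly e F : has_multidegree e F -> mform e (mpoly_fun F).
Proof.
move=> eF; rewrite /mpoly_fun; under [X in mform _ X]eq_fun do rewrite mevalE big_seq.
apply: mform_sum => u uF; apply: mformZ.
have -> : e = fun i => (\sum_k u k * (i == (h k).1))%N.
  apply/funext => i; rewrite -(eF _ uF i) (reindex h')/=; last first.
    by exists h => k _; rewrite ?hK ?h'K.
  under [RHS]eq_bigr do rewrite h'K.
  transitivity (\sum_i' \sum_j u (h' (i', j)) * (i == i'))%N; last first.
    by rewrite pair_bigA; apply: eq_bigr => -[].
  rewrite [RHS](bigD1 i)//= [X in _ = (_ + X)%N]big1 ?addn0.
    by apply: eq_bigr => j _; rewrite eqxx muln1.
  by move=> i' /negbTE ii'; rewrite big1// => j _; rewrite eq_sym ii' muln0.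
by apply: mform_prod => k; apply: mformX; exact: mform_coord.
Qed.

Lemma mpoly_mform e f : mform e f ->
  exists2 F, has_multidegree e F & f = mpoly_fun F.
Proof.
elim=> {e f}.
- move=> e; exists 0; first by move=> u; rewrite msupp0.
  by apply/funext => p; rewrite /mpoly_fun meval0.
- move=> a; exists a%:MP; last by apply/funext => p; rewrite /mpoly_fun mevalC.
  move=> u; rewrite msuppC; case: eqP => // _; rewrite inE => /eqP-> i.
  by rewrite big1// => j _; rewrite mnm0E.
- move=> i j; exists 'X_(h' (i, j)); last first.
    by apply/funext => p; rewrite /mpoly_fun mevalXU h'K.
  move=> u; rewrite msuppX inE => /eqP-> i'.
  under eq_bigr do rewrite mnm1E (can_eq h'K) xpair_eqE.
  rewrite [i' == i]eq_sym; case: (i == i') => /=; last by rewrite big1.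
  rewrite (bigD1 j)//= eqxx big1// => j' /negbTE.
  by rewrite eq_sym => ->.
- move=> e f g _ [F eF ->] _ [G eG ->]; exists (F + G); last first.
    by apply/funext => p; rewrite /mpoly_fun mevalD.
  by move=> u /msuppD_le; rewrite mem_cat => /orP[/eF|/eG].
- move=> e e' f g _ [F eF ->] _ [G eG ->]; exists (F * G); last first.
    by apply/funext => p; rewrite /mpoly_fun mevalM.
  move=> u /msuppM_le /allpairsP[[v w] /= [/eF vF /eG wG ->]] i.
  by rewrite -vF -wG -big_split/=; apply: eq_bigr => j _; rewrite mnmDE.
Qed.

End MultiForms.

Arguments mform0 {K X r m x} e.
Arguments mform_cst {K X r m x} a.
Arguments mform_coord {K X r m x} i j.

(** * Zariski topologies generated by nonvanishing loci of forms *)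

Section SubbaseSeparation.
Local Open Scope ring_scope.
Context {K : fieldType} {T : topologicalType} {r m : nat}.
Context {x : 'I_r -> 'I_m -> T -> K} {b : set (set T)}.
Hypothesis openP : forall U, open U <->
  exists2 D, D `<=` finI_from b id & \bigcup_(B in D) B = U.
Hypothesis basicP : forall B, b B <-> exists e f, mform x e f /\ B = [set p | f p != 0].

Lemma mform_closed e f : mform x e f -> closed [set p | f p = 0].
Proof.
move=> ef; rewrite (_ : [set p | _] = ~` [set p | f p != 0]); last first.
  apply/seteqP; split=> p /= => [->|]; first by rewrite eqxx.
  by move/negP; rewrite negbK => /eqP.
rewrite closedC; apply/openP; exists [set [set p | f p != 0]].
  by move=> _ ->; apply: (@finI_from1 _ _ b id); apply/basicP; exists e, f.
by rewrite bigcup_set1.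
Qed.

(** The complement of C contains, around p, a finite intersection of nonvanishing loci; the product
    of the corresponding forms separates p from C. *)
Lemma mform_sep C p : closed C -> ~ C p ->
  exists e f, [/\ mform x e f, forall q, C q -> f q = 0 & f p != 0].
Proof.
move=> /closed_openC/openP[D Db DC] Cp.
have : (~` C) p by [].
rewrite -DC => -[B DB Bp]; have [F Fb BE] := Db _ DB.
suff [e [f [ef fp Ff]]] : exists e f, [/\ mform x e f, f p != 0 &
    forall q, f q != 0 -> forall B', B' \in (F : seq _) -> B' q].
  exists e, f; split=> // q Cq; apply/eqP/negPn/negP => /Ff Fq.
  suff : (~` C) q by [].
  by rewrite -DC; exists B => //; rewrite -BE => B' /Fq.
have : {in (F : seq _), forall B', b B' /\ B' p}.
  move=> B' FB'; split; first by apply/set_mem/Fb.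
  by move: Bp; rewrite -BE; exact.
elim: (F : seq _) => {F Fb BE} [_|B' F IH FB].
  exists (fun=> 0%N), (fun=> 1); split=> //; last by rewrite oner_neq0.
  exact: mform_cst.
have [|e [f [ef fp Ff]]] := IH; first by move=> B'' F''; apply: FB; rewrite inE F'' orbT.
have [/basicP[e' [f' [ef' B'E]]] B'p] := FB B' (mem_head _ _).
exists (fun i => e' i + e i)%N, (fun q => f' q * f q); split; first exact: mformM.
  by rewrite mulf_neq0//; move: B'p; rewrite B'E.
move=> q; rewrite mulf_eq0 negb_or => /andP[f'q /Ff fq] B''.
by rewrite inE => /orP[/eqP->|/fq//]; rewrite B'E.
Qed.

(* Raising all block degrees to a common positive value costs only powers of
   coordinates that do not vanish at p. *)
Lemma graded_uform : (forall p i, exists j, x i j p != 0) -> graded (uform x).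
Proof.
move=> x0; split.
- by move=> e; exact: mform0.
- exact: mform_cst.
- by move=> e a f g ef eg; apply: mformD => //; exact: mformZ.
- by move=> e e' f g; exact: mformM.
- by move=> e f; exact: mform_closed.
move=> C p cC Cp; have [e [f [ef fC fp]]] := mform_sep cC Cp.
have /choice[j jP] := x0 p.
pose E := (\max_i e i).+1.
exists E, (fun q => f q * \prod_i x i (j i) q ^+ (E - e i)); split=> //.
- rewrite /uform; have -> : (fun=> E) = fun i => (e i + \sum_l (E - e l) * (i == l))%N.
    apply/funext => i; rewrite (bigD1 i)//= eqxx muln1 big1 ?addn0.
      by rewrite subnKC// ltnW// ltnS leq_bigmax.
    by move=> l /negbTE; rewrite eq_sym => ->; rewrite muln0.
  apply: mformM => //; apply: mform_prod => i; apply: mformX; exact: mform_coord.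
- by move=> q /fC->; rewrite mul0r.
- rewrite mulf_neq0// prodf_seq_neq0; apply/allP => i _.
  by rewrite expf_neq0 ?implybT.
Qed.

End SubbaseSeparation.

(** * Projective spaces, ordered tuples and unordered sets of points *)

Section ProjectiveInstances.
Local Open Scope ring_scope.
Context {K : fieldType}.

Definition pcoord m (i : 'I_1) (j : 'I_m.+1) (p : projspace K m) : K := rep p 0 j.

Lemma exists_coord_neq0 m (p : projspace K m) : exists j, rep p 0 j != 0.
Proof. by have /rV0Pn := rep_neq0 p. Qed.

Let h1 m (k : 'I_m) : 'I_1 * 'I_m := (ord0, k).
Let h1K m : cancel (@h1 m) snd. Proof. by []. Qed.
Let h1'K m : cancel snd (@h1 m). Proof. by move=> [i j]; rewrite /h1 [i]ord1. Qed.

Let multidegree1 m (F : {mpoly K[m.+1]}) e :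
  has_multidegree (h' := snd) (fun _ : 'I_1 => e) F <-> F \is e.-homog.
Proof.
split=> [eF|/dhomogP eF].
  by apply/dhomogP => u /eF/(_ ord0) <-; rewrite /= mdegE.
by move=> u /eF <- i; rewrite /= mdegE.
Qed.

Lemma mform_hval m e (F : {mpoly K[m.+1]}) :
  F \is e.-homog -> uform (@pcoord m) e (hval F).
Proof. by move=> /multidegree1; exact: (mform_mpoly _ (@h1K _) (@h1'K _)). Qed.

Lemma hval_mform m e f : mform (@pcoord m) e f ->
  exists2 F : {mpoly K[m.+1]}, F \is (e ord0).-homog & f = hval F.
Proof.
move=> /(mpoly_mform (@h1'K _))[F eF ->]; exists F => //; apply/multidegree1.
by move=> u /eF eu i; rewrite eu [i]ord1.
Qed.

Lemma graded_projspace m : graded (uform (@pcoord m)).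
Proof.
apply: (graded_uform (b := @proj_basic K m)) => [U|B|p i].
- by split=> -[D sD <-]; exists D.
- split=> [[F [e [eF BE]]]|[e [f [/hval_mform[F eF fE] ->]]]].
    exists (fun=> e), (hval F); split; last exact: BE.
    exact: mform_hval.
  by exists F, (e ord0); rewrite fE.
- exact: exists_coord_neq0.
Qed.

Definition tcoord m r (i : 'I_r) (j : 'I_m.+1) (t : dtuple K m r) : K :=
  rep (tnth (val t) i) 0 j.

Let h2 r m (k : 'I_(r * m)) : 'I_r * 'I_m :=
  enum_val (cast_ord (esym (mxvec_cast r m)) k).
Let h2' r m (p : 'I_r * 'I_m) : 'I_(r * m) := mxvec_index p.1 p.2.
Let h2'K r m : cancel (@h2' r m) (@h2 r m).
Proof. by move=> [i j]; rewrite /h2 /h2' cast_ordK enum_rankK. Qed.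
Let h2K r m : cancel (@h2 r m) (@h2' r m).
Proof. by move=> k; case/mxvec_indexP: k => i j; rewrite -[mxvec_index i j]/(h2' (i, j)) h2'K. Qed.

Let mhvalE m r (F : {mpoly K[r * m.+1]}) :
  (fun t : dtuple K m r => mhval F (val t)) = mpoly_fun (@tcoord m r) (h := @h2 r m.+1) F.
Proof.
apply/funext => t; apply: meval_eq => k.
case/mxvec_indexP: k => i j; rewrite mxvecE mxE.
by rewrite -[mxvec_index i j]/(h2' (i, j)) h2'K.
Qed.

Lemma graded_dtuple m r : graded (uform (@tcoord m r)).
Proof.
apply: (graded_uform (b := @dtuple_basic K m r)) => [U|B|t i].
- by split=> -[D sD <-]; exists D.
- split=> [[F [[e eF] ->]]|[e [f [/(mpoly_mform (@h2'K _ _))[F eF fE] ->]]]].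
    exists e, (fun t => mhval F (val t)); split=> //.
    by rewrite mhvalE; exact: (mform_mpoly _ (@h2K _ _) (@h2'K _ _)).
  exists F; split; first by exists e.
  by apply/seteqP; split=> t /=; rewrite fE -mhvalE.
- exact: exists_coord_neq0.
Qed.

Definition perm_dtuple m r (s : 'S_r) (t : dtuple K m r) : dtuple K m r :=
  insubd t [tuple tnth (val t) (s i) | i < r].

Lemma val_perm_dtuple m r (s : 'S_r) (t : dtuple K m r) :
  val (perm_dtuple s t) = [tuple tnth (val t) (s i) | i < r].
Proof.
rewrite insubdK//; apply/tuple_uniqP => i j; rewrite !tnth_mktuple.
by move/(tuple_uniqP _ (valP t))/perm_inj.
Qed.

Lemma tnth_perm_dtuple m r (s : 'S_r) (t : dtuple K m r) i :
  tnth (val (perm_dtuple s t)) i = tnth (val t) (s i).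
Proof. by rewrite val_perm_dtuple tnth_mktuple. Qed.

Lemma mem_unord m r (t : dtuple K m r) p :
  (p \in val (unord t)) = (p \in (val t : seq _)).
Proof. by rewrite /= in_fset. Qed.

Lemma unordP m r (t t' : dtuple K m r) :
  unord t = unord t' <-> exists s, t' = perm_dtuple s t.
Proof.
split=> [tt'|[s ->]].
  have : perm_eq (val t') (val t).
    apply: uniq_perm => [||p]; rewrite ?(valP t) ?(valP t')//.
    have /(congr1 (fun S : rsets K m r => p \in val S)) := tt'.
    by rewrite !mem_unord => ->.
  move/tuple_permP => [s sE]; exists s; apply/val_inj/val_inj.
  by rewrite val_perm_dtuple.
apply/val_inj/fsetP => p; rewrite -/(val _) !mem_unord.
have := val_perm_dtuple s t => /(congr1 val) tE.
suff /perm_mem -> : perm_eq (val (perm_dtuple s t)) (val t) by [].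
by apply/tuple_permP; exists s; rewrite -tE.
Qed.

Lemma quotient_rsets m r : quotient_by (uform (@tcoord m r)) (@perm_dtuple m r) unord.
Proof.
split.
- move=> t; apply/val_inj/eq_from_tnth => i.
  by rewrite tnth_perm_dtuple perm1.
- move=> a b t; apply/val_inj/eq_from_tnth => i.
  by rewrite !tnth_perm_dtuple permM.
(* A permutation of the points permutes the block degrees, so the induction runs over all
   multidegrees before specializing to constant ones. *)
- suff H (a : 'S_r) e f : mform (@tcoord m r) e f ->
      mform (@tcoord m r) (fun i => e ((a^-1%g : 'S_r) i)) (f \o perm_dtuple a).
    by move=> a N f; exact: (H a (fun=> N)).
  elim=> {e f} [e|b|i j|e f g _ ef _ eg|e e' f g _ ef _ eg].
  + exact: mform0.
  + exact: mform_cst.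
  + have -> : (fun l => nat_of_bool ((a^-1%g : 'S_r) l == i)) = fun l => nat_of_bool (l == a i).
      by apply/funext => l; rewrite (canF_eq (permKV a)).
    rewrite (_ : _ \o _ = tcoord (a i) j); first exact: mform_coord.
    by apply/funext => t; rewrite /tcoord/= tnth_perm_dtuple.
  + exact: mformD ef eg.
  + exact: mformM ef eg.
- exact: unordP.
- move=> S; have sS : size (val S : seq _) == r by exact: (valP S).
  have uS : uniq (Tuple sS) by exact: fset_uniq.
  exists (exist _ (Tuple sS) uS); apply/val_inj/fsetP => p.
  by rewrite mem_unord.
- by move=> C; split; rewrite -!openC.
Qed.

End ProjectiveInstances.

(** * Veronese varieties and their tangent spaces *)

Section DirectionalDerivative.
Local Open Scope ring_scope.
Context {K : fieldType} {M : nat}.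
Implicit Types (F G : {mpoly K[M]}) (p w : 'I_M -> K).

Definition dirder F p w : K := \sum_j F^`M(j).@[p] * w j.

Lemma dirderD F G p w : dirder (F + G) p w = dirder F p w + dirder G p w.
Proof.
by rewrite -big_split; apply: eq_bigr => j _; rewrite mderivD mevalD mulrDl.
Qed.

Lemma dirderZ a F p w : dirder (a *: F) p w = a * dirder F p w.
Proof. by rewrite mulr_sumr; apply: eq_bigr => j _; rewrite mderivZ mevalZ mulrA. Qed.

Lemma dirder0 p w : dirder 0 p w = 0.
Proof. by rewrite -(scale0r 0) dirderZ mul0r. Qed.

Lemma dirderN F p w : dirder (- F) p w = - dirder F p w.
Proof. by rewrite -scaleN1r dirderZ mulN1r. Qed.

Lemma dirderM F G p w :
  dirder (F * G) p w = dirder F p w * G.@[p] + F.@[p] * dirder G p w.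
Proof.
rewrite mulr_suml mulr_sumr -big_split; apply: eq_bigr => j _.
by rewrite mderivM mevalD !mevalM mulrDl mulrA mulrAC.
Qed.

Lemma dirder1 p w : dirder 1 p w = 0.
Proof. by rewrite /dirder big1// => j _; rewrite -[1]/(1%:MP) mderivC meval0 mul0r. Qed.

Lemma dirderXU i p w : dirder 'X_i p w = w i.
Proof.
have U0 : (U_(i) - U_(i) = 0 :> 'X_{1..M})%MM.
  by apply/mnmP => j; rewrite mnmBE subnn mnm0E.
rewrite /dirder (bigD1 i)//= big1 ?addr0 => [|j /negbTE ji].
  by rewrite mderivX mnm1E eqxx scale1r U0 mpolyX0 meval1 mul1r.
by rewrite mderivX mnm1E eq_sym ji scale0r meval0 mul0r.
Qed.

Lemma dirder_sum (I : Type) (r : seq I) (F : I -> {mpoly K[M]}) p w :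
  dirder (\sum_(i <- r) F i) p w = \sum_(i <- r) dirder (F i) p w.
Proof.
elim: r => [|i r IH]; first by rewrite !big_nil dirder0.
by rewrite !big_cons dirderD IH.
Qed.

Lemma dirderZr a F p w : dirder F p (fun j => a * w j) = a * dirder F p w.
Proof. by rewrite mulr_sumr; apply: eq_bigr => j _; rewrite mulrCA. Qed.

Lemma dirder_prod_eq0 (I : Type) (r : seq I) (F : I -> {mpoly K[M]}) p w :
  (forall i, dirder (F i) p w = 0) -> dirder (\prod_(i <- r) F i) p w = 0.
Proof.
move=> F0; elim: r => [|i r IH]; first by rewrite big_nil dirder1.
by rewrite big_cons dirderM F0 IH mul0r mulr0 addr0.
Qed.

Lemma dirderX_eq0 F k p w : dirder F p w = 0 -> dirder (F ^+ k) p w = 0.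
Proof.
move=> F0; elim: k => [|k IH]; first by rewrite expr0 dirder1.
by rewrite exprS dirderM F0 IH mul0r mulr0 addr0.
Qed.

(** Chain rule along a polynomial curve, the derivative in s being the formal one. *)
Lemma mpoly_curve F (c : 'I_M -> {poly K}) : exists q : {poly K}, forall s,
  q.[s] = F.@[fun j => (c j).[s]] /\
  q^`().[s] = dirder F (fun j => (c j).[s]) (fun j => (c j)^`().[s]).
Proof.
pose curved G := exists q : {poly K}, forall s, q.[s] = G.@[fun j => (c j).[s]] /\
  q^`().[s] = dirder G (fun j => (c j).[s]) (fun j => (c j)^`().[s]).
have cM G H : curved G -> curved H -> curved (G * H).
  move=> [q qP] [q' q'P]; exists (q * q') => s.
  have [q0 q1] := qP s; have [q'0 q'1] := q'P s.
  by rewrite derivM hornerD !hornerM mevalM dirderM q1 q'1 q0 q'0.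
have c1 : curved 1.
  by exists 1 => s; rewrite meval1 dirder1 -[1]/(1%:P) hornerC derivC horner0.
have cZ a G : curved G -> curved (a *: G).
  move=> [q qP]; exists (a *: q) => s; have [qs q1] := qP s.
  by rewrite derivZ !hornerZ mevalZ dirderZ qs q1.
have cS G H : curved G -> curved H -> curved (G + H).
  move=> [q qP] [q' q'P]; exists (q + q') => s.
  have [qs q1] := qP s; have [q's q'1] := q'P s.
  by rewrite derivD !hornerD mevalD dirderD qs q1 q's q'1.
rewrite -[exists _, _]/(curved F) (mpolyE F).
elim: (msupp F : seq _) => [|m r IH].
  rewrite big_nil; exists 0 => s.
  by rewrite meval0 dirder0 -[0]/(0%:P) hornerC derivC horner0.
rewrite big_cons; apply: (cS) => //; apply: (cZ); rewrite mpolyXE_id.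
elim: (index_enum _) => [|i s IH']; first by rewrite big_nil.
rewrite big_cons; apply: (cM) => //.
elim: (m i) => [|l IHl]; first by rewrite expr0.
rewrite exprS; apply: (cM) => //.
by exists (c i) => t; rewrite mevalXU dirderXU.
Qed.

Lemma meval_homogZ e F a p : F \is e.-homog ->
  F.@[fun j => a * p j] = a ^+ e * F.@[p].
Proof.
move=> /dhomogP eF; rewrite !mevalE mulr_sumr big_seq [RHS]big_seq.
apply: eq_bigr => m mF; rewrite mulrCA; congr (_ * _).
rewrite -(eF _ mF) /= mdegE expr_sum -big_split/=.
by apply: eq_bigr => i _; rewrite exprMn.
Qed.

Hypothesis charK : [pchar K] =i pred0.

Lemma poly_eq0_pointwise (q : {poly K}) : (forall s, q.[s] = 0) -> q = 0.
Proof.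
by move=> q0; apply/eqP/negPn/negP => /(exists_nonroot charK)[s]; rewrite q0 eqxx.
Qed.

Lemma poly_eq_pointwise (q q' : {poly K}) : (forall s, q.[s] = q'.[s]) -> q = q'.
Proof.
move=> qq'; apply/eqP; rewrite -subr_eq0; apply/eqP/poly_eq0_pointwise => s.
by rewrite hornerD hornerN qq' subrr.
Qed.

Lemma dirder_curve F (c : 'I_M -> {poly K}) (q : {poly K}) s :
  (forall s, q.[s] = F.@[fun j => (c j).[s]]) ->
  q^`().[s] = dirder F (fun j => (c j).[s]) (fun j => (c j)^`().[s]).
Proof.
move=> qF; have [q' q'P] := mpoly_curve F c.
have -> : q = q' by apply: poly_eq_pointwise => t; rewrite qF (q'P t).1.
by rewrite (q'P s).2.
Qed.

(** Derivative at s = 0 of F(a (p + s w)) = a^e F(p + s w). The factor a on the left avoids the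
    exponent e - 1. *)
Lemma dirder_homogZ e F a p w : F \is e.-homog ->
  a * dirder F (fun j => a * p j) w = a ^+ e * dirder F p w.
Proof.
move=> eF; pose c j := (p j)%:P + w j *: 'X.
have c0 j : (c j).[0] = p j.
  by rewrite hornerD hornerC hornerZ hornerX mulr0 addr0.
have c1 j : (c j)^`().[0] = w j.
  rewrite derivD derivC add0r derivZ derivX hornerZ.
  by rewrite -[1]/(1%:P) hornerC mulr1.
have [q qP] := mpoly_curve F c.
have := @dirder_curve F (fun j => a *: c j) (a ^+ e *: q) 0.
rewrite derivZ hornerZ (qP 0).2 (funext c0) (funext c1) => -> => [|s].
  rewrite -dirderZr; congr (dirder F _ _); apply/funext => j.
    by rewrite hornerZ c0.
  by rewrite derivZ hornerZ c1.
rewrite hornerZ (qP s).1 -(meval_homogZ _ _ eF).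
by apply: meval_eq => j; rewrite hornerZ.
Qed.

End DirectionalDerivative.

Section VeroneseCoordinates.
Local Open Scope ring_scope.
Context {K : fieldType} {n d : nat}.
Implicit Types (x w : 'rV[K]_n.+1) (F : {mpoly K[n.+1]}).

Definition vero_mnm (j : 'I_(veroN n d).+1) : 'X_{1..n.+1} :=
  [multinom (tnth (enum_val (cast_ord (veroNE n d) j)) i : nat) | i < n.+1].

Lemma vero_vecE x j : vero_vec d x 0 j = 'X_[vero_mnm j].@[x 0].
Proof. by rewrite mxE mevalX; apply: eq_bigr => i _; rewrite mnmE. Qed.

Lemma mdeg_vero_mnm j : mdeg (vero_mnm j) = d.
Proof.
rewrite mdegE; under eq_bigr do rewrite mnmE.
have := enum_valP (cast_ord (veroNE n d) j).
by rewrite inE big_tuple => /eqP.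
Qed.

Lemma vero_mnm_inj : injective vero_mnm.
Proof.
move=> j l /mnmP jl; apply/(cast_ord_inj (eq_n := veroNE n d))/enum_val_inj.
by apply: eq_from_tnth => i; apply/val_inj; have := jl i; rewrite !mnmE.
Qed.

(** Inverse of [vero_mnm] on multidegrees of total degree d; the junk value elsewhere is [ord0]. *)
Definition vero_idx (m : 'X_{1..n.+1}) : 'I_(veroN n d).+1 :=
  odflt ord0 [pick j | vero_mnm j == m].

Lemma vero_idxK m : mdeg m = d -> vero_mnm (vero_idx m) = m.
Proof.
move=> md; rewrite /vero_idx; case: pickP => [j /eqP//|nj].
have mi i : (m i < d.+1)%N.
  by rewrite ltnS -md mdegE (bigD1 i)//= leq_addr.
pose u := [tuple (inord (m i) : 'I_d.+1) | i < n.+1].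
have uE : u \in expos n d.
  rewrite inE big_tuple; apply/eqP; transitivity (mdeg m) => //.
  by rewrite mdegE; apply: eq_bigr => i _; rewrite tnth_mktuple inordK.
have /eqP[] := nj (cast_ord (esym (veroNE n d)) (enum_rank_in uE u)).
apply/mnmP => i; rewrite mnmE cast_ordKV enum_rankK_in//.
by rewrite tnth_mktuple inordK.
Qed.

Lemma homog_vero F : F \is d.-homog ->
  F = \sum_j F@_(vero_mnm j) *: 'X_[vero_mnm j].
Proof.
move=> dF; apply/mpolyP => m; rewrite linear_sum/=.
under eq_bigr do rewrite mcoeffZ mcoeffX.
have [md|md] := eqVneq (mdeg m) d; last first.
  rewrite (dhomog_nemf_coeff dF)// big1// => j _.
  case: eqP => [jm|]; last by rewrite mulr0.
  by move: md; rewrite -jm mdeg_vero_mnm eqxx.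
rewrite (bigD1 (vero_idx m))//= vero_idxK// eqxx mulr1 big1 ?addr0// => j jm.
case: eqP => [mE|]; last by rewrite mulr0.
by case/eqP: jm; apply: vero_mnm_inj; rewrite vero_idxK.
Qed.

Definition vero_jac x : 'M[K]_(n.+1, (veroN n d).+1) :=
  \matrix_(i, j) ('X_[vero_mnm j])^`M(i).@[x 0].

Lemma vero_jacE x w j : (w *m vero_jac x) 0 j = dirder 'X_[vero_mnm j] (x 0) (w 0).
Proof. by rewrite mxE; apply: eq_bigr => i _; rewrite mxE mulrC. Qed.

(** The duality behind the whole criterion: a form of degree d is a linear form on the ambient space
    of the Veronese variety, and its derivative is that linear form evaluated on a tangent
    vector. *)
Lemma dirder_homog_vero F x w : F \is d.-homog ->
  dirder F (x 0) (w 0) = \sum_j F@_(vero_mnm j) * (w *m vero_jac x) 0 j.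
Proof.
move=> /homog_vero {1}->; rewrite dirder_sum; apply: eq_bigr => j _.
by rewrite dirderZ vero_jacE.
Qed.

Lemma homogX_vero j : 'X_[vero_mnm j] \is [in K[n.+1], d.-homog].
Proof. by rewrite dhomogX/= mdeg_vero_mnm. Qed.

Lemma vero_vecZ a x : vero_vec d (a *: x) = a ^+ d *: vero_vec d x.
Proof.
apply/rowP => j; rewrite [RHS]mxE !vero_vecE.
rewrite -(meval_homogZ _ _ (homogX_vero j)).
by apply: meval_eq => i; rewrite mxE.
Qed.

End VeroneseCoordinates.

Section ProjectivePoints.
Local Open Scope ring_scope.
Context {K : fieldType} {m : nat}.
Implicit Types (v w : 'rV[K]_m.+1) (p : projspace K m).

Lemma dim_const_line : \dim <[const_mx 1 : 'rV[K]_m.+1]> == 1%N.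
Proof.
rewrite dim_vline; have -> // : const_mx 1 != 0 :> 'rV[K]_m.+1.
by apply/rV0Pn; exists 0; rewrite mxE oner_neq0.
Qed.

(* The junk value at v = 0 is the point (1 : ... : 1). *)
Definition ppt v : projspace K m :=
  insubd (exist (fun l : {vspace _} => \dim l == 1%N) _ dim_const_line) <[v]>%VS.

Lemma val_ppt v : v != 0 -> val (ppt v) = <[v]>%VS.
Proof. by move=> v0; rewrite insubdK// -topredE/= dim_vline v0. Qed.

Lemma val_projspace p : val p = <[rep p]>%VS.
Proof.
apply/esym/eqP; rewrite eqEdim (eqP (valP p)) dim_vline rep_neq0 leqnn andbT.
exact: memv_pick.
Qed.

Lemma ppt_rep p : ppt (rep p) = p.
Proof. by apply/val_inj; rewrite val_ppt ?rep_neq0// -val_projspace. Qed.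

Lemma rep_ppt v : v != 0 -> exists2 a, a != 0 & rep (ppt v) = a *: v.
Proof.
move=> v0; have : rep (ppt v) \in <[v]>%VS by rewrite -val_ppt// memv_pick.
move=> /vlineP[a aE]; exists a => //.
by apply: contraNneq (rep_neq0 (ppt v)) => a0; rewrite aE a0 scale0r.
Qed.

Lemma pptZ a v : a != 0 -> v != 0 -> ppt (a *: v) = ppt v.
Proof.
move=> a0 v0; apply/val_inj; rewrite !val_ppt ?scaler_eq0 ?(negbTE a0)//.
apply/eqP; rewrite eqEdim !dim_vline scaler_eq0 (negbTE a0) (negbTE v0)/= andbT.
by rewrite -memvE memvZ// memv_line.
Qed.

Lemma ppt_inj v w : v != 0 -> w != 0 -> ppt v = ppt w ->
  exists2 a, a != 0 & v = a *: w.
Proof.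
move=> v0 w0 /(congr1 val); rewrite !val_ppt// => vw.
have /vlineP[a vE] : v \in <[w]>%VS by rewrite -vw memv_line.
by exists a => //; apply: contraNneq v0 => a0; rewrite vE a0 scale0r.
Qed.

End ProjectivePoints.

Section VeroneseTangent.
Local Open Scope ring_scope.
Context {K : fieldType} {n d : nat}.
Hypotheses (charK : [pchar K] =i pred0) (d0 : (0 < d)%N).
Implicit Types (x w : 'rV[K]_n.+1) (v : 'rV[K]_(veroN n d).+1).

Lemma nu_ppt x : x != 0 -> nu d (ppt x) = ppt (vero_vec d x).
Proof.
move=> x0; have [a a0 aE] := rep_ppt x0; have y0 := vero_vec_neq0 d x0.
have ad0 : a ^+ d != 0 by rewrite expf_neq0.
rewrite -(pptZ ad0 y0); apply/val_inj; rewrite val_ppt /= ?aE ?vero_vecZ//.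
by rewrite scaler_eq0 negb_or ad0.
Qed.

(** The monomial x_i^(d-1) x_j: where x_i is nonzero, these monomials recover the point and serve as
    affine coordinates. *)
Definition vero_chart_mnm (i j : 'I_n.+1) : 'X_{1..n.+1} := (U_(i) *+ d.-1 + U_(j))%MM.

Lemma mdeg_vero_chart i j : mdeg (vero_chart_mnm i j) = d.
Proof. by rewrite mdegD mdegMn !mdeg1 mul1n addn1 prednK. Qed.

Definition vero_chart i j : 'I_(veroN n d).+1 := vero_idx (vero_chart_mnm i j).

Lemma vero_chart_mpoly i j :
  'X_[vero_mnm (vero_chart i j)] = 'X_i ^+ d.-1 * 'X_j :> {mpoly K[n.+1]}.
Proof. by rewrite vero_idxK ?mdeg_vero_chart// mpolyXD mpolyXn. Qed.

Lemma vero_vec_chart x i j : vero_vec d x 0 (vero_chart i j) = x 0 i ^+ d.-1 * x 0 j.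
Proof. by rewrite vero_vecE vero_chart_mpoly mevalM rmorphXn /= !mevalXU. Qed.

Lemma dirderXUn M (i : 'I_M) k (p w : 'I_M -> K) :
  dirder ('X_i ^+ k) p w = k%:R * (p i ^+ k.-1 * w i).
Proof.
elim: k => [|k IH]; first by rewrite expr0 dirder1 mul0r.
rewrite exprS dirderM dirderXU IH rmorphXn /= !mevalXU/=.
rewrite mulrCA -nat1r mulrDl mul1r [w i * _]mulrC; congr (_ + _).
by case: k {IH} => [|k]; rewrite ?mulr0n ?mul0r// [p i * _]mulrA -exprS.
Qed.

Lemma vero_jac_chart x w i j : (w *m vero_jac x) 0 (vero_chart i j) =
  d.-1%:R * (x 0 i ^+ d.-2 * w 0 i) * x 0 j + x 0 i ^+ d.-1 * w 0 j.
Proof.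
by rewrite vero_jacE vero_chart_mpoly dirderM dirderXUn dirderXU rmorphXn /= !mevalXU.
Qed.

Lemma vero_jac_chart_diag x w i : (w *m vero_jac x) 0 (vero_chart i i) =
  d%:R * (x 0 i ^+ d.-1 * w 0 i).
Proof.
have dE : d%:R = d.-1%:R + 1 :> K by rewrite natr1 prednK.
rewrite vero_jac_chart dE mulrDl mul1r; congr (_ + _).
case: d.-1 => [|k]; first by rewrite mulr0n !mul0r.
by rewrite /= exprSr -!mulrA [w 0 i * _]mulrC.
Qed.

Let dn0 : d%:R != 0 :> K.
Proof. by rewrite (pcharf0P K).1// -lt0n. Qed.

(** The entry of index (i, i) is d x_i^(d-1) w_i and gives w_i = 0, as d is nonzero in K; the
    entries (i, j) then give the other w_j. *)
Lemma vero_jac_inj x w : x != 0 -> w *m vero_jac (d := d) x = 0 -> w = 0.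
Proof.
move=> /rV0Pn[i xi] w0.
have wi : w 0 i = 0.
  have /eqP := vero_jac_chart_diag x w i; rewrite w0 mxE eq_sym !mulf_eq0.
  by rewrite (negbTE dn0) expf_eq0 (negbTE xi) andbF => /eqP.
apply/rowP => j; rewrite mxE.
have /eqP := vero_jac_chart x w i j; rewrite w0 mxE wi !mulr0 mul0r add0r eq_sym.
by rewrite mulf_eq0 expf_eq0 (negbTE xi) andbF => /eqP.
Qed.

Lemma nu_inj : injective (@nu K n d).
Proof.
move=> p q; rewrite -(ppt_rep p) -(ppt_rep q) !nu_ppt ?rep_neq0//.
set x := rep p; set y := rep q.
have x0 : x != 0 := rep_neq0 p; have y0 : y != 0 := rep_neq0 q.
move=> /(ppt_inj (vero_vec_neq0 d x0) (vero_vec_neq0 d y0))[a a0 xy].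
have /rV0Pn[i xi] := x0.
have E j : x 0 i ^+ d.-1 * x 0 j = a * (y 0 i ^+ d.-1 * y 0 j).
  by rewrite -!vero_vec_chart xy mxE.
have c0 : x 0 i ^+ d.-1 != 0 by rewrite expf_neq0.
have xE : x = ((x 0 i ^+ d.-1)^-1 * (a * y 0 i ^+ d.-1)) *: y.
  by apply/rowP => j; rewrite mxE -!mulrA -E mulKf.
rewrite xE pptZ//; apply: contraNneq x0 => b0.
by rewrite xE b0 scale0r.
Qed.

Lemma vero_jac_vanishing x w e (F : {mpoly K[(veroN n d).+1]}) : x != 0 ->
  F \is e.-homog -> (forall p, veronese K n d p -> hval F p = 0) ->
  dirder F (vero_vec d x 0) ((w *m vero_jac x) 0) = 0.
Proof.
move=> x0 eF F0.
pose c i := (x 0 i)%:P + w 0 i *: 'X : {poly K}.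
have cE s : (fun i => (c i).[s]) = (x + s *: w) 0.
  apply/funext => i.
  by rewrite hornerD hornerC hornerZ hornerX !mxE mulrC.
have dcE s : (fun i => (c i)^`().[s]) = w 0.
  apply/funext => i; rewrite derivD derivC add0r derivZ derivX hornerZ.
  by rewrite -[1]/(1%:P) hornerC mulr1.
have /choice[y yP] j := mpoly_curve 'X_[vero_mnm (n := n) (d := d) j] c.
have yE s : (fun j => (y j).[s]) = vero_vec d (x + s *: w) 0.
  by apply/funext => j; rewrite (yP j s).1 cE vero_vecE.
have dyE : (fun j => (y j)^`().[0]) = (w *m vero_jac x) 0.
  apply/funext => j; rewrite (yP j 0).2 cE dcE vero_jacE.
  by rewrite scale0r addr0.
have [q qP] := mpoly_curve F y.
have q0 : q = 0.
  apply: (poly_eq0_pointwise charK) => s; have /rV0Pn[i xi] := x0.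
  (* The curve x + s w may pass through 0, where it defines no projective point; discarding the
     zeros of a coordinate that is nonzero at s = 0 avoids this. *)
  apply: (polyfun_eq0_dense charK (q := fun s => (c i).[s]) (t := 0)).
  - by exists q.
  - by exists (c i).
  - by rewrite -[_.[0]]/((fun i => (c i).[0]) i) cE scale0r addr0.
  move=> t ct; rewrite (qP t).1 yE.
  have xt : x + t *: w != 0.
    by apply: contraNneq ct => xt; rewrite -[_.[t]]/((fun i => (c i).[t]) i) cE xt mxE.
  have := F0 (nu d (ppt (x + t *: w))) (ex_intro2 _ _ _ I erefl).
  rewrite /hval nu_ppt//; have [a a0 ->] := rep_ppt (vero_vec_neq0 d xt).
  under eq_fun do rewrite mxE.
  rewrite (meval_homogZ _ _ eF) => /eqP; rewrite mulf_eq0 expf_eq0 (negbTE a0).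
  by rewrite andbF => /eqP.
by have := (qP 0).2; rewrite q0 deriv0 horner0 yE dyE scale0r addr0.
Qed.

End VeroneseTangent.

Section VeroneseTangentSpace.
Local Open Scope ring_scope.
Context {K : fieldType} {n d : nat}.
Hypotheses (charK : [pchar K] =i pred0) (d0 : (0 < d)%N).

Lemma nu_rep (p : projspace K n) : nu d p = ppt (vero_vec d (rep p)).
Proof. by rewrite -nu_ppt ?rep_neq0// ppt_rep. Qed.

(* On the Veronese variety the coordinate of index vero_chart i l is x_i^(d-1) x_l. *)
Definition vero_relation (i : 'I_n.+1) (j : 'I_(veroN n d).+1) :
    {mpoly K[(veroN n d).+1]} :=
  'X_(vero_chart i i) ^+ d.-1 * 'X_j -
    \prod_l 'X_(vero_chart i l) ^+ vero_mnm j l.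

Lemma vero_relation_homog i j : vero_relation i j \is d.-homog.
Proof.
apply: rpredB.
  by rewrite mpolyXn -mpolyXD dhomogX/= mdegD mdegMn !mdeg1 mul1n addn1 prednK.
under eq_bigr do rewrite mpolyXn.
rewrite -(big_map (fun l => U_(vero_chart i l) *+ vero_mnm j l)%MM xpredT
  (fun m => 'X_[K, m])) mpolyX_prod big_map dhomogX/= mdeg_sum.
under eq_bigr do rewrite mdegMn mdeg1 mul1n.
by rewrite -mdegE mdeg_vero_mnm.
Qed.

Lemma vero_relation_vanish i j p : veronese K n d p -> hval (vero_relation i j) p = 0.
Proof.
move=> [q _ <-]; rewrite nu_rep; set x := rep q.
have [a a0 aE] := rep_ppt (vero_vec_neq0 d (rep_neq0 q)).
rewrite /hval -/x aE; under eq_fun do rewrite mxE.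
rewrite (meval_homogZ _ _ (vero_relation_homog i j)) mevalB mevalM rmorphXn/=.
rewrite rmorph_prod/= !mevalXU vero_vec_chart// vero_vecE mevalX.
under [X in _ - X]eq_bigr do rewrite rmorphXn/= mevalXU vero_vec_chart// exprMn.
rewrite big_split/=.
under [X in _ - X * _]eq_bigr do rewrite -exprM.
rewrite -expr_sum -big_distrr/= -mdegE mdeg_vero_mnm -exprSr prednK// exprM.
by rewrite exprAC subrr mulr0.
Qed.

(** Curves on the variety show that the image of the Jacobian is tangent. Conversely, a tangent
    vector is corrected by the Jacobian until its chart entries vanish, and [vero_relation] then
    forces all its entries to vanish. *)
Lemma tangent_nu p : tangent (veronese K n d) (nu d p) =
  limg (linfun (mulmxr (vero_jac (d := d) (rep p)))).
Proof.
set x := rep p; have x0 : x != 0 := rep_neq0 p.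
have [a a0 aE] := rep_ppt (vero_vec_neq0 d x0); rewrite -nu_rep in aE.
have dirE F (v : 'rV[K]_(veroN n d).+1) : \sum_(j < (veroN n d).+1) hval F^`M(j) (nu d p) * v 0 j =
    dirder F (fun j => a * vero_vec d x 0 j) (v 0).
  apply: eq_bigr => j _; congr (_ * _); apply: meval_eq => l.
  by rewrite aE mxE.
have jacT w : tangent_vector (veronese K n d) (nu d p) (w *m vero_jac x).
  move=> F [[e eF] F0]; rewrite dirE.
  apply: (mulfI a0); rewrite (dirder_homogZ charK _ _ _ eF).
  by rewrite (vero_jac_vanishing charK w x0 eF F0) !mulr0.
apply/vspaceP => v; apply/idP/idP; last first.
  by move=> /memv_imgP[w _ ->]; apply/tangentP; rewrite lfunE/=; exact: jacT.
move=> /tangentP vT; have /rV0Pn[i xi] := x0.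
have xk k : x 0 i ^+ k != 0 by rewrite expf_neq0.
have dn0 : d%:R != 0 :> K by rewrite (pcharf0P K).1// -lt0n.
have [b bE] : exists b, v 0 (vero_chart i i) = d%:R * (x 0 i ^+ d.-1 * b).
  exists (v 0 (vero_chart i i) / (d%:R * x 0 i ^+ d.-1)).
  by rewrite mulrA mulrC divfK// mulf_neq0.
(* Solved from the chart entries of v; the term with b is the contribution of the i-th entry of w,
   which is shown next to be b. *)
pose w := \row_j ((v 0 (vero_chart i j) -
  d.-1%:R * (x 0 i ^+ d.-2 * b) * x 0 j) / x 0 i ^+ d.-1).
have wi : w 0 i = b.
  rewrite mxE; apply: (mulIf (xk d.-1)); rewrite divfK// bE.
  have -> : d%:R = d.-1%:R + 1 :> K by rewrite natr1 prednK.
  rewrite mulrDl mul1r addrAC [RHS]mulrC -[RHS]add0r; congr (_ + _).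
  case: d.-1 => [|k]; first by rewrite mulr0n !mul0r subrr.
  by rewrite /= exprSr -!mulrA (mulrC b) subrr.
pose u := v - w *m vero_jac x.
have u_chart j : u 0 (vero_chart i j) = 0.
  rewrite /u mxE [X in _ + X]mxE vero_jac_chart// wi [w 0 j]mxE.
  by rewrite [x 0 i ^+ d.-1 * _]mulrC divfK// [X in - X]addrC subrK subrr.
have uT : tangent_vector (veronese K n d) (nu d p) u.
  move=> F FI; have := vT F FI; have := jacT w F FI; rewrite !dirE => wF vF.
  rewrite /u /dirder; under eq_bigr do rewrite mxE mulrDr.
  rewrite big_split/= -/(dirder F _ (v 0)) vF add0r.
  under eq_bigr do rewrite mxE mulrN.
  by rewrite sumrN -/(dirder F _ ((w *m vero_jac x) 0)) wF oppr0.
have u0 : u = 0.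
  apply/rowP => j; rewrite [RHS]mxE.
  have : vanishing_ideal (veronese K n d) (vero_relation i j).
    by split; [exists d; exact: vero_relation_homog|exact: vero_relation_vanish].
  move/uT.
  (* Since u vanishes on the chart entries, the derivative of the relation reduces to a nonzero
     multiple of the j-th entry of u. *)
  rewrite dirE /vero_relation dirderD dirderN dirderM dirderX_eq0; last first.
    by rewrite dirderXU u_chart.
  rewrite [dirder (\prod__ _) _ _]dirder_prod_eq0; last first.
    by move=> l; rewrite dirderX_eq0// dirderXU u_chart.
  rewrite mul0r add0r subr0 dirderXU rmorphXn/= mevalXU vero_vec_chart// -exprSr.
  by move/eqP; rewrite mulf_eq0 expf_eq0 mulf_eq0 (negbTE a0) (negbTE (xk _)) andbF => /eqP.
apply/memv_imgP; exists w; first exact: memvf.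
by rewrite lfunE/=; move/eqP: u0; rewrite subr_eq0 => /eqP.
Qed.

Lemma dim_tangent_nu p : \dim (tangent (veronese K n d) (nu d p)) = n.+1.
Proof.
pose f : 'Hom('rV[K]_n.+1, 'rV[K]_(veroN n d).+1) := linfun (mulmxr (vero_jac (rep p))).
have ker0 : (fullv :&: lker f = 0)%VS.
  apply/eqP; rewrite -subv0; apply/subvP => w; rewrite memv_cap => /andP[_].
  rewrite memv_ker lfunE/= memv0 => /eqP w0; apply/eqP.
  exact: (vero_jac_inj charK d0 (rep_neq0 p)) w0.
by rewrite tangent_nu -/f limg_dim_eq// dimvf/dim/= mul1n.
Qed.

End VeroneseTangentSpace.

(** * Limits along polynomial curves *)

Section CurveClosure.
Local Open Scope ring_scope.
Context {K : fieldType} {X : topologicalType} {r m : nat}.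
Context {x : 'I_r -> 'I_m -> X -> K}.
Hypotheses (charK : [pchar K] =i pred0) (gX : graded (uform x)).

(** A form vanishing on B pulls back to a polynomial in s, up to a nonzero factor, that vanishes
    where g does not, hence also at 0; separation concludes. *)
Lemma closure_curve (B : set X) (phi : K -> X) (g : K -> K) t
    (l : 'I_r -> K -> K) (q : 'I_r -> 'I_m -> K -> K) :
  polyfun g -> g t != 0 -> (forall s, g s != 0 -> B (phi s)) ->
  (forall i j, polyfun (q i j)) ->
  (forall s, g s != 0 \/ s = 0 -> forall i, l i s != 0 /\
    forall j, x i j (phi s) = l i s * q i j s) ->
  closure B (phi 0).
Proof.
move=> gp gt Bphi qp xphi; apply: contrapT => nB.
have [e [f [_ Vf f0 fphi]]] := graded_sep gX (@closed_closure _ B) nB.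
have [p pp fE] := @mform_pull _ _ _ _ x _ [set s | g s != 0 \/ s = 0] phi
  (fun=> @polyfun K) 0 l q (fun _ => @polyfun_cst K) (fun _ => @polyfunD K)
  (fun _ _ => @polyfunM K) qp (fun y i j Sy => (xphi y Sy i).2 j) _ _ Vf.
case/eqP: fphi; rewrite fE; last by right.
rewrite (polyfun_eq0_dense charK pp gp gt) ?mulr0// => s gs.
have := f0 _ (subset_closure (Bphi s gs)); rewrite fE; last by left.
move/eqP; rewrite mulf_eq0 prodf_seq_eq0 => /orP[/hasP[i _]|/eqP//].
by rewrite expf_eq0 (negbTE (xphi s (or_introl gs) i).1) andbF.
Qed.

End CurveClosure.

Lemma uform_boxpoly (K : fieldType) (X : Type) (r m k : nat)
    (x : 'I_r -> 'I_m -> X -> K) (S : set ('I_k -> K)) (phi : ('I_k -> K) -> X)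
    (c : nat) (l : 'I_r -> ('I_k -> K) -> K) (q : 'I_r -> 'I_m -> ('I_k -> K) -> K) :
  (forall i j, boxpoly c (q i j)) ->
  (forall y i j, S y -> x i j (phi y) = (l i y * q i j y)%R) ->
  forall e f, uform x e f -> exists2 p, boxpoly (c * r * e) p &
    forall y, S y -> f (phi y) = ((\prod_i l i y) ^+ e * p y)%R.
Proof.
move=> qc xq e f Vf.
have bc N a : @boxpoly K k N (fun=> a) by exact: boxpoly_leq (boxpoly_cst a).
have [p bp fE] := mform_pull bc (fun N => @boxpolyD K k N)
  (fun N N' => @boxpolyM K k N N') qc xq Vf.
exists p; first by move: bp; rewrite sum_nat_const card_ord mulnA.
by move=> y Sy; rewrite fE// prodrXl.
Qed.

Section VeronesePolynomials.
Local Open Scope ring_scope.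
Context {K : fieldType} {n d : nat}.

Lemma boxpoly_vero k N (x : ('I_k -> K) -> 'rV[K]_n.+1) :
  (forall i, boxpoly N (fun y => x y 0 i)) ->
  forall j, boxpoly (n.+1 * (d * N)) (fun y => vero_vec d (x y) 0 j).
Proof.
move=> xN j; under eq_fun do rewrite mxE.
have := @boxpoly_prod K k 'I_n.+1 (index_enum _) (d * N)
  (fun i y => x y 0 i ^+ tnth (enum_val (cast_ord (veroNE n d) j)) i).
have -> : size (index_enum 'I_n.+1) = n.+1 by rewrite [index_enum _]unlock -enumT size_enum_ord.
apply => i.
apply: (@boxpoly_leq _ _ (tnth (enum_val (cast_ord (veroNE n d) j)) i * N)).
  by rewrite leq_mul2r -ltnS ltn_ord orbT.
exact: boxpolyX.
Qed.

Lemma polyfun_vero (x : K -> 'rV[K]_n.+1) :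
  (forall i, polyfun (fun s => x s 0 i)) ->
  forall j, polyfun (fun s => vero_vec d (x s) 0 j).
Proof.
move=> xp j; under eq_fun do rewrite mxE.
by apply: polyfun_prod => i; exact: polyfunX.
Qed.

End VeronesePolynomials.

(** * Dimension and smoothness of the Veronese variety *)

Section VeroneseDimension.
Local Open Scope ring_scope.
Context {K : fieldType} {n d : nat}.
Hypotheses (charK : [pchar K] =i pred0) (d0 : (0 < d)%N).

(** Allows [dim_chart], stated for quotients, to be applied to the Veronese variety itself. *)
Lemma quotient_trivial (D : topologicalType) (V : nat -> set (D -> K)) :
  quotient_by V (fun (_ : 'S_1) => id) id.
Proof.
split=> //; last by move=> t; exists t.
by move=> x y; split=> [->|[_ ->]]//; exists 1%g.
Qed.

Definition affine_vec (y : 'I_n -> K) : 'rV[K]_n.+1 :=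
  \row_j (if unlift ord0 j is Some i then y i else 1).

Lemma affine_vec0 y : affine_vec y 0 0 = 1.
Proof. by rewrite mxE unlift_none. Qed.

Lemma affine_vec_lift y i : affine_vec y 0 (lift ord0 i) = y i.
Proof. by rewrite mxE liftK. Qed.

Lemma affine_vec_neq0 y : affine_vec y != 0.
Proof. by apply/rV0Pn; exists 0; rewrite affine_vec0 oner_neq0. Qed.

Lemma boxpoly_affine_vec j : boxpoly 1 (fun y => affine_vec y 0 j).
Proof.
under eq_fun do rewrite mxE; case: unliftP => [i _|_]; first exact: boxpoly_coord.
exact: boxpoly_leq (boxpoly_cst 1).
Qed.

Lemma ppt_affine_vec (x : 'rV[K]_n.+1) : x 0 0 != 0 ->
  exists y, ppt x = ppt (affine_vec y).
Proof.
move=> x0; exists (fun i => x 0 (lift ord0 i) / x 0 0).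
rewrite -(pptZ x0 (affine_vec_neq0 _)); congr ppt; apply/rowP => j.
rewrite mxE; case: (unliftP ord0 j) => [i ->|->].
  by rewrite affine_vec_lift mulrC divfK.
by rewrite affine_vec0 mulr1.
Qed.

Let phi (y : 'I_n -> K) : projspace K (veroN n d) := ppt (vero_vec d (affine_vec y)).

Lemma chart_veronese : chart (uform (@pcoord K (veroN n d))) phi (fun=> 1).
Proof.
have phi0 y := vero_vec_neq0 d (affine_vec_neq0 y).
have /choice[l lP] y : exists a, a != 0 /\
    rep (phi y) = a *: vero_vec d (affine_vec y).
  by have [a a0 aE] := rep_ppt (phi0 y); exists a.
split.
- exists (n.+1 * (d * 1))%N, l; split=> [y _|e f Vf]; first by have [] := lP y.
  have [|y i j _|p bp fE] := @uform_boxpoly _ _ _ _ _ (@pcoord K _) setT phi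
    (n.+1 * (d * 1)) (fun _ => l) (fun _ j y => vero_vec d (affine_vec y) 0 j)
    _ _ e f Vf.
  + by move=> _; apply: boxpoly_vero => i'; exact: boxpoly_affine_vec.
  + by rewrite /pcoord (lP y).2 mxE.
  exists p; first by move: bp; rewrite muln1.
  by move=> y _; rewrite fE// big_ord1.
- by exists 0%N; exact: boxpoly_cst.
- move=> i; exists 1%N, (pcoord 0 (vero_chart 0 (lift ord0 i))),
    (pcoord 0 (vero_chart 0 0)).
  have U j : uform (@pcoord K (veroN n d)) 1 (pcoord 0 j).
    rewrite /uform (_ : (fun=> 1%N) = fun l : 'I_1 => nat_of_bool (l == 0)).
      exact: mform_coord.
    by apply/funext => h; rewrite [h]ord1.
  split=> // y _; have [l0 lE] := lP y.
  have rE j : rep (phi y) 0 j = l y * vero_vec d (affine_vec y) 0 j by rewrite lE mxE.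
  rewrite /pcoord !rE !vero_vec_chart// affine_vec0 affine_vec_lift.
  by rewrite expr1n !mul1r mulr1 mulrC.
Qed.

Lemma has_dim_veronese : has_dim (veronese K n d) n.
Proof.
have [||//] := @dim_chart K _ _ _ charK (graded_projspace _) phi (fun=> 1)
  (fun=> 0) chart_veronese (oner_neq0 _) _ _ _ _ (quotient_trivial _) (veronese K n d).
- move=> _ [_ [y _ <-] <-]; exists (ppt (affine_vec y)) => //.
  by rewrite nu_ppt ?affine_vec_neq0.
move=> _ [p _ <-]; rewrite nu_rep; set x := rep p.
(* A point with x_0 = 0 is outside the affine chart; moving it along the basis vector e_0 brings it
   inside and exhibits it as a limit. *)
pose q s := x + s *: delta_mx 0 0.
have q00 s : q s 0 0 = x 0 0 + s by rewrite !mxE eqxx mulr1.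
have q0 s : x 0 0 + s != 0 \/ s = 0 -> q s != 0.
  move=> [xs|->]; last by rewrite /q scale0r addr0 rep_neq0.
  by apply/rV0Pn; exists 0; rewrite q00.
have -> : ppt (vero_vec d x) = ppt (vero_vec d (q 0)) by rewrite /q scale0r addr0.
have /choice[l lP] s : exists a, vero_vec d (q s) != 0 -> a != 0 /\
    rep (ppt (vero_vec d (q s))) = a *: vero_vec d (q s).
  have [q1|q1] := eqVneq (vero_vec d (q s)) 0; first by exists 1; rewrite q1.
  by have [a a0 aE] := rep_ppt q1; exists a.
apply: (closure_curve charK (graded_projspace _) (phi := fun s => ppt (vero_vec d (q s)))
  (g := fun s => x 0 0 + s) (t := 1 - x 0 0) (l := fun _ => l)
  (q := fun _ j s => vero_vec d (q s) 0 j)).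
- by apply: polyfunD; [exact: polyfun_cst|exact: polyfun_id].
- by rewrite addrC subrK oner_neq0.
- move=> s xs; have [|y yE] := @ppt_affine_vec (q s); first by rewrite q00.
  exists (phi y) => //; first by exists y => //=; rewrite oner_neq0.
  by rewrite /phi -!nu_ppt ?yE ?affine_vec_neq0//; apply: q0; left.
- move=> _; apply: polyfun_vero => i.
  rewrite (_ : (fun s => q s 0 i) = fun s => x 0 i + s * (delta_mx 0 0 : 'rV[K]_n.+1) 0 i).
    apply: polyfunD; first exact: polyfun_cst.
    by apply: polyfunM; [exact: polyfun_id|exact: polyfun_cst].
  by apply/funext => s; rewrite !mxE.
- move=> s xs i; have [|l0 lE] := lP s; first by rewrite vero_vec_neq0// q0.
  by split=> // j; rewrite /pcoord lE mxE.
Qed.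

Lemma smooth_veronese : smooth (veronese K n d) = veronese K n d.
Proof.
apply/seteqP; split=> [p []//|_ [p _ <-]]; split; first by exists p.
by rewrite /pdim dim_tangent_nu//; exact: has_dim_veronese.
Qed.

End VeroneseDimension.

(** * Double points and forms of degree d *)

Section TerraciniCriterion.
Local Open Scope ring_scope.
Context {K : fieldType} {n d : nat}.
Hypotheses (charK : [pchar K] =i pred0) (d0 : (0 < d)%N).
Implicit Types (A F G : {mpoly K[n.+1]}) (p v w : 'rV[K]_n.+1).

(* The double points at the x_i fail to impose independent conditions on forms
   of degree d. *)
Definition dependent r (x : 'I_r -> 'rV[K]_n.+1) :=
  exists W : 'I_r -> 'rV[K]_n.+1, (exists i, W i != 0) /\
    \sum_i W i *m vero_jac (d := d) (x i) = 0.

(** The tangent spaces are images of injective Jacobians of rank n + 1, so their sum is too small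
    iff it is not direct, iff the Jacobians satisfy a nontrivial relation. *)
Lemma dim_sum_tangent_nu r (t : 'I_r -> projspace K n) :
  (\dim (\sum_i tangent (veronese K n d) (nu d (t i)))%VS < r * n.+1)%N <->
  dependent (fun i => rep (t i)).
Proof.
rewrite ltnNge; have -> : (r * n.+1 = \sum_i \dim (tangent (veronese K n d) (nu d (t i))))%N.
  by under eq_bigr do rewrite dim_tangent_nu//; rewrite sum_nat_const card_ord.
have <- : directv (\sum_i tangent (veronese K n d) (nu d (t i)))%VS =
    (\sum_i \dim (tangent (veronese K n d) (nu d (t i))) <=
     \dim (\sum_i tangent (veronese K n d) (nu d (t i)))%VS)%N.
  by rewrite directvEgeq.
split=> [|[W [[i Wi] W0]]].
  apply: contraNP => ndep; apply/directv_sum_independent => u uT u0 i _.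
  have /choice[W WP] j : exists w, u j = w *m vero_jac (rep (t j)).
    have := uT j isT; rewrite tangent_nu// => /memv_imgP[w _ ->].
    by exists w; rewrite lfunE.
  rewrite WP; apply: contrapT => /eqP Wi; apply: ndep; exists W; split.
    by exists i; apply: contraNneq Wi => ->; rewrite mul0mx.
  by rewrite -[RHS]u0; apply: eq_bigr => j _; rewrite WP.
apply/directv_sum_independent => H.
case/eqP: Wi; apply: (vero_jac_inj charK d0 (rep_neq0 (t i))).
apply: (H (fun i => W i *m vero_jac (rep (t i)))) => // j _.
by rewrite tangent_nu//; apply/memv_imgP; exists (W j); rewrite ?memvf ?lfunE.
Qed.

Lemma homog_prod M (I : Type) (s : seq I) (e : I -> nat) (F : I -> {mpoly K[M]}) :
  (forall i, F i \is (e i).-homog) ->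
  \prod_(i <- s) F i \is (\sum_(i <- s) e i)%N.-homog.
Proof.
move=> eF; elim: s => [|i s IH]; first by rewrite !big_nil dhomog1.
by rewrite !big_cons dhomogM.
Qed.

(** Derivative at s = 0 of F((s + 1) p) = (s + 1)^e F(p). *)
Lemma euler_homog e F p : F \is e.-homog -> dirder F (p 0) (p 0) = e%:R * F.@[p 0].
Proof.
move=> eF; pose c j := p 0 j *: ('X + 1) : {poly K}.
have cE j s : (c j).[s] = (s + 1) * p 0 j.
  by rewrite hornerZ hornerD hornerX -[1]/(1%:P) hornerC mulrC.
have c0 j : (c j).[0] = p 0 j by rewrite cE add0r mul1r.
have c1 j : (c j)^`().[0] = p 0 j.
  rewrite derivZ derivD derivX -[X in _ + X^`()]/(1%:P) derivC addr0 hornerZ.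
  by rewrite -[1]/(1%:P) hornerC mulr1.
have := @dirder_curve K n.+1 charK F c (F.@[p 0] *: ('X + 1) ^+ e) 0.
rewrite (funext c0) (funext c1) => <- => [|s].
  rewrite derivZ deriv_exp derivD derivX -[X in _ + X^`()]/(1%:P) derivC addr0 mul1r.
  rewrite hornerZ hornerMn horner_exp hornerD hornerX -[1]/(1%:P) hornerC add0r.
  by rewrite expr1n mulrC.
rewrite hornerZ horner_exp hornerD hornerX -[1]/(1%:P) hornerC mulrC.
rewrite -(meval_homogZ _ _ eF); apply: meval_eq => j.
by rewrite cE.
Qed.

Definition linform M (a : 'I_M -> K) : {mpoly K[M]} := \sum_j a j *: 'X_j.

Lemma linform_homog M (a : 'I_M -> K) : linform a \is 1.-homog.
Proof. by apply: rpred_sum => j _; rewrite rpredZ// dhomogX/= mdeg1. Qed.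

Lemma meval_linform M (a p : 'I_M -> K) : (linform a).@[p] = \sum_j a j * p j.
Proof. by rewrite linear_sum/=; apply: eq_bigr => j _; rewrite mevalZ mevalXU. Qed.

Lemma dirder_linform M (a p w : 'I_M -> K) : dirder (linform a) p w = \sum_j a j * w j.
Proof. by rewrite dirder_sum; apply: eq_bigr => j _; rewrite dirderZ dirderXU. Qed.

(** The linear form is a coordinate of u minus its projection to U, chosen to be nonzero at v. *)
Lemma hyperplane_avoiding (U : {vspace 'rV[K]_n.+1}) v : v \notin U ->
  exists a, (forall u, u \in U -> (linform a).@[u 0] = 0) /\ (linform a).@[v 0] != 0.
Proof.
move=> vU; pose f u := u - projv U u.
have : f v != 0.
  apply: contraNneq vU => /eqP; rewrite subr_eq0 => /eqP ->.
  exact: memv_proj.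
move=> /rV0Pn[i fvi]; exists (fun j => f (delta_mx 0 j) 0 i).
have fE (u : 'rV[K]_n.+1) : (linform (fun j => f (delta_mx 0 j) 0 i)).@[u 0] = f u 0 i.
  rewrite meval_linform [in RHS](row_sum_delta u) /f linear_sum/= -sumrB summxE.
  by apply: eq_bigr => j _; rewrite linearZ/= -scalerBr [RHS]mxE mulrC.
by split=> [u uU|]; rewrite fE// /f projv_id// subrr mxE.
Qed.

Definition singular_at A p := A.@[p 0] = 0 /\ forall w, dirder A (p 0) (w 0) = 0.

Lemma singular_atM A F p : singular_at A p -> singular_at (A * F) p.
Proof.
by move=> [Ap dA]; split=> [|w]; rewrite ?mevalM ?dirderM ?dA Ap !mul0r ?addr0.
Qed.

Lemma singular_at_mul A F p : A.@[p 0] = 0 -> F.@[p 0] = 0 -> singular_at (A * F) p.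
Proof.
by move=> Ap Fp; split=> [|w]; rewrite ?mevalM ?dirderM Ap Fp ?mulr0 ?mul0r ?addr0.
Qed.

Lemma singular_at_prod (I : finType) (P : pred I) (F : I -> {mpoly K[n.+1]}) p i :
  P i -> singular_at (F i) p -> singular_at (\prod_(j | P j) F j) p.
Proof. by move=> Pi Fp; rewrite (bigD1 i)//=; exact: singular_atM. Qed.

Lemma dependent_homog r (x W : 'I_r -> 'rV[K]_n.+1) F :
  \sum_i W i *m vero_jac (d := d) (x i) = 0 -> F \is d.-homog ->
  \sum_i dirder F (x i 0) (W i 0) = 0.
Proof.
move=> W0 dF; under eq_bigr do rewrite (dirder_homog_vero _ _ dF).
rewrite exchange_big big1//= => j _; rewrite -mulr_sumr -[X in _ * X]summxE W0.
by rewrite mxE mulr0.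
Qed.

(* A form singular at all the points but x i, and not vanishing there, may be
   multiplied by arbitrary forms of the residual degree. *)
Lemma not_dependent r (x : 'I_r -> 'rV[K]_n.+1) : (forall i, x i != 0) ->
  (forall i, exists e A, [/\ (e < d)%N, A \is e.-homog, A.@[x i 0] != 0 &
    forall j, j != i -> singular_at A (x j)]) ->
  ~ dependent x.
Proof.
move=> x0 HA [W [[i Wi] W0]]; have [e [A [ed eA Axi sA]]] := HA i.
have AGd G : G \is (d - e).-homog -> A * G \is d.-homog.
  by move=> /(dhomogM eA); rewrite subnKC// ltnW.
have AG G : G \is (d - e).-homog -> dirder (A * G) (x i 0) (W i 0) = 0.
  move=> /AGd dAG; rewrite -[RHS](dependent_homog W0 dAG) (bigD1 i)//= [X in _ + X]big1 ?addr0//.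
  by move=> j ji; have [_ ->] := singular_atM G (sA j ji).
have xn0 : x i \notin 0%VS by rewrite memv0.
have [l [_ lx]] := hyperplane_avoiding xn0.
have lX k : linform l ^+ k \is k.-homog.
  by have := dhomogMn k (linform_homog l); rewrite mul1n.
(* A direction parallel to [x i] is detected through the Euler relation by the value of a form. Any
   other one is detected by a hyperplane through [x i], which uses one of the d - e spare
   degrees. *)
have [/vlineP[a aE]|Wx] := boolP (W i \in <[x i]>%VS).
  have a0 : a != 0 by apply: contraNneq Wi => a0; rewrite aE a0 scale0r.
  have := AG _ (lX (d - e)%N); rewrite aE.
  have -> : (a *: x i) 0 = fun j => a * x i 0 j by apply/funext => j; rewrite mxE.
  rewrite dirderZr (@euler_homog d); last by apply: AGd; exact: lX.
  move/eqP; rewrite mevalM rmorphXn/= !mulf_eq0 (negbTE a0) expf_eq0 (negbTE lx).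
  by rewrite (negbTE Axi) (pcharf0P K).1// eqn0Ngt d0 andbF.
have [h [hx hW]] := hyperplane_avoiding Wx.
have hxi : (linform h).@[x i 0] = 0 by apply: hx; exact: memv_line.
have dh : dirder (linform h) (x i 0) (W i 0) != 0.
  by rewrite dirder_linform -meval_linform.
have := AG (linform h * linform l ^+ (d - e).-1).
rewrite dirderM mevalM hxi mul0r mulr0 add0r dirderM hxi mul0r addr0.
rewrite rmorphXn/= => H; have /eqP : A.@[x i 0] * (dirder (linform h) (x i 0) (W i 0) *
    (linform l).@[x i 0] ^+ (d - e).-1) = 0.
  apply: H; have := dhomogM (linform_homog h) (lX (d - e).-1).
  by rewrite add1n prednK ?subn_gt0.
by rewrite !mulf_eq0 (negbTE Axi) (negbTE dh) expf_eq0 (negbTE lx) andbF.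
Qed.

End TerraciniCriterion.

(** * Too many double points on a linear subspace *)

Section DependentPoints.
Local Open Scope ring_scope.
Context {K : fieldType} {n d : nat}.
Hypotheses (charK : [pchar K] =i pred0).

(** Veronese maps commute with linear maps: the monomials of degree d in c B are forms of degree d
    in c, with coefficients M. Tangent vectors along a k-plane thus live in a space of dimension at
    most C(k + d, k). *)
Lemma vero_jac_mulmx k (B : 'M[K]_(k.+1, n.+1)) :
  exists M : 'M[K]_((veroN k d).+1, (veroN n d).+1), forall c a : 'rV[K]_k.+1,
    (a *m B) *m vero_jac (d := d) (c *m B) = (a *m vero_jac (d := d) c) *m M.
Proof.
pose F j : {mpoly K[k.+1]} := \prod_i linform (fun l => B l i) ^+ vero_mnm (d := d) j i.
have Fd j : F j \is d.-homog.
  have -> : d = (\sum_i vero_mnm (n := n) (d := d) j i)%N by rewrite -mdegE mdeg_vero_mnm.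
  apply: homog_prod => i.
  by have := dhomogMn (vero_mnm j i) (linform_homog (fun l => B l i)); rewrite mul1n.
have FE j (c : 'rV[K]_k.+1) : (F j).@[c 0] = 'X_[vero_mnm j].@[(c *m B) 0].
  rewrite mevalX rmorph_prod/=; apply: eq_bigr => i _.
  rewrite rmorphXn/= meval_linform mxE; congr (_ ^+ _).
  by apply: eq_bigr => l _; rewrite mulrC.
exists (\matrix_(b, j) (F j)@_(vero_mnm b)) => c a; apply/rowP => j.
rewrite vero_jacE mxE.
under eq_bigr do rewrite [X in _ * X]mxE mulrC.
rewrite -(dirder_homog_vero _ _ (Fd j)).
pose p l := (c 0 l)%:P + a 0 l *: 'X : {poly K}.
pose p' i := ((c *m B) 0 i)%:P + (a *m B) 0 i *: 'X : {poly K}.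
have pE s : (fun l => (p l).[s]) = (c + s *: a) 0.
  by apply/funext => l; rewrite hornerD hornerC hornerZ hornerX !mxE mulrC.
have p'E s : (fun l => (p' l).[s]) = ((c + s *: a) *m B) 0.
  apply/funext => l; rewrite hornerD hornerC hornerZ hornerX mulmxDl -scalemxAl.
  by rewrite [RHS]mxE [X in _ = _ + X]mxE mulrC.
have dpE s : (fun l => (p l)^`().[s]) = a 0.
  apply/funext => l; rewrite derivD derivC add0r derivZ derivX hornerZ.
  by rewrite -[1]/(1%:P) hornerC mulr1.
have dp'E s : (fun l => (p' l)^`().[s]) = (a *m B) 0.
  apply/funext => l; rewrite derivD derivC add0r derivZ derivX hornerZ.
  by rewrite -[1]/(1%:P) hornerC mulr1.
have [q qP] := mpoly_curve (F j) p.
have := @dirder_curve _ _ charK 'X_[vero_mnm j] p' q 0.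
rewrite dp'E p'E (qP 0).2 dpE pE scale0r addr0 => -> //= s.
by rewrite (qP s).1 pE p'E FE.
Qed.

(** Each point of P has k + 1 tangent directions inside L, too many for the dimension C(k + d, k)
    available to them; their relation is nonzero in the ambient space because [b] is free. *)
Lemma dependent_linear r (x : 'I_r -> 'rV[K]_n.+1) k (L : {vspace 'rV[K]_n.+1})
    (P : {set 'I_r}) :
  \dim L = k.+1 -> (forall i, i \in P -> x i \in L) ->
  ('C(k + d, k) < #|P| * k.+1)%N -> dependent (d := d) x.
Proof.
move=> dimL xL kP.
have [b bL] : exists b : k.+1.-tuple 'rV[K]_n.+1, basis_of L b.
  by rewrite -dimL; exists (vbasis L); exact: vbasisP.
pose B := \matrix_(l < k.+1) b`_l.
have BE (a : 'rV[K]_k.+1) : a *m B = \sum_l a 0 l *: b`_l.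
  by rewrite mulmx_sum_row; apply: eq_bigr => l _; rewrite rowK.
have [M MP] := vero_jac_mulmx B.
pose c i : 'rV[K]_k.+1 := \row_l coord b l (x i).
have xE i : i \in P -> x i = c i *m B.
  move=> /xL xi; rewrite {1}(coord_basis bL xi) BE.
  by apply: eq_bigr => l _; rewrite mxE.
pose J := ({i : 'I_r | i \in P} * 'I_k.+1)%type.
have cJ : (#|'I_(veroN k d).+1| < #|{: J}|)%N.
  rewrite card_ord card_prod card_sig card_ord prednK ?bin_gt0 ?leq_addr//.

have [al [[[i0 l0] al0] alP]] := @linear_dependency K _ _
  (fun (p : J) j => vero_jac (d := d) (c (val p.1)) p.2 j) cJ.
pose a i : 'rV[K]_k.+1 := \row_l (if insub i is Some i' then al (i', l) else 0).
have aE i' l : a (val i') 0 l = al (i', l) by rewrite mxE valK.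
exists (fun i => a i *m B); split.
  exists (val i0); apply: contraNneq al0 => aB.
  have /freeP/(_ (fun l => a (val i0) 0 l)) := basis_free bL.
  by rewrite -BE aB => /(_ erefl l0); rewrite aE => ->.
have aP i : i \notin P -> a i = 0.
  by move=> iP; apply/rowP => l; rewrite !mxE insubN.
rewrite (bigID (mem P))/= [X in _ + X]big1 ?addr0; last first.
  by move=> i /aP ->; rewrite !mul0mx.
under eq_bigr => i iP do rewrite xE// MP.
rewrite -mulmx_suml (_ : \sum_(i in P) _ = 0) ?mul0mx//.
apply/rowP => j; rewrite summxE [RHS]mxE -[RHS](alP j).
transitivity (\sum_i' \sum_l al (i', l) * vero_jac (d := d) (c (val i')) l j); last first.
  by rewrite pair_bigA; apply: eq_bigr => -[].
rewrite (reindex_omap (val : {i : 'I_r | i \in P} -> 'I_r) insub)/=; last first.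
  by move=> i iP; rewrite insubT.
apply: eq_big => [i'|i' _]; first by rewrite valK eqxx (valP i').
by rewrite mxE; apply: eq_bigr => l _; rewrite aE.
Qed.

End DependentPoints.

(** * Isolating a point from the others by products of hyperplanes *)

Section IndependentPoints.
Local Open Scope set_scope.
Local Open Scope ring_scope.
Context {K : fieldType} {n r : nat}.
Context {x : 'I_r -> 'rV[K]_n.+1}.
Hypothesis x_indep : forall i j, i != j -> x i \notin <[x j]>%VS.

Definition isolating (e : nat) (i : 'I_r) (J : {set 'I_r}) (A : {mpoly K[n.+1]}) :=
  [/\ A \is e.-homog, A.@[x i 0] != 0 & forall j, j \in J -> singular_at A (x j)].

(** Each point not yet covered costs degree 2, for the square of a hyperplane through it that avoids
    [x i]. *)
Lemma isolating_extend e i (J : {set 'I_r}) A : i \notin J -> isolating e i J A ->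
  exists A', isolating (e + 2 * (r - #|J|.+1)) i (~: [set i]) A'.
Proof.
move=> iJ [eA Ai sA].
have /choice[l lP] j : exists a, j != i -> (linform a).@[x j 0] = 0 /\
    (linform a).@[x i 0] != 0.
  have [->|ji] := eqVneq j i; first by exists (fun=> 0).
  have [|a [aj ai]] := hyperplane_avoiding (x_indep (i := i) (j := j) _).
    by rewrite eq_sym.
  by exists a => _; split=> //; apply: aj; exact: memv_line.
pose J' := ~: (i |: J).
have cJ' : #|J'| = (r - #|J|.+1)%N.
  by rewrite cardsCs finset.setCK cardsU1 iJ card_ord add1n.
exists (A * \prod_(j in J') (linform (l j) * linform (l j))); split.
- apply: dhomogM => //; rewrite -big_enum/=.
  have -> : (2 * (r - #|J|.+1) = \sum_(j <- enum J') 2)%N.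
    by rewrite big_enum/= sum_nat_const cJ' mulnC.
  apply: homog_prod => j.
  by rewrite -[2%N]/(1 + 1)%N dhomogM ?linform_homog.
- rewrite mevalM mulf_neq0// rmorph_prod/= prodf_seq_neq0.
  apply/allP => j _; apply/implyP; rewrite !inE negb_or => /andP[ji _].
  by have [_ li] := lP j ji; rewrite mevalM mulf_neq0.
- move=> j; rewrite !inE => ji; have [jJ|jJ] := boolP (j \in J).
    exact/singular_atM/sA.
  rewrite mulrC; apply: singular_atM.
  apply: (@singular_at_prod _ _ _ (mem J') _ _ j); first by rewrite !inE negb_or ji.
  by have [lj _] := lP j ji; exact: singular_at_mul.
Qed.

Definition line i j : {vspace 'rV[K]_n.+1} := (<[x i]> + <[x j]>)%VS.

Lemma lineC i j : line i j = line j i.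
Proof. exact: addvC. Qed.

Lemma line_l i j : x i \in line i j.
Proof. by rewrite -[x i]addr0 memv_add ?memv_line ?mem0v. Qed.

Lemma line_r i j : x j \in line i j.
Proof. by rewrite lineC line_l. Qed.

Lemma lineS i j l : x l \in line i j -> (line i l <= line i j)%VS.
Proof. by move=> xl; rewrite subv_add -!memvE line_l. Qed.

Lemma line_swap i j l : i != j -> x i \in line j l -> x l \in line i j.
Proof.
move=> ij /memv_addP[_ /vlineP[a ->] [_ /vlineP[b ->] E]].
have b0 : b != 0.
  apply: contraNneq (x_indep ij) => b0.
  by rewrite E b0 scale0r addr0 memvZ// memv_line.
rewrite (_ : x l = b^-1 *: (x i - a *: x j)).
  by rewrite memvZ// memvB ?memvZ ?line_l ?line_r.
by rewrite E addrC addKr scalerA mulVf// scale1r.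
Qed.

Lemma line_form i j l : x i \notin line j l -> exists a : 'I_n.+1 -> K,
  [/\ (linform a).@[x i 0] != 0, (linform a).@[x j 0] = 0 & (linform a).@[x l 0] = 0].
Proof.
move=> /hyperplane_avoiding[a [al ai]]; exists a.
by rewrite ai !al ?line_l ?line_r.
Qed.

Lemma off_line i j l : i != j -> x l \notin line i j -> x i \notin line j l.
Proof. by move=> ij; apply: contraNN; exact: line_swap. Qed.

Lemma isolating_pair i j l : x i \notin line j l -> exists A, isolating 2 i [set j; l] A.
Proof.
move=> /line_form[a [ai aj al]]; exists (linform a * linform a); split.
- by rewrite -[2%N]/(1 + 1)%N dhomogM ?linform_homog.
- by rewrite mevalM mulf_neq0.
- by move=> h; rewrite !inE => /orP[]/eqP->; exact: singular_at_mul.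
Qed.

Lemma isolatingM i e e' J J' A A' : isolating e i J A -> isolating e' i J' A' ->
  isolating (e + e') i (J :|: J') (A * A').
Proof.
move=> [eA Ai sA] [eA' Ai' sA']; split; first exact: dhomogM.
  by rewrite mevalM mulf_neq0.
move=> j; rewrite inE => /orP[/sA|/sA']; first exact: singular_atM.
by rewrite mulrC; exact: singular_atM.
Qed.

(** Each vertex lies on two of the three hyperplanes, so degree 3 covers three double points instead
    of the usual 6. *)
Lemma isolating_triangle i a b c :
  x i \notin line a b -> x i \notin line b c -> x i \notin line c a ->
  exists A, isolating 3 i [set a; b; c] A.
Proof.
move=> /line_form[f [fi fa fb]] /line_form[g [gi gb gc]] /line_form[h [hi hc ha]].
exists (linform f * linform g * linform h); split.
- by rewrite -[3%N]/(1 + 1 + 1)%N !dhomogM ?linform_homog.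
- by rewrite !mevalM !mulf_neq0.
- move=> j; rewrite !inE -orbA => /or3P[]/eqP->.
  + by apply: singular_at_mul; rewrite ?mevalM ?fa ?mul0r.
  + by apply: singular_atM; exact: singular_at_mul.
  + by apply: singular_at_mul; rewrite ?mevalM ?gc ?mulr0.
Qed.

Lemma card_lt_notin i (J : {set 'I_r}) : i \notin J -> (#|J| < r)%N.
Proof.
move=> iJ; have := subset_leq_card (finset.subsetT (i |: J)).
by rewrite cardsU1 iJ cardsT card_ord add1n.
Qed.

(** One pair covered in degree 2 and r - 3 single points: 2 + 2(r - 3) = 2r - 4. *)
Lemma isolating_noncollinear i : (1 < r)%N ->
  (forall j, i != j -> exists l, x l \notin line i j) ->
  exists A, isolating (2 * r - 4) i (~: [set i]) A.
Proof.
move=> r1 nl.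
have [j ij] : exists j, i != j.
  have /card_gt0P[j] : (0 < #|~: [set i]|)%N.
    by rewrite cardsCs finset.setCK cards1 card_ord subn_gt0.
  by rewrite !inE eq_sym; exists j.
have [l lij] := nl _ ij.
have il : i != l by apply: contraNneq lij => <-; exact: line_l.
have jl : j != l by apply: contraNneq lij => <-; exact: line_r.
have [A AP] := isolating_pair (off_line ij lij).
have iJ : i \notin [set j; l] by rewrite !inE negb_or ij.
have [A' A'P] := isolating_extend iJ AP; exists A'.
have := card_lt_notin iJ; rewrite cards2 jl => r2.
by move: A'P; rewrite cards2 jl; congr isolating; lia.
Qed.

(** Two disjoint pairs, each on a line avoiding [x i], and r - 5 single points: 4 + 2(r - 5) = 2r -
    6. *)
Lemma isolating_two_off i : (4 < r)%N ->
  (forall j, i != j -> exists b c, [/\ b != c, x b \notin line i j & x c \notin line i j]) ->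
  exists A, isolating (2 * r - 6) i (~: [set i]) A.
Proof.
move=> r4 nl.
suff [p [q [s [t [uJ npq nst]]]]] : exists p q s t, [/\ uniq [:: i; p; q; s; t],
    x i \notin line p q & x i \notin line s t].
  have [A AP] := isolating_pair npq; have [A' A'P] := isolating_pair nst.
  have iJ : i \notin [set p; q] :|: [set s; t].
    by rewrite !inE -!orbA; move: uJ; rewrite /= !inE => /andP[].
  have [B BP] := isolating_extend iJ (isolatingM AP A'P); exists B.
  move: BP; have -> : #|[set p; q] :|: [set s; t]| = 4.
    rewrite (_ : _ :|: _ = [set j in [:: p; q; s; t]]); last first.
      by apply/setP => j; rewrite !inE -!orbA.
    by move: uJ => /andP[_ uJ]; rewrite cardsE; exact/card_uniqP.
  by congr isolating; lia.
have [a ia] : exists j, i != j.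
  have /card_gt0P[j] : (0 < #|~: [set i]|)%N.
    by rewrite cardsCs finset.setCK cards1 card_ord subn_gt0; lia.
  by rewrite !inE eq_sym; exists j.
have [b [c [bc bL cL]]] := nl _ ia.
have neqL j h : x h \notin line i j -> (i != h) * (j != h).
  by move=> hL; split; apply: contraNneq hL => <-; rewrite ?line_l ?line_r.
have [ib ab] := neqL _ _ bL; have [ic ac] := neqL _ _ cL.
have [e] : exists e, e \notin [set i; a; b; c].
  apply/existsP; rewrite -negb_forall; apply: contraTN r4 => /forallP H.
  rewrite -leqNgt -[r]card_ord -cardsT.
  rewrite (_ : [set: 'I_r] = [set i; a; b; c]); last by apply/setP => j; rewrite H inE.
  by rewrite !cardsU !cards1; lia.
rewrite !inE -!orbA !negb_or => /and4P[ei ea eb ec].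
(* The pairs ab, ce or ac, be work unless [x i] is on both lines ce and be; in that case i, b, c, e
   are collinear, and a further point f off their line gives the pairs ab, fc. *)
have [iec|iec] := boolP (x i \in line c e); last first.
  exists a, b, c, e; split=> //; last exact: off_line.
  rewrite /= !inE !negb_or ia ib ic ab ac bc /=.
  by rewrite ![_ == e]eq_sym ei ea eb ec.
have [ieb|ieb] := boolP (x i \in line b e); last first.
  exists a, c, b, e; split=> //; last exact: off_line.
  rewrite /= !inE !negb_or ia ib ic ab ac [c == b]eq_sym bc /=.
  by rewrite ![_ == e]eq_sym ei ea eb ec.
have eb' := line_swap ib ieb.
have cb' : x c \in line i b.
  have : x c \in line i e by apply: line_swap; [rewrite eq_sym|rewrite lineC].
  by apply/subvP; exact: lineS.
have ab' : x a \notin line i b.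
  by apply: contraNN bL => aL; rewrite lineC; apply: line_swap => //; rewrite eq_sym.
(* Two points are off the line ib, so one of them is not a. *)
have [f [fb fa]] : exists f, x f \notin line i b /\ a != f.
  have [f [g [fg fL gL]]] := nl _ ib.
  have [af|af] := eqVneq a f; last by exists f.
  by exists g; rewrite af.
have [if' bf] := neqL _ _ fb.
have cf : c != f by apply: contraNneq fb => <-.
exists a, b, f, c; split; last 1 first.
- rewrite lineC; apply: off_line => //; apply: contraNN fb.
  by apply/subvP; exact: lineS.
- rewrite /= !inE !negb_or ia ib ic ab ac bc fa if' bf /=.
  by rewrite eq_sym cf.
- exact: off_line.
Qed.

(** With only three other points there are no two disjoint pairs; the triangle they form takes their
    place. *)
Lemma isolating_four i : r = 4 ->
  (forall j, i != j -> exists b c, [/\ b != c, x b \notin line i j & x c \notin line i j]) ->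
  exists A, isolating 3 i (~: [set i]) A.
Proof.
move=> r4 nl.
have [a ia] : exists j, i != j.
  have /card_gt0P[j] : (0 < #|~: [set i]|)%N.
    by rewrite cardsCs finset.setCK cards1 card_ord subn_gt0; lia.
  by rewrite !inE eq_sym; exists j.
have [b [c [bc bL cL]]] := nl _ ia.
have neqL j h : x h \notin line i j -> (i != h) * (j != h).
  by move=> hL; split; apply: contraNneq hL => <-; rewrite ?line_l ?line_r.
have [ib ab] := neqL _ _ bL; have [ic ac] := neqL _ _ cL.
have all4 j : j \in [:: i; a; b; c].
  have u4 : uniq [:: i; a; b; c].
    by rewrite /= !inE !negb_or ia ib ic ab ac bc.
  have /setP/(_ j) : [set j in [:: i; a; b; c]] = [set: 'I_r].
    apply/eqP; rewrite eqEcard finset.subsetT cardsT card_ord cardsE.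
    by have /card_uniqP -> := u4; rewrite /=; lia.
  by rewrite !inE => ->.
(* The two points off the line ib can only be a and c, as there are four points in all. *)
have cb : x c \notin line i b.
  have [f [g [fg fL gL]]] := nl _ ib.
  have [if' bf] := neqL _ _ fL; have [ig bg] := neqL _ _ gL.
  have := all4 f; have := all4 g; rewrite !inE.
  rewrite [g == i]eq_sym (negbTE ig) [g == b]eq_sym (negbTE bg).
  rewrite [f == i]eq_sym (negbTE if') [f == b]eq_sym (negbTE bf) /=.
  move=> /orP[/eqP ga|/eqP<-//] /orP[/eqP fa|/eqP<-//].
  by move: fg; rewrite fa ga eqxx.
have ica : x i \notin line c a by rewrite lineC; exact: off_line.
have [A AP] := isolating_triangle (off_line ia bL) (off_line ib cb) ica.
have iJ : i \notin [set a; b; c] by rewrite !inE -!orbA !negb_or ia ib ic.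
have [A' A'P] := isolating_extend iJ AP; exists A'.
have c3 : #|[set a; b; c]| = 3.
  rewrite (_ : [set a; b; c] = [set j in [:: a; b; c]]); last first.
    by apply/setP => j; rewrite !inE -!orbA.
  rewrite cardsE; have /card_uniqP -> // : uniq [:: a; b; c].
  by rewrite /= !inE negb_or ab ac bc.
by move: A'P; rewrite c3; congr isolating; lia.
Qed.

Lemma isolating_spanning i : x i \notin (\sum_(j | j != i) <[x j]>)%VS ->
  exists A, isolating 2 i (~: [set i]) A.
Proof.
move=> /hyperplane_avoiding[a [aU ai]]; exists (linform a * linform a); split.
- by rewrite -[2%N]/(1 + 1)%N dhomogM ?linform_homog.
- by rewrite mevalM mulf_neq0.
- move=> j; rewrite !inE => ji.
  have aj : (linform a).@[x j 0] = 0.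
    by apply: aU; apply: subvP (memv_line (x j)); exact: (sumv_sup j).
  exact: singular_at_mul.
Qed.

End IndependentPoints.

Lemma exists_superspace (K : fieldType) n (U : {vspace 'rV[K]_n.+1}) k :
  (\dim U <= k <= n.+1)%N -> exists L, (U <= L)%VS /\ \dim L = k.
Proof.
elim: k => [|k IH] /andP[Uk kn].
  by exists U; split=> //; apply/eqP; rewrite -leqn0.
have [Uk1|Uk1] := leqP (\dim U) k; last first.
  by exists U; split=> //; apply/eqP; rewrite eqn_leq Uk.
have [|L [UL dimL]] := IH; first by rewrite Uk1 ltnW.
have [v vL] : exists v, v \notin L.
  apply: contrapT => H; suff : (\dim (fullv : {vspace 'rV[K]_n.+1}) <= \dim L)%N.
    by rewrite dimL dimvf/dim/= mul1n; lia.
  by apply: dimvS; apply/subvP => v _; apply/negPn/negP => vL; apply: H; exists v.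
exists (L + <[v]>)%VS; split; first exact: subv_trans (addvSl _ _).
have v0 : v != 0%R by apply: contraNneq vL => ->; exact: mem0v.
rewrite dimv_disjoint_sum ?dimL ?dim_vline ?v0 ?addn1//.
apply/eqP; rewrite -subv0; apply/subvP => w; rewrite memv_cap => /andP[wL].
move=> /vlineP[a wE]; have [a0|a0] := eqVneq a 0%R.
  by rewrite wE a0 scale0r mem0v.
case/negP: vL; rewrite -[v]scale1r -(mulVf a0) -scalerA memvZ//.
by rewrite -wE.
Qed.

(** * From dependent double points to Terracini loci *)

Section TerraciniSets.
Local Open Scope ring_scope.
Context {K : fieldType} {n d : nat}.
Hypotheses (charK : [pchar K] =i pred0) (d0 : (0 < d)%N) (n0 : (0 < n)%N).

Definition coords r (t : dtuple K n r) (i : 'I_r) : 'rV[K]_n.+1 := rep (tnth (val t) i).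

Lemma coords_indep r (t : dtuple K n r) i j : i != j -> coords t i \notin <[coords t j]>%VS.
Proof.
apply: contraNN; rewrite /coords; set p := tnth _ i; set q := tnth _ j => pq.
have /(tuple_uniqP _ (valP t)) : p = q; last by move->.
apply/val_inj/eqP; rewrite eqEdim (eqP (valP p)) (eqP (valP q)) leqnn andbT.
by rewrite !val_projspace -memvE.
Qed.

Lemma perm_nu_unord r (t : dtuple K n r) (T : rsets K (veroN n d) r) :
  val T = [fset nu d q | q in val (unord t)]%fset ->
  perm_eq (val T : seq _) [seq nu d q | q <- val t].
Proof.
move=> TE; apply: uniq_perm; first exact: fset_uniq.
  by rewrite map_inj_uniq ?(valP t)//; exact: nu_inj.
move=> p; rewrite TE; apply/imfsetP/mapP => [[q /= qt ->]|[q qt ->]].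
  by exists q => //; rewrite -mem_unord.
by exists q => //=; rewrite mem_unord.
Qed.

Lemma terracini_condition r (t : dtuple K n r) (T : rsets K (veroN n d) r) :
  (0 < r)%N -> val T = [fset nu d q | q in val (unord t)]%fset ->
  (exists2 k, has_dim (veronese K n d) k &
     (pdim (\sum_(p <- val T) tangent (veronese K n d) p)%VS < r * k.+1 - 1)%N) <->
  dependent (d := d) (coords t).
Proof.
move=> r0 TE.
have -> : (\sum_(p <- val T) tangent (veronese K n d) p =
    \sum_i tangent (veronese K n d) (nu d (tnth (val t) i)))%VS.
  by rewrite (perm_big _ (perm_nu_unord TE)) big_map big_tuple.
have <- := dim_sum_tangent_nu charK d0 (tnth (val t)).
(* Makes the truncated predecessors harmless, also for a span of dimension 0. *)
have rn : (1 < r * n.+1)%N by case: (r) r0 => // r' _; lia.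
rewrite /pdim; split=> [[k kdim]|H].
  rewrite -(has_dim_inj (has_dim_veronese charK d0) kdim); lia.
by exists n; [exact: has_dim_veronese|lia].
Qed.

Lemma rsubsets_veronese r (T : rsets K (veroN n d) r) : rsubsets (veronese K n d) T ->
  exists t : dtuple K n r, val T = [fset nu d q | q in val (unord t)]%fset.
Proof.
move=> TX; have [t' t'T] := quot_surj (quotient_rsets (veroN n d) r) T.
have /choice[s sP] i : exists q, nu d q = tnth (val t') i.
  have [|q _ qE] := TX (tnth (val t') i); last by exists q.
  by rewrite -t'T mem_unord mem_tnth.
have us : uniq [tuple s i | i < r].
  apply/tuple_uniqP => i j; rewrite !tnth_mktuple => /(congr1 (nu d)).
  by rewrite !sP => /(tuple_uniqP _ (valP t')).
pose t : dtuple K n r := exist (fun t : r.-tuple (projspace K n) => uniq t) _ us.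
have tnth_t i : tnth (val t) i = s i by rewrite tnth_mktuple.
exists t; apply/fsetP => p; rewrite -t'T mem_unord.
apply/tnthP/imfsetP => [[i ->]|[q qt ->]].
  by exists (s i); rewrite ?sP// -tnth_t; change (tnth (val t) i \in val (unord t));
    rewrite mem_unord mem_tnth.
have : q \in val (unord t) by [].
by rewrite mem_unord => /tnthP[i ->]; exists i; rewrite tnth_t sP.
Qed.

(** As all points are smooth, the locus is determined by the dependent sets of points of projective
    space; it remains to describe these geometrically. *)
Lemma Ter_veronese r (P : rsets K n r -> Prop) : (0 < r)%N ->
  (forall t : dtuple K n r, dependent (d := d) (coords t) <-> P (unord t)) ->
  Ter r (veronese K n d) = closure_in (rsubsets (veronese K n d))
    [set T | exists S : rsets K n r, P S /\ val T = [fset nu d q | q in val S]%fset].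
Proof.
move=> r0 depP; rewrite /Ter smooth_veronese//; congr closure_in.
apply/seteqP; split=> T.
  move=> [/rsubsets_veronese[t tE] cT]; exists (unord t); split=> //.
  by apply/depP/(terracini_condition r0 tE).
move=> [S [PS TE]]; have [t tS] := quot_surj (quotient_rsets n r) S.
rewrite -tS in PS TE; split; last by apply/(terracini_condition r0 TE)/depP.
by move=> p; rewrite TE => /imfsetP[q _ ->]; exists q.
Qed.

Lemma dim_line r (t : dtuple K n r) i j : i != j -> \dim (line (x := coords t) i j) = 2%N.
Proof.
move=> ij; rewrite dimv_disjoint_sum ?dim_vline ?rep_neq0//.
apply/eqP; rewrite -subv0; apply/subvP => v; rewrite memv_cap => /andP[].
move=> /vlineP[a ->] aj; have [->|a1] := eqVneq a 0; first by rewrite scale0r mem0v.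
case/negP: (coords_indep t ij).
by rewrite -[coords t i]scale1r -(mulVf a1) -scalerA memvZ.
Qed.

Lemma mem_coords r (t : dtuple K n r) (L : {vspace 'rV[K]_n.+1}) i :
  (coords t i \in L) = (val (tnth (val t) i) <= L)%VS.
Proof. by rewrite [in RHS]val_projspace -memvE. Qed.

Lemma in_linear_coords k r (t : dtuple K n r) : in_linear k (val (unord t)) <->
  exists L, \dim L = k.+1 /\ forall i, coords t i \in L.
Proof.
split=> -[L [dimL tL]]; exists L; split=> //.
  by move=> i; rewrite mem_coords tL// mem_unord mem_tnth.
by move=> p; rewrite mem_unord => /tnthP[i ->]; rewrite -mem_coords.
Qed.

Lemma coords_neq0 r (t : dtuple K n r) i : coords t i != 0.
Proof. exact: rep_neq0. Qed.

Lemma not_dependent_isolating r (t : dtuple K n r) e : (e < d)%N ->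
  (forall i, exists A, isolating (x := coords t) e i (~: [set i]%SET) A) ->
  ~ dependent (d := d) (coords t).
Proof.
move=> ed HA; apply: (not_dependent charK d0 (coords_neq0 t)) => i.
have [A [eA Ai sA]] := HA i; exists e, A; split=> // j ji.
by apply: sA; rewrite !inE.
Qed.

(** The first bound says that 2r exceeds d + 1, the dimension of the forms of degree d on a line;
    the second that the isolating degree 2r - 4 is below d. *)
Lemma dependent_on_line r (t : dtuple K n r) : (d + 1 < r * 2)%N -> (2 * r <= d + 3)%N ->
  dependent (d := d) (coords t) <-> in_linear 1 (val (unord t)).
Proof.
move=> dr rd; split=> [dep|/in_linear_coords[L [dimL tL]]]; last first.
  apply: (dependent_linear charK (L := L) (P := [set: 'I_r]%SET) dimL) => //.
  by rewrite cardsT card_ord bin1 addnC.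
apply: contrapT => /in_linear_coords nl; move: dep.
apply: (not_dependent_isolating (e := 2 * r - 4)); first by lia.
move=> i; apply: isolating_noncollinear; [exact: coords_indep|lia|move=> j ij].
apply: contrapT => H; apply: nl; exists (line (x := coords t) i j).
split=> [|l]; first exact: dim_line.
by apply/negPn/negP => Hl; apply: H; exists l.
Qed.

End TerraciniSets.

Section TerraciniSpecial.
Local Open Scope ring_scope.
Context {K : fieldType} {n : nat}.
Hypotheses (charK : [pchar K] =i pred0).

(** Four double points of a plane impose 12 conditions on its 10-dimensional space of cubics. Four
    points not in a plane are independent, and a squared plane through three isolates the fourth in
    degree 2. *)
Lemma dependent_in_plane (t : dtuple K n 4) : (2 <= n)%N ->
  dependent (d := 3) (coords t) <-> in_linear 2 (val (unord t)).
Proof.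
move=> n2; split=> [dep|/in_linear_coords[L [dimL tL]]]; last first.
  apply: (dependent_linear charK (L := L) (P := [set: 'I_4]%SET) dimL) => //.
  by rewrite cardsT card_ord.
apply: contrapT => /in_linear_coords nl; move: dep.
apply: (not_dependent_isolating charK (d := 3) isT (e := 2)) => // i.
apply: isolating_spanning; apply/negP => iU; apply: nl.
set U := (\sum_(j | j != i) <[coords t j]>)%VS in iU.
(* Three points span at most a plane; the span is enlarged to dimension exactly 3, for which n >= 2
   leaves room. *)
have [L [UL dimL]] : exists L, (U <= L)%VS /\ \dim L = 3%N.
  apply: exists_superspace; apply/andP; split=> //.
  apply: leq_trans (dimv_leq_sum _ _ _) _.
  apply: (@leq_trans (\sum_(j < 4 | j != i) 1)).
    by apply: leq_sum => j _; rewrite dim_vline leq_b1.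
  by rewrite sum1_card cardC1 card_ord.
exists L; split=> // j; apply: (subvP UL).
have [->//|ji] := eqVneq j i.
by apply: subvP (memv_line (coords t j)); exact: (sumv_sup j).
Qed.

Lemma line_plus_point_coords r (t : dtuple K n r) :
  (exists (S : rsets K n (r - 1)) (p : projspace K n),
    in_linear 1 (val S) /\ p \notin val S /\ val (unord t) = (p |` val S)%fset) <->
  exists i L, \dim L = 2%N /\ forall j, j != i -> coords t j \in L.
Proof.
split=> [[S [p [[L [dimL SL]] [pS tE]]]]|[i [L [dimL tL]]]].
  have : p \in val (unord t) by rewrite tE fset1U1.
  rewrite mem_unord => /tnthP[i pE]; exists i, L; split=> // j ji.
  rewrite mem_coords SL//.
  have : tnth (val t) j \in val (unord t) by rewrite mem_unord mem_tnth.
  rewrite tE in_fset1U => /orP[/eqP jp|//].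
  by case/eqP: ji; apply: (tuple_uniqP _ (valP t)); rewrite jp pE.
set p := tnth (val t) i.
have pt : p \in val (unord t) by rewrite mem_unord mem_tnth.
have cS : #|` (val (unord t) `\ p)%fset| == (r - 1)%N.
  have ct : #|` val (unord t)| = r by apply/eqP; exact: (valP (unord t)).
  by rewrite -[in X in _ == X]ct (cardfsD1 p (val (unord t))) pt add1n subn1.
exists (exist (fun S : {fset projspace K n} => #|` S| == (r - 1)%N) _ cS), p; split.
  exists L; split=> // q.
  rewrite in_fsetD1 mem_unord => /andP[qp /tnthP[j qE]].
  rewrite qE -mem_coords; apply: tL.
  by apply: contraNneq qp => ji; rewrite qE ji.
by rewrite in_fsetD1 eqxx fsetD1K.
Qed.

(** The first bound makes the r - 1 points on the line dependent, as 2(r - 1) > d + 1; the second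
    puts the isolating degree 2r - 6 below d. *)
Lemma dependent_line_plus_point d r (t : dtuple K n r) : (4 <= d)%N ->
  (d + 3 < r * 2)%N -> (2 * r <= d + 5)%N ->
  dependent (d := d) (coords t) <->
  exists (S : rsets K n (r - 1)) (p : projspace K n),
    in_linear 1 (val S) /\ p \notin val S /\ val (unord t) = (p |` val S)%fset.
Proof.
move=> d4 dr rd; have d0 : (0 < d)%N by lia.
rewrite line_plus_point_coords; split=> [dep|[i [L [dimL tL]]]]; last first.
  apply: (dependent_linear charK (L := L) (P := ~: [set i]%SET) dimL).
    by move=> j; rewrite !inE; exact: tL.
  by rewrite cardsCs finset.setCK cards1 card_ord bin1; lia.
apply: contrapT => nl; move: dep.
have off i j : i != j -> exists b c, [/\ b != c,
    coords t b \notin line (x := coords t) i j & coords t c \notin line (x := coords t) i j].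
  move=> ij; apply: contrapT => H; apply: nl.
  have [[b bL]|all_in] := pselect (exists b, coords t b \notin line (x := coords t) i j).
    exists b, (line (x := coords t) i j); split=> [|c cb]; first exact: dim_line.
    by apply/negPn/negP => cL; apply: H; exists c, b.
  exists i, (line (x := coords t) i j); split=> [|c _]; first exact: dim_line.
  by apply/negPn/negP => cL; apply: all_in; exists c.
(* Here d = 4, and the triangle form has degree 3 < d. *)
have [r4|r4] := eqVneq r 4.
  apply: (not_dependent_isolating charK (d := d) d0 (e := 3)) => // i.
  apply: isolating_four => //; first exact: coords_indep.
  by move=> j; exact: off.
apply: (not_dependent_isolating charK d0 (e := 2 * r - 6)); first by lia.
move=> i; apply: isolating_two_off; [exact: coords_indep|lia|].
by move=> j; exact: off.
Qed.

End TerraciniSpecial.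

(** * Configurations of points *)

Section DeterminantLemmas.
Local Open Scope ring_scope.

Lemma det_scale_rows (R : comPzRingType) m (l : 'I_m -> R) (F : 'I_m -> 'I_m -> R) :
  \det (\matrix_(i, j) (l i * F i j)) = (\prod_i l i) * \det (\matrix_(i, j) F i j).
Proof.
rewrite big_distrr/=; apply: eq_bigr => s _; rewrite mulrCA; congr (_ * _).
by rewrite -big_split/=; apply: eq_bigr => i _; rewrite !mxE.
Qed.

(** Cramer's rule, without division. *)
Lemma det_replace_col (R : comPzRingType) m (C : 'M[R]_m) (u : 'I_m -> R) l :
  \det (\matrix_(i, j) (if j == l then \sum_b C i b * u b else C i j)) = u l * \det C.
Proof.
set M := \matrix_(i, j) _; rewrite (expand_det_col M l).
have cofE i : cofactor M i l = cofactor C i l.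
  rewrite /cofactor; congr (_ * \det _); apply/matrixP => i' j'.
  by rewrite !mxE eq_sym (negbTE (neq_lift _ _)).
transitivity (\sum_b u b * (\adj C *m C) l b).
  under eq_bigr do rewrite mxE eqxx cofE mulr_suml.
  rewrite exchange_big/=; apply: eq_bigr => b _; rewrite mxE mulr_sumr.
  by apply: eq_bigr => i _; rewrite !mxE -mulrA mulrCA; congr (_ * _); exact: mulrC.
rewrite mul_adj_mx (bigD1 l)//= big1 ?addr0 => [|b /negbTE bl].
  by rewrite mxE eqxx.
by rewrite mxE eq_sym bl mulr0.
Qed.

End DeterminantLemmas.

Lemma count_interval m a b : \sum_(j < m) (a < j <= b : nat) = minn m b.+1 - a.+1.
Proof.
elim: m => [|m IH]; first by rewrite big_ord0 min0n.
by rewrite big_ord_recr/= IH; case: (ltnP a m) => ?; case: (leqP m b) => ? /=; lia.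
Qed.

Section Configurations.
Local Open Scope ring_scope.
Context {K : fieldType} {n r k : nat} {X : pred 'I_r}.
Hypotheses (k0 : (0 < k)%N) (kn : (k.+1 <= n.+1)%N) (kr : (k.+1 <= r)%N).

Local Notation pt := (widen_ord kr).
Local Notation cl := (widen_ord kn).

(* The points outside X lie on the k-plane spanned by the rows (1 | u) of a
   reduced matrix, with affine coordinates c in that plane; the points in X are
   arbitrary. Parameters: u_(l,j) for k < j, and c_(i,j) for 0 < j <= nparam i. *)
Definition nparam i := if X i then n else k.

Definition is_param (p : 'I_k.+1 * 'I_n.+1 + 'I_r * 'I_n.+1) : bool :=
  match p with
  | inl (l, j) => (k < j)%N
  | inr (i, j) => (0 < j <= nparam i)%N
  end.

Definition param := {p | is_param p}.

(** The first term is the dimension of the Grassmannian of k-planes; each point adds k parameters,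
    or n if it is free. *)
Lemma card_param : #|{: param}| = (k.+1 * (n - k) + \sum_i nparam i)%N.
Proof.
rewrite card_sig -sum1_card big_mkcond/= big_sumType/=; congr (_ + _)%N.
  transitivity (\sum_(l < k.+1) \sum_(j < n.+1) (k < j <= n : nat))%N.
    rewrite pair_bigA; apply: eq_bigr => -[l j] _ /=.
    have -> : (j <= n)%N by rewrite -ltnS.
    by rewrite andbT inE/=; case: (k < j)%N.
  by rewrite sum_nat_const card_ord count_interval minnn subSS.
transitivity (\sum_(i < r) \sum_(j < n.+1) (0 < j <= nparam i : nat))%N.
  by rewrite pair_bigA; apply: eq_bigr => -[i j] _; rewrite inE/=; case: ifP.
apply: eq_bigr => i _; rewrite count_interval subn1 (minn_idPr _)//.
by rewrite /nparam; case: (X i).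
Qed.

Implicit Types (y : 'I_#|{: param}| -> K).

Definition param_val y p : K :=
  if insub p is Some q then y (enum_rank (q : param)) else 0.

(** Reduced echelon form, identity block followed by u: a general k-plane has exactly one such
    basis. *)
Definition conf_u y (l : 'I_k.+1) (j : 'I_n.+1) : K :=
  if (k < j)%N then param_val y (inl (l, j)) else (l == j :> nat)%:R.

Definition conf_c y (i : 'I_r) (j : 'I_n.+1) : K :=
  if j == 0 :> nat then 1 else if (j <= nparam i)%N then param_val y (inr (i, j)) else 0.

(** The basis being reduced, the leading entries of a point of the plane are its coordinates in that
    basis; this gives one formula for points on the plane and free points. *)
Definition conf_x y (i : 'I_r) : 'rV[K]_n.+1 :=
  \row_j (if (j <= nparam i)%N then conf_c y i j
          else \sum_l conf_c y i (cl l) * conf_u y l j).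

Definition coord1 : 'I_n.+1 := inord 1.

Lemma coord1E : coord1 = 1%N :> nat.
Proof. by rewrite inordK// ltnS; exact: leq_trans k0 kn. Qed.

(** The first factor lets coordinate 1 distinguish the points. The determinant concerns the first k
    + 1 points, from which the plane is to be recovered. *)
Definition conf_Q y : K :=
  \prod_(i < r) \prod_(j < r | (i < j)%N) (conf_c y i coord1 - conf_c y j coord1) *
  \det (\matrix_(a < k.+1, b < k.+1) conf_c y (pt a) (cl b)).

Lemma nparam_gt0 i : (0 < nparam i)%N.
Proof. by rewrite /nparam; case: (X i) => //; exact: leq_trans k0 kn. Qed.

Lemma conf_x0 y i : conf_x y i 0 0 = 1.
Proof. by rewrite mxE /conf_c. Qed.

Lemma conf_x_neq0 y i : conf_x y i != 0.
Proof. by apply/rV0Pn; exists 0; rewrite conf_x0 oner_neq0. Qed.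

Lemma conf_x1 y i : conf_x y i 0 coord1 = conf_c y i coord1.
Proof. by rewrite mxE coord1E nparam_gt0. Qed.

Lemma leq_nparam i (l : 'I_k.+1) : (l <= nparam i)%N.
Proof. by rewrite /nparam -ltnS; case: (X i) => //; exact: leq_trans (ltn_ord l) kn. Qed.

Lemma conf_xE y i : ~~ X i ->
  conf_x y i = \sum_l conf_c y i (cl l) *: \row_j conf_u y l j.
Proof.
move=> Xi; apply/rowP => j; rewrite summxE mxE.
under [RHS]eq_bigr do rewrite !mxE.
case: leqP => // jk; have jk' : (j < k.+1)%N by move: jk; rewrite /nparam (negbTE Xi) ltnS.
rewrite (bigD1 (Ordinal jk'))//= /conf_u ltnNge -ltnS jk'/= eqxx mulr1.
rewrite big1 ?addr0; last first.
  move=> l lj; rewrite (_ : (l == j :> nat) = false) ?mulr0//.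
  by apply: contraNF lj => /eqP lj; apply/eqP/val_inj.
by congr conf_c; apply/val_inj.
Qed.

Lemma prod_pairs_neq0 (D : 'I_r -> 'I_r -> K) :
  \prod_(i < r) \prod_(j < r | (i < j)%N) D i j != 0 <->
  forall i j : 'I_r, (i < j)%N -> D i j != 0.
Proof.
split=> [|H].
  rewrite prodf_seq_neq0 => /allP H i j ij; have := H i (mem_index_enum _).
  by rewrite /= prodf_seq_neq0 => /allP/(_ j (mem_index_enum _)); rewrite ij.
rewrite prodf_seq_neq0; apply/allP => i _ /=.
by rewrite prodf_seq_neq0; apply/allP => j _; apply/implyP; exact: H.
Qed.

Lemma conf_Q_inj y i j : conf_Q y != 0 -> i != j ->
  conf_c y i coord1 != conf_c y j coord1.
Proof.
rewrite mulf_eq0 negb_or => /andP[/prod_pairs_neq0 H _] ij.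
case: (ltngtP i j) => [/H|/H|/val_inj/eqP]; last by rewrite (negbTE ij).
  by rewrite subr_eq0.
by rewrite subr_eq0 eq_sym.
Qed.

Lemma conf_ppt_inj y : conf_Q y != 0 -> injective (fun i => ppt (conf_x y i)).
Proof.
move=> Qy i j /(ppt_inj (conf_x_neq0 _ _) (conf_x_neq0 _ _))[a _ xE].
apply/eqP/negPn/negP => ij; have := conf_Q_inj Qy ij; rewrite -!conf_x1.
have a1 : a = 1 by have := conf_x0 y i; rewrite xE mxE conf_x0 mulr1.
by rewrite xE a1 scale1r eqxx.
Qed.

Lemma boxpoly_param_val p : boxpoly 1 (fun y => param_val y p).
Proof.
rewrite /param_val; case: (insub p : option param) => [q|]; first exact: boxpoly_coord.
exact: boxpoly_leq (boxpoly_cst 0).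
Qed.

Lemma boxpoly_conf_c i j : boxpoly 1 (fun y => conf_c y i j).
Proof.
rewrite /conf_c; case: (j == 0 :> nat); first exact: boxpoly_leq (boxpoly_cst 1).
case: (j <= nparam i)%N; first exact: boxpoly_param_val.
exact: boxpoly_leq (boxpoly_cst 0).
Qed.

Lemma boxpoly_conf_x i j : boxpoly 2 (fun y => conf_x y i 0 j).
Proof.
under eq_fun do rewrite mxE; case: (j <= nparam i)%N.
  exact: boxpoly_leq (boxpoly_conf_c i j).
apply: boxpoly_sum => l; apply: (@boxpolyM _ _ 1 1); first exact: boxpoly_conf_c.
rewrite /conf_u; case: (k < j)%N; first exact: boxpoly_param_val.
exact: boxpoly_leq (boxpoly_cst _).
Qed.

Lemma boxpoly_conf_Q : exists N, boxpoly N conf_Q.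
Proof.
exists (size (index_enum 'I_r) * (size (index_enum 'I_r) * 1) +
  (0 + size (index_enum 'I_k.+1) * 1))%N.
apply: boxpolyM; last first.
  apply: boxpoly_sum => s; apply: boxpolyM; first exact: boxpoly_cst.
  apply: boxpoly_prod => i; under eq_fun do rewrite mxE.
  exact: boxpoly_conf_c.
apply: boxpoly_prod => i; under eq_fun do rewrite big_mkcond.
apply: boxpoly_prod => j; case: (i < j)%N; last exact: boxpoly_leq (boxpoly_cst 1).
apply: boxpolyD; first exact: boxpoly_conf_c.
under eq_fun do rewrite -mulN1r.
by apply: (@boxpolyM _ _ 0 1); [exact: boxpoly_cst|exact: boxpoly_conf_c].
Qed.

(** The condition for [b] and [M] to normalize to a point of the chart, with denominators cleared so
    that it is polynomial along a path. *)
Definition good_conf (b : 'I_k.+1 -> 'rV[K]_n.+1) (M : 'I_r -> 'rV[K]_n.+1) : K :=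
  \prod_i M i 0 0 * \det (\matrix_(l, j) b l 0 (cl j)) *
  (\prod_(i < r) \prod_(j < r | (i < j)%N)
     (M i 0 0 * M j 0 coord1 - M i 0 coord1 * M j 0 0)) *
  \det (\matrix_(a < k.+1, j < k.+1) M (pt a) 0 (cl j)).

(** Row reduction of [b] by its leading minor gives the parameters u; dividing each [M i] by its
    entry 0 gives the parameters c. *)
Lemma good_conf_param b M : good_conf b M != 0 ->
  (forall i, ~~ X i -> exists c, M i = \sum_l c l *: b l) ->
  exists y, conf_Q y != 0 /\ forall i, conf_x y i = (M i 0 0)^-1 *: M i.
Proof.
rewrite !mulf_eq0 !negb_or => /andP[/andP[/andP[M0 detb] /prod_pairs_neq0 M1] detM] Mb.
have {}M0 i : M i 0 0 != 0.
  by move: M0; rewrite prodf_seq_neq0 => /allP/(_ i (mem_index_enum _)).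
pose B := \matrix_(l, j) b l 0 (cl j).
have uB : B \in unitmx by rewrite unitmxE unitfE.
pose b' := \matrix_l b l.
pose u := invmx B *m b'.
pose y (q : 'I_#|{: param}|) := match val (enum_val q : param) with
  | inl (l, j) => u l j
  | inr (i, j) => M i 0 j / M i 0 0
  end.
have yE p : is_param p -> param_val y p = match p with
  | inl (l, j) => u l j | inr (i, j) => M i 0 j / M i 0 0 end.
  by move=> pP; rewrite /param_val insubT /y enum_rankK.
have cE i (j : 'I_n.+1) : (j <= nparam i)%N -> conf_c y i j = M i 0 j / M i 0 0.
  move=> ji; rewrite /conf_c; case: eqP => [j0|/eqP j0].
    by rewrite (_ : j = 0) ?divff//; exact/val_inj.
  by rewrite ji yE//= lt0n j0.
have u_cl l j : u l (cl j) = (l == j)%:R.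
  have := mulVmx uB => /matrixP/(_ l j); rewrite [RHS]mxE => <-.
  by rewrite /u !mxE; apply: eq_bigr => h _; rewrite !mxE.
have uE l j : conf_u y l j = u l j.
  rewrite /conf_u; case: ltnP => jk; first by rewrite yE.
  have jk' : (j < k.+1)%N by rewrite ltnS.
  have -> : j = cl (Ordinal jk') by exact/val_inj.
  by rewrite u_cl.
have Mu i j : ~~ X i -> M i 0 j = \sum_l M i 0 (cl l) * u l j.
  move=> /Mb[c ->].
  pose C := \row_l c l.
  have CE j' : (\sum_l c l *: b l) 0 j' = (C *m b') 0 j'.
    rewrite summxE mxE; apply: eq_bigr => l _.
    by rewrite !mxE.
  have bE : b' = B *m u by rewrite /u mulKVmx.
  rewrite CE bE mulmxA mxE; apply: eq_bigr => l _; congr (_ * _).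
  rewrite CE !mxE; apply: eq_bigr => h _; congr (_ * _).
  by rewrite !mxE.
have xE i : conf_x y i = (M i 0 0)^-1 *: M i.
  apply/rowP => j; rewrite !mxE; case: leqP => ji; first by rewrite cE// mulrC.
  have Xi : ~~ X i.
    by move: ji; rewrite /nparam; case: (X i) => //; rewrite ltnNge -ltnS ltn_ord.
  rewrite (Mu i j Xi) mulr_sumr; apply: eq_bigr => l _.
  by rewrite uE cE ?leq_nparam// mulrA [_^-1 * _]mulrC.
exists y; split=> //; rewrite mulf_neq0//.
  apply/prod_pairs_neq0 => i j ij; rewrite !cE ?coord1E ?nparam_gt0//.
  have := M1 i j ij; apply: contraNneq => /eqP.
  by rewrite subr_eq0 eqr_div// subr_eq0 eq_sym mulrC => /eqP->; rewrite mulrC.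
rewrite (_ : \matrix_(a, c) _ =
    \matrix_(a, c) ((M (pt a) 0 0)^-1 * M (pt a) 0 (cl c))); last first.
  by apply/matrixP => a c; rewrite !mxE cE ?leq_nparam// mulrC.
rewrite (det_scale_rows (fun a => (M (pt a) 0 0)^-1) (fun a c => M (pt a) 0 (cl c))).
rewrite mulf_neq0// prodf_seq_neq0; apply/allP => a _.
by rewrite invr_eq0 M0.
Qed.

End Configurations.

Section DistinctTuples.
Local Open Scope ring_scope.
Context {K : fieldType} {m r : nat}.

(* Junk value t0 unless the points are distinct. *)
Definition dtup (t0 : dtuple K m r) (v : 'I_r -> 'rV[K]_m.+1) : dtuple K m r :=
  insubd t0 [tuple ppt (v i) | i < r].

Lemma tnth_dtup t0 v i : injective (fun i => ppt (v i)) ->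
  tnth (val (dtup t0 v)) i = ppt (v i).
Proof.
move=> vi; rewrite insubdK ?tnth_mktuple//.
by apply/tuple_uniqP => j l; rewrite !tnth_mktuple => /vi.
Qed.

End DistinctTuples.

(** * Regular inverse of the parametrization of configurations *)

Section ConfigurationChart.
Local Open Scope ring_scope.
Context {K : fieldType} {n d r k : nat} {X : pred 'I_r}.
Hypotheses (k0 : (0 < k)%N) (kn : (k.+1 <= n.+1)%N) (kr : (k.+1 <= r)%N).
Hypothesis X_last : forall a : 'I_k.+1, ~~ X (widen_ord kr a).
Hypothesis charK : [pchar K] =i pred0.
Hypothesis d0 : (0 < d)%N.

Local Notation pt := (widen_ord kr).
Local Notation cl := (widen_ord kn).
Local Notation N := (veroN n d).
Local Notation param := (param (n := n) (r := r) (k := k) (X := X)).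
Local Notation conf_x := (conf_x (X := X) kn).
Local Notation conf_Q := (conf_Q (X := X) kn kr).
Implicit Types (y : 'I_#|{: param}| -> K).

Definition conf_tuple (t0 : dtuple K N r) y : dtuple K N r :=
  dtup t0 (fun i => vero_vec d (conf_x y i)).

Lemma conf_vero_inj y : conf_Q y != 0 ->
  injective (fun i => ppt (vero_vec d (conf_x y i))).
Proof.
move=> Qy i j; rewrite -!nu_ppt ?conf_x_neq0// => /(nu_inj d0).
exact: conf_ppt_inj Qy i j.
Qed.

Lemma tnth_conf_tuple t0 y i : conf_Q y != 0 ->
  tnth (val (conf_tuple t0 y)) i = nu d (ppt (conf_x y i)).
Proof.
by move=> Qy; rewrite tnth_dtup ?nu_ppt ?conf_x_neq0//; exact: conf_vero_inj.
Qed.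

(** The Veronese coordinate x_0^(d-1) x_j; as x_0 = 1 on the chart, it is x_j up to the scale of the
    representative. *)
Let z (i : 'I_r) (j : 'I_n.+1) : dtuple K N r -> K := tcoord i (vero_chart 0 j).

Let uform_prod (c : 'I_r -> 'I_n.+1) :
  uform (@tcoord K N r) 1 (fun t => \prod_i z i (c i) t).
Proof.
rewrite /uform (_ : (fun=> 1%N) = fun h => (\sum_i nat_of_bool (h == i))%N); last first.
  apply/funext => h; rewrite (bigD1 h)//= eqxx big1 ?addn0// => i.
  by rewrite eq_sym => /negbTE ->.
by apply: mform_prod => i; exact: mform_coord.
Qed.

(** The determinant has degree 1 in the first k + 1 points only; the factors [z i 0] with i > k
    bring the other points to degree 1. *)
Let uform_det (c : 'I_k.+1 -> 'I_n.+1) : uform (@tcoord K N r) 1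
  (fun t => \det (\matrix_(a, b) z (pt a) (c b) t) * \prod_i z i 0 t ^+ (k < i)%N).
Proof.
rewrite /uform (_ : (fun=> 1%N) = fun h =>
    (\sum_a nat_of_bool (h == pt a) + \sum_(i < r) (k < i)%N * nat_of_bool (h == i))%N).
  apply: mformM; last first.
    by apply: mform_prod => i; apply: mformX; exact: mform_coord.
  apply: mform_sum => s _; apply: mformZ.
  apply: (@mform_prod _ _ _ _ _ _ _ (fun a h => nat_of_bool (h == pt a))
    (fun a t => (\matrix_(a, b) z (pt a) (c b) t) a (s a))) => a.
  by under [X in mform _ _ X]eq_fun do rewrite mxE; exact: mform_coord.
apply/funext => h; rewrite [X in (_ + X)%N](bigD1 h)//= eqxx muln1.
rewrite [X in (_ + (_ + X))%N]big1 ?addn0; last first.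
  by move=> i; rewrite eq_sym => /negbTE ->; rewrite muln0.
have [kh|hk] := ltnP k h.
  rewrite big1// => a _; case: eqP => // ha.
  by move: kh; rewrite ha /= ltnNge -ltnS ltn_ord.
have hk' : (h < k.+1)%N by rewrite ltnS.
rewrite (bigD1 (Ordinal hk'))//= big1 ?addn0.
  by case: eqP => // -[]; exact/val_inj.
move=> a ah; case: eqP => // ha; case/eqP: ah; apply/val_inj.
by rewrite /= ha.
Qed.

(** The parameters c are quotients of coordinates of one point. The parameters u come from Cramer's
    rule applied to the first k + 1 points, which lie on the plane by [X_last]. *)
Lemma chart_conf t0 : chart (uform (@tcoord K N r)) (conf_tuple t0) conf_Q.
Proof.
have v0 y i := vero_vec_neq0 d (conf_x_neq0 (X := X) kn y i).
have /choice[l lP] (p : 'I_r * ('I_#|{: param}| -> K)) : exists a, a != 0 /\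
    rep (ppt (vero_vec d (conf_x p.2 p.1))) = a *: vero_vec d (conf_x p.2 p.1).
  by have [a a0 aE] := rep_ppt (v0 p.2 p.1); exists a.
have tE i j y : conf_Q y != 0 ->
    tcoord i j (conf_tuple t0 y) = l (i, y) * vero_vec d (conf_x y i) 0 j.
  move=> Qy; rewrite /tcoord tnth_dtup; last exact: conf_vero_inj.
  by rewrite (lP (i, y)).2 mxE.
have zE i j y : conf_Q y != 0 -> z i j (conf_tuple t0 y) = l (i, y) * conf_x y i 0 j.
  by move=> Qy; rewrite /z tE// vero_vec_chart// conf_x0 expr1n mul1r.
split.
- exists (n.+1 * (d * 2) * r)%N, (fun y => \prod_i l (i, y)); split=> [y _|e f Vf].
    by rewrite prodf_seq_neq0; apply/allP => i _; rewrite (lP (i, y)).1.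
  apply: (@uform_boxpoly _ _ _ _ _ _ [set y | conf_Q y != 0] _ _
    (fun i y => l (i, y)) (fun i j y => vero_vec d (conf_x y i) 0 j) _ _ e f Vf).
    by move=> i; apply: boxpoly_vero => j; exact: boxpoly_conf_x.
  by move=> y i j Qy; exact: tE.
- exact (boxpoly_conf_Q (X := X) kn kr).
move=> h; have := valP (enum_val h : param).
have yE y : y h = param_val y (val (enum_val h : param)).
  by rewrite /param_val valK enum_valK.
case: (val (enum_val h : param)) yE => [[b j] yE /= kj|[i j] yE /= /andP[j0 ji]].
  pose D (c : 'I_k.+1 -> 'I_n.+1) t :=
    \det (\matrix_(a, b) z (pt a) (c b) t) * \prod_i z i 0 t ^+ (k < i)%N.
  exists 1%N, (D (fun b' => if b' == b then j else cl b')), (D cl).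
  split; [exact: uform_det|exact: uform_det|move=> y Qy].
  have DE c : D c (conf_tuple t0 y) = (\prod_a l (pt a, y)) *
      \det (\matrix_(a, b) conf_x y (pt a) 0 (c b)) * \prod_i l (i, y) ^+ (k < i)%N.
    rewrite /D -(det_scale_rows (fun a => l (pt a, y))
      (fun a b => conf_x y (pt a) 0 (c b))); congr (\det _ * _).
      by apply/matrixP => a b'; rewrite [LHS]mxE zE// [RHS]mxE.
    by apply: eq_bigr => i _; rewrite zE// conf_x0 mulr1.
  rewrite !DE; have detQ : \matrix_(a, b) conf_x y (pt a) 0 (cl b) =
      \matrix_(a < k.+1, b < k.+1) conf_c y (pt a) (cl b).
    by apply/matrixP => a b'; rewrite !mxE /= leq_nparam.
  have -> : \det (\matrix_(a, b') conf_x y (pt a) 0 (if b' == b then j else cl b')) =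
      y h * \det (\matrix_(a, b) conf_x y (pt a) 0 (cl b)).
    have -> : y h = conf_u y b j by rewrite /conf_u kj yE.
    rewrite -(det_replace_col _ (fun l => conf_u y l j)); congr (\det _).
    apply/matrixP => a b'; rewrite [LHS]mxE [RHS]mxE; case: eqP => _; last by rewrite [RHS]mxE.
    rewrite (conf_xE kn y (X_last a)) summxE; apply: eq_bigr => c _.
    rewrite !mxE /= leq_nparam//.
  split; last by rewrite mulrCA -!mulrA.
  have /= := Qy; rewrite /conf_Q mulf_eq0 negb_or => /andP[_ detQ0].
  rewrite !mulf_neq0// ?detQ//; rewrite prodf_seq_neq0; apply/allP => a _ /=.
    exact: (lP (pt a, y)).1.
  by rewrite expf_neq0// (lP (a, y)).1.
exists 1%N, (fun t => \prod_i' z i' (if i' == i then j else 0) t),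
  (fun t => \prod_i' z i' 0 t); split; [exact: uform_prod|exact: (uform_prod (fun=> 0))|].
move=> y Qy; split.
  rewrite prodf_seq_neq0; apply/allP => i' _.
  by rewrite /= zE// conf_x0 mulr1 (lP (i', y)).1.
rewrite (bigD1 i)//= eqxx zE// [in RHS](bigD1 i)//= zE// conf_x0 mulr1.
have -> : conf_x y i 0 j = y h.
  by rewrite mxE ji /conf_c ji gtn_eqF// yE.
rewrite [RHS]mulrA [y h * l _]mulrC; congr (_ * _).
by apply: eq_bigr => i' /negbTE ->.
Qed.

End ConfigurationChart.

(** * Dimension of sets of configurations *)

Section ConfigurationDimension.
Local Open Scope ring_scope.
Context {K : fieldType} {n d r k : nat} {X : pred 'I_r}.
Hypotheses (k0 : (0 < k)%N) (kn : (k.+1 <= n.+1)%N) (kr : (k.+1 <= r)%N).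
Hypothesis X_last : forall a : 'I_k.+1, ~~ X (widen_ord kr a).
Hypothesis charK : [pchar K] =i pred0.
Hypothesis d0 : (0 < d)%N.

Local Notation pt := (widen_ord kr).
Local Notation cl := (widen_ord kn).
Local Notation N := (veroN n d).
Local Notation param := (param (n := n) (r := r) (k := k) (X := X)).
Local Notation conf_x := (conf_x (X := X) kn).
Local Notation conf_Q := (conf_Q (X := X) kn kr).
Local Notation coord1 := (@coord1 n).

Lemma polyfun_det m (F : 'I_m -> 'I_m -> K -> K) : (forall i j, polyfun (F i j)) ->
  polyfun (fun s => \det (\matrix_(i, j) F i j s)).
Proof.
move=> Fp; apply: polyfun_sum => s; apply: polyfunM; first exact: polyfun_cst.
by apply: polyfun_prod => i; under eq_fun do rewrite mxE.
Qed.

Let node i : K := i%:R.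

(** Points of a rational normal curve in the coordinate k-plane, in general position by the
    Vandermonde determinant. *)
Let base_x (i : 'I_r) : 'rV[K]_n.+1 := \sum_(l < k.+1) node i ^+ l *: delta_mx 0 (cl l).

Let base_x_cl i l : base_x i 0 (cl l) = node i ^+ l.
Proof.
rewrite summxE (bigD1 l)//= big1 ?addr0 => [|h /negbTE hl]; rewrite !mxE eqxx/=.
  by rewrite eqxx mulr1.
by rewrite -val_eqE/= [(l : nat) == _]eq_sym val_eqE hl mulr0.
Qed.

Lemma good_conf_base :
  good_conf kn kr (fun l => delta_mx 0 (cl l)) base_x != 0 :> K.
Proof.
have x0 i : base_x i 0 0 = 1.
  have -> : (0 : 'I_n.+1) = cl ord0 by exact/val_inj.
  by rewrite base_x_cl expr0.
have x1 i : base_x i 0 coord1 = node i.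
  have k1 : (1 < k.+1)%N by [].
  have -> : coord1 = cl (Ordinal k1) by apply/val_inj; rewrite /= (coord1E k0 kn).
  by rewrite base_x_cl expr1.
have nodeB (i j : nat) : (i < j)%N -> node j - node i != 0.
  move=> ij; rewrite subr_eq0; apply/eqP => /(natr_inj_pchar0 charK) E.
  by rewrite E ltnn in ij.
rewrite /good_conf !mulf_neq0//.
- by rewrite prodf_seq_neq0; apply/allP => i _; rewrite /= x0 oner_neq0.
- rewrite (_ : \matrix_(_, _) _ = 1%:M) ?det1 ?oner_neq0//.
  by apply/matrixP => l j; rewrite !mxE eqxx/= -val_eqE/= eq_sym.
- apply/prod_pairs_neq0 => i j ij; rewrite !x0 !x1 mul1r mulr1; exact: nodeB.
- rewrite -det_tr.
  rewrite (_ : _^T = Vandermonde k.+1 (\row_(a < k.+1) node (pt a))); last first.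
    by apply/matrixP => i j; rewrite !mxE base_x_cl.
  rewrite det_Vandermonde prodf_seq_neq0; apply/allP => a _ /=.
  rewrite prodf_seq_neq0; apply/allP => b _; apply/implyP => ab.
  by rewrite !mxE; exact: nodeB.
Qed.

Lemma exists_conf : exists y : 'I_#|{: param}| -> K, conf_Q y != 0.
Proof.
have [|y [Qy _]] := good_conf_param (X := X) k0 good_conf_base.
  by move=> i _; exists (fun l : 'I_k.+1 => node i ^+ l).
by exists y.
Qed.

Definition configuration (t : dtuple K n r) :=
  exists L, \dim L = k.+1 /\ forall i, ~~ X i -> coords t i \in L.

(** The configuration is at s = 0 of a path reaching the base configuration at s = 1; the path meets
    the chart wherever the polynomial [good_conf] is nonzero. *)
Lemma configuration_closure t (t' : dtuple K N r) : configuration t ->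
  (forall i, tnth (val t') i = nu d (tnth (val t) i)) ->
  closure (conf_tuple kn t' @` [set y | conf_Q y != 0]) t'.
Proof.
move=> [L [dimL tL]] tt'.
have [b bL] : exists b : k.+1.-tuple 'rV[K]_n.+1, basis_of L b.
  by rewrite -dimL; exists (vbasis L); exact: vbasisP.
pose mix (u v : K) s := u + s * (v - u).
have mix0 u v : mix u v 0 = u by rewrite /mix mul0r addr0.
have mix1 u v : mix u v 1 = v by rewrite /mix mul1r addrC subrK.
have mixp u v : polyfun (mix u v).
  apply: polyfunD; first exact: polyfun_cst.
  by apply: polyfunM; [exact: polyfun_id|exact: polyfun_cst].
(* Moving a basis of L and the coordinates in it, instead of the points themselves, keeps the points
   outside X on a common k-plane for all s. *)
pose B s (l : 'I_k.+1) : 'rV[K]_n.+1 :=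
  \row_j mix (b`_l 0 j) ((delta_mx 0 (cl l) : 'rV[K]_n.+1) 0 j) s.
pose c s i (l : 'I_k.+1) := mix (coord b l (coords t i)) (node i ^+ l) s.
pose M s (i : 'I_r) : 'rV[K]_n.+1 :=
  if X i then \row_j mix (coords t i 0 j) (base_x i 0 j) s
  else \sum_l c s i l *: B s l.
have Bp l j : polyfun (fun s => B s l 0 j) by under eq_fun do rewrite mxE.
have Mp i j : polyfun (fun s => M s i 0 j).
  rewrite /M; case: (X i); first by under eq_fun do rewrite mxE.
  under eq_fun do rewrite summxE; apply: polyfun_sum => l.
  by under eq_fun do rewrite mxE; apply: polyfunM; [exact: mixp|exact: Bp].
have M0 i : M 0 i = coords t i.
  rewrite /M; case: ifP => [_|/negbT/tL ti].
    by apply/rowP => j; rewrite mxE mix0.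
  rewrite [RHS](coord_basis bL ti); apply: eq_bigr => l _; rewrite /c mix0.
  by congr (_ *: _); apply/rowP => j; rewrite mxE mix0.
have B1 : B 1 = fun l => delta_mx 0 (cl l).
  by apply/funext => l; apply/rowP => j; rewrite mxE mix1.
have M1 : M 1 = base_x.
  apply/funext => i; rewrite /M; case: (X i).
    by apply/rowP => j; rewrite mxE mix1.
  by apply: eq_bigr => l _; rewrite /c mix1 B1.
pose g s := good_conf kn kr (B s) (M s).
have gp : polyfun g.
  have MMp i i' j j' : polyfun (fun s => M s i 0 j * M s i' 0 j').
    by apply: polyfunM; exact: Mp.
  apply: polyfunM; last by apply: polyfun_det => a j; exact: Mp.
  apply: polyfunM; last first.
    apply: polyfun_prod => i; apply: polyfun_prod => j; apply: polyfunD => //.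
    under eq_fun do rewrite -mulN1r.
    by apply: polyfunM; [exact: polyfun_cst|exact: MMp].
  apply: polyfunM; first by apply: polyfun_prod => i; exact: Mp.
  by apply: polyfun_det => l j; exact: Bp.
have g1 : g 1 != 0 by rewrite /g B1 M1; exact: good_conf_base.
have hit s : g s != 0 -> exists y, conf_Q y != 0 /\
    forall i, M s i 0 0 != 0 /\ conf_x y i = (M s i 0 0)^-1 *: M s i.
  move=> gs; have [|y [Qy yE]] := good_conf_param (X := X) k0 gs.
    by move=> i Xi; exists (c s i); rewrite /M (negbTE Xi).
  exists y; split=> // i; split=> //.
  move: gs; rewrite /g /good_conf !mulf_eq0 !negb_or => /andP[/andP[/andP[m0 _] _] _].
  by move: m0; rewrite prodf_seq_neq0 => /allP/(_ i (mem_index_enum _)).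
have Mn0 s i : g s != 0 \/ s = 0 -> M s i != 0.
  move=> [/hit[y [_ /(_ i)[m0 _]]]|->]; last by rewrite M0 coords_neq0.
  by apply/rV0Pn; exists 0.
have ptM s y i : M s i 0 0 != 0 -> conf_x y i = (M s i 0 0)^-1 *: M s i ->
    ppt (vero_vec d (M s i)) = ppt (vero_vec d (conf_x y i)).
  move=> m0 E; have Ms : M s i != 0 by apply/rV0Pn; exists 0.
  by rewrite -!nu_ppt ?conf_x_neq0// E pptZ// invr_eq0.
have pt0 i : ppt (vero_vec d (M 0 i)) = tnth (val t') i.
  by rewrite M0 -nu_ppt ?coords_neq0// ppt_rep tt'.
pose phi s := dtup t' (fun i => vero_vec d (M s i)).
have injM s : g s != 0 \/ s = 0 -> injective (fun i => ppt (vero_vec d (M s i))).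
  move=> [/hit[y [Qy yE]]|-> i j]; last by rewrite !pt0 => /(tuple_uniqP _ (valP t')).
  move=> i j; have [mi Ei] := yE i; have [mj Ej] := yE j.
  by rewrite (ptM _ _ _ mi Ei) (ptM _ _ _ mj Ej) => /(conf_vero_inj k0 d0 Qy).
have tphi s i : g s != 0 \/ s = 0 -> tnth (val (phi s)) i = ppt (vero_vec d (M s i)).
  by move=> gs; rewrite tnth_dtup//; exact: injM.
have <- : phi 0 = t'.
  apply/val_inj/eq_from_tnth => i; rewrite tphi; last by right.
  exact: pt0.
have /choice[l lP] (p : K * 'I_r) : exists a, (g p.1 != 0 \/ p.1 = 0) -> a != 0 /\
    rep (ppt (vero_vec d (M p.1 p.2))) = a *: vero_vec d (M p.1 p.2).
  have [gs|ngs] := pselect (g p.1 != 0 \/ p.1 = 0); last by exists 0.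
  by have [a a0 aE] := rep_ppt (vero_vec_neq0 d (Mn0 _ p.2 gs)); exists a.
apply: (closure_curve charK (graded_dtuple N r) (g := g) (t := 1)
  (l := fun i s => l (s, i)) (q := fun i j s => vero_vec d (M s i) 0 j)) => //.
- move=> s gs; have [y [Qy yE]] := hit s gs; exists y => //.
  apply/val_inj/eq_from_tnth => i; have [mi Ei] := yE i.
  rewrite tphi ?tnth_conf_tuple//; last by left.
  by rewrite nu_ppt ?conf_x_neq0// -(ptM _ _ _ mi Ei).
- by move=> i; apply: polyfun_vero => j; exact: Mp.
move=> s gs i; have [l0 lE] := lP (s, i) gs; split=> // j.
by rewrite /tcoord tphi// lE mxE.
Qed.

Lemma conf_x_configuration y t : (forall i, tnth (val t) i = ppt (conf_x y i)) ->
  configuration t.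
Proof.
move=> tE; pose U := <<[seq \row_j conf_u y l j | l : 'I_k.+1]>>%VS.
(* Enlarging the span to dimension k + 1 avoids proving the rows independent. *)
have [|L [UL dimL]] := @exists_superspace K n U k.+1.
  by rewrite kn andbT (leq_trans (dim_span _))// size_map size_enum_ord.
exists L; split=> // i Xi; rewrite /coords tE.
have [a _ ->] := rep_ppt (conf_x_neq0 kn y i); apply: memvZ.
rewrite conf_xE//; apply: memv_suml => l _; apply: memvZ.
apply: (subvP UL); apply: memv_span.
by apply/mapP; exists l; rewrite ?mem_enum.
Qed.

Lemma configuration_dim (P : rsets K n r -> Prop) :
  (forall S, P S <-> exists2 t, unord t = S & configuration t) ->
  let A := closure_in (rsubsets (veronese K n d))
    [set T : rsets K N r | exists S : rsets K n r, P S /\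
       val T = [fset nu d q | q in val S]%fset] in
  irreducible_set A /\ has_dim A (k.+1 * (n - k) + \sum_i nparam (n := n) (k := k) (X := X) i)%N.
Proof.
move=> PE A; rewrite -(card_param (X := X) kn).
have [y0 Qy0] := exists_conf.
have u0 : uniq [tuple nu d (ppt (conf_x y0 i)) | i < r].
  apply/tuple_uniqP => i j; rewrite !tnth_mktuple => /(nu_inj d0).
  exact: conf_ppt_inj k0 _ _ _ Qy0 i j.
pose t0 : dtuple K N r :=
  exist (fun t : r.-tuple (projspace K N) => uniq t) _ u0.
apply: (dim_chart charK (graded_dtuple N r) (chart_conf k0 kn X_last d0 t0) Qy0
  (quotient_rsets N r)).
- move=> _ [_ [y Qy <-] <-].
  have us : uniq [tuple ppt (conf_x y i) | i < r].
    apply/tuple_uniqP => i j; rewrite !tnth_mktuple.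
    exact: conf_ppt_inj k0 _ _ _ Qy i j.
  pose t : dtuple K n r := exist (fun t : r.-tuple (projspace K n) => uniq t) _ us.
  have tE i : tnth (val t) i = ppt (conf_x y i) by rewrite tnth_mktuple.
  have TE : val (unord (conf_tuple kn t0 y)) = [fset nu d q | q in val (unord t)]%fset.
    apply/fsetP => p; rewrite mem_unord.
    apply/tnthP/imfsetP => [[i ->]|[q qt ->]].
      exists (tnth (val t) i); last by rewrite tnth_conf_tuple// tE.
      by change (tnth (val t) i \in val (unord t)); rewrite mem_unord mem_tnth.
    have : q \in val (unord t) by [].
    by rewrite mem_unord => /tnthP[i ->]; exists i; rewrite tnth_conf_tuple// tE.
  have BT : exists S : rsets K n r, P S /\
      val (unord (conf_tuple kn t0 y)) = [fset nu d q | q in val S]%fset.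
    exists (unord t); split=> //; apply/PE; exists t => //.
    exact: conf_x_configuration tE.
  split; last exact: subset_closure.
  by move=> p; rewrite TE => /imfsetP[q _ ->]; exists q.
move=> T [_]; apply: closure_subset_closed; first exact: closed_closure.
move=> {}T [S [/PE[t <- tconf] TE]].
have us : uniq [tuple nu d (tnth (val t) i) | i < r].
  apply/tuple_uniqP => i j; rewrite !tnth_mktuple => /(nu_inj d0).
  exact: (tuple_uniqP _ (valP t)).
pose t' : dtuple K N r := exist (fun t : r.-tuple (projspace K N) => uniq t) _ us.
have t'E i : tnth (val t') i = nu d (tnth (val t) i) by rewrite tnth_mktuple.
have <- : unord t' = T.
  apply/val_inj/fsetP => p; rewrite mem_unord TE.
  apply/tnthP/imfsetP => [[i ->]|[q qt ->]].
    exists (tnth (val t) i); last by rewrite t'E.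
    by change (tnth (val t) i \in val (unord t)); rewrite mem_unord mem_tnth.
  have : q \in val (unord t) by [].
  by rewrite mem_unord => /tnthP[i ->]; exists i; rewrite t'E.
(* The two parametrizations differ only in their default tuple, which cannot occur where [conf_Q] is
   nonzero. *)
have sub : conf_tuple kn t' @` [set y | conf_Q y != 0] `<=`
    conf_tuple kn t0 @` [set y | conf_Q y != 0].
  move=> _ [y Qy <-]; exists y => //; apply/val_inj/eq_from_tnth => i.
  by rewrite !tnth_conf_tuple.
have := closureS sub (configuration_closure tconf t'E).
apply: (@closure_subset_closed _ _ [set u | closure _ (unord u)]).
  have [/(_ (@closed_closure _ (unord @` (conf_tuple kn t0 @` [set y | conf_Q y != 0]))))] :=
    quot_closed (quotient_rsets N r)
      (closure (unord @` (conf_tuple kn t0 @` [set y | conf_Q y != 0]))).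
  exact.
by move=> u uB; apply: subset_closure; exists u.
Qed.

End ConfigurationDimension.

(** * The three statements *)

Lemma configuration_all_linear (K : fieldType) n r k (S : rsets K n r) :
  in_linear k (val S) <->
  exists2 t, unord t = S & configuration (k := k) (X := pred0) t.
Proof.
split=> [SL|[t <- [L [dimL tL]]]].
  have [t tS] := quot_surj (quotient_rsets n r) S; exists t => //.
  move: SL; rewrite -tS => /in_linear_coords[L [dimL tL]].
  by exists L; split=> // i _; exact: tL.
by apply/in_linear_coords; exists L; split=> // i; exact: tL.
Qed.

(** A transposition moves the free point to the last index, so that the leading points of the chart
    lie on the line. *)
Lemma configuration_line_plus_point (K : fieldType) n r (r0 : 0 < r) (S : rsets K n r) :
  (exists (S' : rsets K n (r - 1)) (p : projspace K n),
    in_linear 1 (val S') /\ p \notin val S' /\ val S = (p |` val S')%fset) <->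
  exists2 t, unord t = S &
    configuration (k := 1) (X := [pred i : 'I_r | i == r.-1 :> nat]) t.
Proof.
have lastP : r.-1 < r by rewrite prednK.
pose last := Ordinal lastP.
split=> [|[t <- [L [dimL tL]]]]; last first.
  by apply/line_plus_point_coords; exists last, L.
have [t tS] := quot_surj (quotient_rsets n r) S.
rewrite -tS => /line_plus_point_coords[i [L [dimL tL]]].
exists (perm_dtuple (tperm i last) t); first by rewrite (quot_act (quotient_rsets n r)).
exists L; split=> // j jl; rewrite /coords tnth_perm_dtuple; apply: tL.
apply: contraNneq jl => ji; apply/eqP; apply: (congr1 (@nat_of_ord r) (y := last)).
by rewrite -(tpermK i last j) ji tpermL.
Qed.

Lemma rsets_line_plus_point (K : fieldType) n d r (r0 : 0 < r) :
  [set T : rsets K (veroN n d) r | exists (S : rsets K n (r - 1)) (p : projspace K n),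
     in_linear 1 (val S) /\ p \notin val S /\
     val T = [fset nu d q | q in (p |` val S)]%fset] =
  [set T | exists S : rsets K n r,
     (exists (S' : rsets K n (r - 1)) (p : projspace K n),
        in_linear 1 (val S') /\ p \notin val S' /\ val S = (p |` val S')%fset) /\
     val T = [fset nu d q | q in val S]%fset].
Proof.
apply/seteqP; split=> T.
  move=> [S [p [SL [pS TE]]]].
  have cS : #|` (p |` val S)%fset| == r.
    by rewrite cardfsU1 pS (eqP (valP S)) subnKC.
  exists (exist (fun S : {fset projspace K n} => #|` S| == r) _ cS); split=> //.
  by exists S, p.
move=> [S [[S' [p [S'L [pS' SE]]]] TE]]; exists S', p; split=> //; split=> //.
by rewrite TE SE.
Qed.

Theorem theorem6p6 (K : closedFieldType) (n d : nat)
    (charK : [pchar K]%R =i pred0) (hn : 2 <= n) (hd : 3 <= d) :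
  (let r := uphalf (d + 2) in
   Ter r (veronese K n d) =
     closure_in (rsubsets (veronese K n d))
       [set T | exists S : rsets K n r, in_linear 1 (val S) /\
          val T = [fset nu d q | q in val S]%fset] /\
   irreducible_set (Ter r (veronese K n d)) /\
   has_dim (Ter r (veronese K n d)) (2 * n + r - 2)) /\
  (Ter 4 (veronese K n 3) =
     closure_in (rsubsets (veronese K n 3))
       [set T | exists S : rsets K n 4, in_linear 2 (val S) /\
          val T = [fset nu 3 q | q in val S]%fset] /\
   irreducible_set (Ter 4 (veronese K n 3)) /\
   has_dim (Ter 4 (veronese K n 3)) (3 * n + 2)) /\
  (4 <= d ->
   let r := uphalf (d + 2) + 1 in
   Ter r (veronese K n d) =
     closure_in (rsubsets (veronese K n d))
       [set T | exists (S : rsets K n (r - 1)) (p : projspace K n),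
          in_linear 1 (val S) /\ p \notin val S /\
          val T = [fset nu d q | q in (p |` val S)]%fset] /\
   irreducible_set (Ter r (veronese K n d)) /\
   has_dim (Ter r (veronese K n d)) (3 * n + r - 3)).
Proof.
have d0 : 0 < d by lia.
(* Tells linear arithmetic that 2 [uphalf (d + 2)] is d + 2 or d + 3. *)
have halfE : odd (d + 2).+1 + (uphalf (d + 2)).*2 = (d + 2).+1.
  exact: odd_double_half.
have n0 : 0 < n by lia.
split; [|split].
- move=> r.
  have rE := @Ter_veronese K n d charK d0 n0 r (fun S => in_linear 1 (val S)).
  rewrite rE; [|by rewrite /r; lia|]; last first.
    by move=> t; apply: dependent_on_line => //; rewrite /r; lia.
  split=> //.
  have k1n : 2 <= n.+1 by lia.
  have k1r : 2 <= r by rewrite /r; lia.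
  have := @configuration_dim K n d r 1 pred0 isT k1n k1r (fun=> isT) charK d0
    (fun S => in_linear 1 (val S)) (configuration_all_linear 1).
  rewrite /= /nparam /= sum_nat_const card_ord.
  by rewrite (_ : 2 * (n - 1) + r * 1 = 2 * n + r - 2); last by lia.
- rewrite (@Ter_veronese K n 3 charK isT n0 4 (fun S => in_linear 2 (val S))) //; last first.
    by move=> t; exact: dependent_in_plane.
  split=> //.
  have k2n : 3 <= n.+1 by lia.
  have := @configuration_dim K n 3 4 2 pred0 isT k2n isT (fun=> isT) charK isT
    (fun S => in_linear 2 (val S)) (configuration_all_linear 2).
  rewrite /= /nparam /= sum_nat_const card_ord.
  by rewrite (_ : 3 * (n - 2) + 4 * 2 = 3 * n + 2); last by lia.
- move=> d4 r; have r0 : 0 < r by rewrite /r; lia.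
  rewrite (@rsets_line_plus_point K n d r r0).
  pose P (S : rsets K n r) := exists (S' : rsets K n (r - 1)) (p : projspace K n),
    in_linear 1 (val S') /\ p \notin val S' /\ val S = (p |` val S')%fset.
  rewrite (@Ter_veronese K n d charK d0 n0 r P) //; last first.
    by move=> t; apply: dependent_line_plus_point => //; rewrite /r; lia.
  split=> //.
  have k1n : 2 <= n.+1 by lia.
  have r2 : 2 < r by rewrite /r; lia.
  have k1r : 2 <= r by exact: ltnW.
  pose X := [pred i : 'I_r | i == r.-1 :> nat].
  have X_last (a : 'I_2) : ~~ X (widen_ord k1r a).
    by rewrite /X /= neq_ltn; have := ltn_ord a; lia.
  have := @configuration_dim K n d r 1 X isT k1n k1r X_last charK d0 P
    (configuration_line_plus_point r0).
  have -> : \sum_i nparam (n := n) (k := 1) (X := X) i = n + (r - 1).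
    have lastP : r.-1 < r by rewrite prednK.
    rewrite (bigD1 (Ordinal lastP))//= /nparam /= eqxx; congr (_ + _).
    rewrite (eq_bigr (fun=> 1)) => [|i il].
      by rewrite sum1_card cardC1 card_ord subn1.
    by case: ifP => // /eqP il'; case/eqP: il; apply/val_inj.
  by rewrite (_ : 2 * (n - 1) + (n + (r - 1)) = 3 * n + r - 3); last by lia.
Qed.
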